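(* Let $n\ge 2$ and let $f$ be a hyperbolic regular polynomial automorphism of $\mathbb{C}^n$. Then $f$ is Axiom A.
   Context: Let $f=(f_1,\dots,f_n)$ be a polynomial automorphism of $\mathbb{C}^n$ (a polynomial map with polynomial inverse), $d=\deg f=\max_i\deg f_i$. View $\mathbb{C}^n\subset\mathbb{P}^n$ with hyperplane at infinity $H_0$, and let $\hat f$ be the extension of $f$ to a meromorphic map of $\mathbb{P}^n$. If $F$ is the homogeneous degree-$d$ polynomial map of $\mathbb{C}^{n+1}$ inducing $\hat f$, the indeterminacy set is $I^+=\pi(F^{-1}(0)\setminus\{0\})\subset H_0$, where $\pi:\mathbb{C}^{n+1}\setminus\{0\}\to\mathbb{P}^n$ is the canonical projection; $I^-$ is the indeterminacy set of $\widehat{f^{-1}}$ defined in the same way. $f$ is regular if $d>1$ and $I^+\cap I^-=\emptyset$. $K^{\pm}=\{p\in\mathbb{C}^n:\{f^{\pm k}(p):k\in\mathbb{N}\}\text{ is bounded}\}$, $J^\pm=\partial K^\pm$, $J=J^+\cap J^-$. A compact $f$-invariant set $\Lambda$ is a hyperbolic set for $f$ if there is a continuous $Df$-invariant splitting $T_\Lambda\mathbb{C}^n=E^u\oplus E^s$ such that $Df$ is uniformly expanding on $E^u$ and uniformly contracting on $E^s$. $f$ is called hyperbolic if $J$ is a hyperbolic set for $f$ and the periodic points of $f|_J$ are dense in $J$. A point $x$ is nonwandering for $f$ if for every neighborhood $U$ of $x$ there is an integer $k\ge1$ with $U\cap f^k(U)\neq\emptyset$. A diffeomorphism of a Riemannian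 manifold is Axiom A if its set of nonwandering points is a hyperbolic set and the periodic points are dense in the nonwandering set. *)

(* Defs.v *)
From HB Require Import structures.
From mathcomp Require Import all_boot all_order all_algebra.
From mathcomp Require Import all_classical all_reals all_analysis.
From mathcomp Require Import complex.
(* The notations of mpoly clash with those of MathComp-Analysis. *)
From mathcomp Require Import -(notations) mpoly.

Set Implicit Arguments.
Unset Strict Implicit.
Unset Printing Implicit Defensive.

Import Order.TTheory GRing.Theory Num.Theory.
Import numFieldNormedType.Exports.

Local Open Scope classical_set_scope.
Local Open Scope ring_scope.
Local Open Scope complex_scope.

(* R[i], packed as a numClosedFieldType so that it and the spaces 'rV_n over it
   receive their canonical norm and topology from MathComp-Analysis. *)
Definition Cplx (R : realType) : numClosedFieldType := R[i].

Definition ofR (R : realType) (x : R) : Cplx R := x%:C.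

Section PolynomialMaps.
Variable R : realType.
Local Notation C := (Cplx R).

Definition polymap (m n : nat) (p : 'I_m -> mpoly n C) (z : 'rV[C]_n) :
  'rV[C]_m := \row_i meval (fun j => z 0 j) (p i).

(* [msize] is the total degree plus one. *)
Definition degmap (m n : nat) (p : 'I_m -> mpoly n C) : nat :=
  \max_(i < m) (msize (p i)).-1.

Record polyaut (n : nat) := PolyAut {
  pa_poly : 'I_n -> mpoly n C ;
  pa_ipoly : 'I_n -> mpoly n C ;
  pa_polyK : cancel (polymap pa_poly) (polymap pa_ipoly) ;
  pa_ipolyK : cancel (polymap pa_ipoly) (polymap pa_poly) }.

Definition pa_inv (n : nat) (f : polyaut n) : polyaut n :=
  PolyAut (pa_ipolyK f) (pa_polyK f).

Definition pa_fun (n : nat) (f : polyaut n) : 'rV[C]_n -> 'rV[C]_n :=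
  polymap (pa_poly f).

Definition pa_deg (n : nat) (f : polyaut n) : nat := degmap (pa_poly f).

(* X_0^d * p(X_1/X_0, ..., X_n/X_0), for p of degree at most d. *)
Definition homogenize (n d : nat) (p : mpoly n C) : mpoly n.+1 C :=
  \sum_(m <- msupp p)
     mcoeff m p *: mpolyX C (Multinom [tuple
       if unlift ord0 j is Some i then m i else (d - mdeg m)%N | j < n.+1]).

(* The components of the homogeneous map
     F(z_0, z) = (z_0^d, z_0^d f_1(z/z_0), ..., z_0^d f_n(z/z_0)),
   where C^n is embedded in P^n by z |-> [1 : z]. *)
Definition homog_lift (n : nat) (f : polyaut n) (i : 'I_n.+1) : mpoly n.+1 C :=
  if unlift ord0 i is Some j then homogenize (pa_deg f) (pa_poly f j)
  else homogenize (pa_deg f) 1.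

(* P^n is realized as the set of orbits of C^* in C^(n+1) \ {0}. *)
Definition projpt (n : nat) (z : 'rV[C]_n.+1) : set 'rV[C]_n.+1 :=
  [set c *: z | c in [set c : C | c != 0]].

Definition indeterminacy (n : nat) (f : polyaut n) : set (set 'rV[C]_n.+1) :=
  @projpt n @` ([set z | polymap (homog_lift f) z = 0] `\ 0).

Definition regular (n : nat) (f : polyaut n) : Prop :=
  (1 < pa_deg f)%N /\ indeterminacy f `&` indeterminacy (pa_inv f) = set0.

Definition Kplus (n : nat) (f : polyaut n) : set 'rV[C]_n :=
  [set p | bounded_set (range (fun k => iter k (pa_fun f) p))].

Definition Jplus (n : nat) (f : polyaut n) : set 'rV[C]_n :=
  closure (Kplus f) `\` (Kplus f)°.

Definition Julia (n : nat) (f : polyaut n) : set 'rV[C]_n :=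
  Jplus f `&` Jplus (pa_inv f).

End PolynomialMaps.

Section Dynamics.
Variables (R : realType) (n : nat).
Local Notation C := (Cplx R).
Local Notation V := ('rV[C]_n).

(* E is a continuous subbundle of the restriction to L of the real tangent
   bundle: locally on L, it has a continuous frame.  As for diffeomorphisms of
   a Riemannian manifold, the fibres are real linear subspaces; they are not
   required to be complex ones. *)
Definition subbundle (L : set V) (E : V -> set V) : Prop :=
  forall p, L p -> exists U, nbhs p U /\
    exists (k : nat) (e : 'I_k -> V -> V),
      (forall i, {within L `&` U, continuous (e i)}) /\
      (forall q, (L `&` U) q ->
        let comb (a : 'rV[R]_k) := \sum_(i < k) ofR (a 0 i) *: e i q in
        injective comb /\ E q = range comb).

Definition splitting (L : set V) (Eu Es : V -> set V) : Prop :=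
  forall p, L p -> Eu p `&` Es p = [set 0] /\
    [set u + s | u in Eu p & s in Es p] = setT.

Definition invariant_bundle (f : V -> V) (L : set V) (E : V -> set V) : Prop :=
  forall p, L p -> 'd f p @` E p = E (f p).

Definition expanding (f : V -> V) (L : set V) (E : V -> set V) : Prop :=
  exists c mu : R, 0 < c /\ 1 < mu /\
    forall (k : nat) p v, L p -> E p v ->
      ofR (c * mu ^+ k) * `|v| <= `|'d (iter k f) p v|.

Definition contracting (f : V -> V) (L : set V) (E : V -> set V) : Prop :=
  exists c mu : R, 0 < c /\ 0 < mu < 1 /\
    forall (k : nat) p v, L p -> E p v ->
      `|'d (iter k f) p v| <= ofR (c * mu ^+ k) * `|v|.

Definition hyperbolic_set (f : V -> V) (L : set V) : Prop :=
  compact L /\ f @` L = L /\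
  exists Eu Es : V -> set V,
    [/\ subbundle L Eu, subbundle L Es & splitting L Eu Es] /\
    [/\ invariant_bundle f L Eu, invariant_bundle f L Es,
        expanding f L Eu & contracting f L Es].

Definition periodic_points (f : V -> V) : set V :=
  [set p | exists2 k, (0 < k)%N & iter k f p = p].

Definition nonwandering (f : V -> V) : set V :=
  [set x | forall U, nbhs x U ->
     exists2 k, (0 < k)%N & U `&` iter k f @` U !=set0].

Definition hyperbolic (f : polyaut R n) : Prop :=
  hyperbolic_set (pa_fun f) (Julia f) /\
  Julia f `<=` closure (Julia f `&` periodic_points (pa_fun f)).

Definition axiomA (f : V -> V) : Prop :=
  hyperbolic_set f (nonwandering f) /\
  nonwandering f `<=` closure (nonwandering f `&` periodic_points f).

End Dynamics.

(* Main.v *)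
Require Import Defs.
From mathcomp Require Import all_boot all_order all_algebra.
From mathcomp Require Import all_classical all_reals all_analysis.
From mathcomp Require Import complex.
From mathcomp Require Import -(notations) mpoly.
From mathcomp Require Import perm ring lra zify.

Set Implicit Arguments.
Unset Strict Implicit.
Unset Printing Implicit Defensive.

Import Order.TTheory GRing.Theory Num.Theory.
Import numFieldNormedType.Exports.

Local Open Scope classical_set_scope.
Local Open Scope ring_scope.

(* Regularity gives the filtration at infinity: outside a ball, [f] or its inverse [g] at
   least doubles the norm.  Hence nonwandering points lie in the compact set K = K+ /\ K-.
   The Jacobian determinants of [f] and [g] are constants with product 1, and exchanging
   [f] and [g] we may assume that [g] does not contract volume; then int K- is contained
   in int K+, so the nonwandering set is J together with the set A of nonwandering points
   in int K+.
   An unstable cone argument shows that no orbit staying close to J starts in int K+,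
   whence A is at positive distance from J and compact.  Limits of iterates are normal on
   int K+; if A had non-isolated points, then at one of maximal Euclidean norm the maximum
   principle (in the form of Parseval's identity) would force the derivatives of the
   iterates along a recurrence sequence to tend to 0, so the point would be an isolated
   attracting periodic point, which is absurd.  So A consists of finitely many periodic
   sinks, and the hyperbolic splitting on J extends by the trivial one on A.
   Compactness arguments use limits along a fixed free ultrafilter [F] on [nat]. *)

(** * Real norms on complex vector spaces *)

Section RealNorm.
Variable R : realType.
Local Notation C := (Cplx R).

(** Holomorphy enters only through polynomials: every iterate of [f], restricted to a complex line,
    is a vector of one-variable polynomials. Means over circles are taken discretely, by averaging
    over the two square roots of a point, which halves the degree until a constant remains.
    Normality takes the form of bounds and Lipschitz constants valid for all iterates at once.

    The hypothesis concerns only J, the points of K interior to neither K+ nor K-, whereas Axiom A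
    concerns every nonwandering point. Once volume has placed int K- inside int K+, the danger left
    is that nonwandering points of int K+ accumulate at J. It is excluded by following backward
    orbits to their first exit from a neighbourhood of J: a limit of exit points lies in K, and the
    forward orbit of its image stays close to J, which forces it into J although exit points are
    away from J.

    The fibres of a hyperbolic splitting are real subspaces without given angles, so cones are
    compared through the components of vectors, and uniform constants come from limits of normalized
    counterexamples. *)

Definition cmod (c : C) : R := complex.Re `|c|.

Lemma ofR_Re (c : C) : 0 <= c -> c = ofR (complex.Re c).
Proof. by move=> /ger0_Im; case: c => a b /= ->. Qed.

Lemma ler_ofR (a b : R) : (ofR a <= ofR b) = (a <= b).
Proof. exact: lecR. Qed.

Lemma ltr_ofR (a b : R) : (ofR a < ofR b) = (a < b).
Proof. exact: ltcR. Qed.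

Lemma ofRD (a b : R) : ofR (a + b) = ofR a + ofR b.
Proof. exact: (rmorphD (real_complex R)). Qed.

Lemma ofRM (a b : R) : ofR (a * b) = ofR a * ofR b.
Proof. exact: (rmorphM (real_complex R)). Qed.

Lemma ofR_inj : injective (@ofR R).
Proof. by move=> a b []. Qed.

Lemma cmodE (c : C) : `|c| = ofR (cmod c).
Proof. exact: ofR_Re. Qed.

Lemma cmod_ofR (a : R) : cmod (ofR a) = `|a|.
Proof. by apply: ofR_inj; rewrite -cmodE normc_def /= expr0n /= addr0 sqrtr_sqr. Qed.

Lemma cmod_ge0 c : 0 <= cmod c.
Proof. by rewrite -ler_ofR -cmodE; exact: normr_ge0. Qed.

Lemma cmodM a b : cmod (a * b) = cmod a * cmod b.
Proof. by apply: ofR_inj; rewrite ofRM -!cmodE normrM. Qed.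

Lemma cmodX a k : cmod (a ^+ k) = cmod a ^+ k.
Proof.
elim: k => [|k IH]; first by rewrite !expr0 (_ : 1 = ofR 1) // cmod_ofR normr1.
by rewrite !exprS cmodM IH.
Qed.

Lemma cmodD a b : cmod (a + b) <= cmod a + cmod b.
Proof. by rewrite -ler_ofR ofRD -!cmodE ler_normD. Qed.

Lemma cmodN a : cmod (- a) = cmod a.
Proof. by rewrite /cmod normrN. Qed.

Lemma cmod0 : cmod 0 = 0.
Proof. by rewrite /cmod normr0. Qed.

Lemma cmod1 : cmod 1 = 1.
Proof. by rewrite /cmod normr1. Qed.

Lemma cmod_eq0 a : cmod a = 0 -> a = 0.
Proof. by move=> a0; apply/normr0_eq0; rewrite cmodE a0. Qed.

Lemma cmodV a : cmod a^-1 = (cmod a)^-1.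
Proof.
have [->|a0] := eqVneq a 0; first by rewrite !invr0 cmod0 invr0.
have c0 : cmod a != 0 by apply: contraNneq a0 => /cmod_eq0 ->.
by apply: (mulfI c0); rewrite -cmodM !divff // cmod1.
Qed.

Lemma cmod_sum I (r : seq I) (P : pred I) (G : I -> C) :
  cmod (\sum_(i <- r | P i) G i) <= \sum_(i <- r | P i) cmod (G i).
Proof.
elim/big_rec2: _ => [|i x y Pi h]; first by rewrite cmod0.
by rewrite (le_trans (cmodD _ _)) // lerD2l.
Qed.

Lemma cmod_prod I (r : seq I) (P : pred I) (G : I -> C) :
  cmod (\prod_(i <- r | P i) G i) = \prod_(i <- r | P i) cmod (G i).
Proof.
elim/big_rec2: _ => [|i x y Pi h]; first by rewrite cmod1.
by rewrite cmodM h.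
Qed.

Lemma cmod_sqr (c : C) :
  cmod c ^+ 2 = complex.Re c ^+ 2 + complex.Im c ^+ 2.
Proof. by case: c => a b; rewrite /cmod normc_def /= sqr_sqrtr // addr_ge0 ?sqr_ge0. Qed.

Lemma parallelogram (a b : C) :
  cmod (a + b) ^+ 2 + cmod (a - b) ^+ 2 = 2 * (cmod a ^+ 2 + cmod b ^+ 2).
Proof. by case: a => a1 a2; case: b => b1 b2; rewrite !cmod_sqr /=; ring. Qed.

Section Vectors.
Variable n : nat.
Local Notation V := 'rV[C]_n.

(** The norm [|v|] is a complex number; its real part gives the maximum norm as an element of the
    ordered field [R]. *)
Definition nr (v : V) : R := complex.Re `|v|.

Lemma nrE (v : V) : `|v| = ofR (nr v).
Proof. exact: ofR_Re. Qed.

Lemma nr_ge0 v : 0 <= nr v.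
Proof. by rewrite -ler_ofR -nrE; exact: normr_ge0. Qed.

Lemma nrD a b : nr (a + b) <= nr a + nr b.
Proof. by rewrite -ler_ofR ofRD -!nrE ler_normD. Qed.

Lemma nrN a : nr (- a) = nr a.
Proof. by rewrite /nr normrN. Qed.

Lemma nrB a b : nr (a - b) = nr (b - a).
Proof. by rewrite -opprB nrN. Qed.

Lemma nr0 : nr 0 = 0.
Proof. by rewrite /nr normr0. Qed.

Lemma nr_eq0 a : nr a = 0 -> a = 0.
Proof. by move=> a0; apply/normr0_eq0; rewrite nrE a0. Qed.

Lemma nr_gt0 a : a <> 0 -> 0 < nr a.
Proof.
by move=> a0; rewrite lt_neqAle nr_ge0 andbT; apply/eqP => h; apply/a0/nr_eq0.
Qed.

Lemma nrZ (c : C) v : nr (c *: v) = cmod c * nr v.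
Proof. by apply: ofR_inj; rewrite ofRM -cmodE -!nrE normrZ. Qed.

Lemma nr_dist a b c : nr (a - b) <= nr (a - c) + nr (c - b).
Proof. by rewrite (le_trans _ (nrD _ _)) // addrA subrK. Qed.

Lemma nr_le v (M : R) : 0 <= M -> (nr v <= M <-> forall i, cmod (v 0 i) <= M).
Proof.
move=> M0; rewrite -ler_ofR -nrE [`|v|]/Num.norm /= mx_normE.
have M0' : 0 <= ofR M by rewrite ler_ofR.
have -> : ofR M = (NngNum M0')%:num by [].
rewrite num_le; split.
  move=> /bigmax_leP[_ h] i; have := h (0, i) isT; rewrite -num_le /=.
  by rewrite cmodE ler_ofR.
move=> h; apply/bigmax_leP; split; first by rewrite -num_le /= ler_ofR.
by move=> [i j] _; rewrite -num_le /= cmodE ler_ofR ord1.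
Qed.

Lemma nr_coord (v : V) i : cmod (v 0 i) <= nr v.
Proof. by have /(nr_le _ (nr_ge0 v)) := lexx (nr v). Qed.

Lemma nbhs_nrP (p : V) (U : set V) :
  nbhs p U <-> exists2 e : R, 0 < e & forall q, nr (q - p) < e -> U q.
Proof.
split=> [/nbhs_normP[e /= e0 h]|[e e0 h]].
  have eE := ofR_Re (ltW e0); exists (complex.Re e).
    by rewrite -ltr_ofR -eE.
  by move=> q qp; apply: h; rewrite /= -opprB normrN nrE eE ltr_ofR.
suff : \near p, U p by [].
apply/nbhs_normP; exists (ofR e) => /=; first by rewrite (@ltr_ofR 0).
by move=> q /=; rewrite -opprB normrN nrE ltr_ofR; exact: h.
Qed.

Lemma cvg_nrP (T : Type) (F : set_system T) {FF : Filter F} (u : T -> V) (l : V) :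
  u @ F --> l <-> forall e : R, 0 < e -> \forall j \near F, nr (u j - l) < e.
Proof.
split=> [ul e e0|h].
  by apply: (ul [set q | nr (q - l) < e]); apply/nbhs_nrP; exists e.
move=> U /nbhs_nrP[e e0 eU]; rewrite nbhs_filterE /=.
by have := h e e0; apply: filterS => j; exact: eU.
Qed.

Lemma cvg_nr (T : Type) (F : set_system T) {FF : Filter F} (u : T -> V) (l : V) :
  u @ F --> l -> (fun j => nr (u j)) @ F --> nr l.
Proof.
move=> /cvg_nrP h; apply/cvgrPdist_lt => e e0; have := h e e0.
apply: filterS => j; apply: le_lt_trans; rewrite ler_norml; apply/andP; split.
  by rewrite lerNl opprB lerBlDr (le_trans _ (nrD _ _)) // subrK.
by rewrite lerBlDr nrB (le_trans _ (nrD _ _)) // subrK.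
Qed.

Lemma closed_ball_compact (M : R) : compact [set v : V | nr v <= M].
Proof.
(* A square containing the disc of each coordinate; it is a continuous image of a compact rectangle
   of R x R. *)
pose S := [set c : C | `|complex.Re c| <= `|M| /\ `|complex.Im c| <= `|M|].
have cS : compact S.
  pose h (x : R * R) : C := Complex x.1 x.2.
  have -> : S = h @` (`[- `|M|, `|M|]%classic `*` `[- `|M|, `|M|]%classic).
    rewrite eqEsubset; split=> [[a b] [/= Ha Hb]|_ [[a b] [/= Ha Hb] <-]].
      by exists (a, b) => //=; rewrite !in_itv /= -!ler_norml.
    by rewrite /S /=; move: Ha Hb; rewrite !in_itv /= -!ler_norml.
  apply: continuous_compact; last by apply: compact_setX; exact: segment_compact.
  apply: continuous_subspaceT => -[a b]; apply/cvgrPdist_lt => e e0.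
  have eE := ofR_Re (ltW e0); set r := complex.Re e in eE.
  have r0 : 0 < r by rewrite -ltr_ofR -eE.
  have r20 : 0 < r / 2 by rewrite divr_gt0.
  exists (ball a (r / 2), ball b (r / 2)) => [|[a' b'] [/= Ha Hb]].
    by split; exact: nbhsx_ballx.
  rewrite eE cmodE ltr_ofR.
  have -> : h (a, b) - h (a', b') = ofR (a - a') + Complex 0 1 * ofR (b - b').
    by apply/eqP; rewrite eq_complex /=; apply/andP; split; apply/eqP; ring.
  apply: (le_lt_trans (cmodD _ _)); rewrite cmodM !cmod_ofR.
  have -> : cmod (Complex 0 1) = 1.
    by rewrite /cmod normc_def /= expr0n /= add0r expr1n sqrtr1.
  by rewrite mul1r [ltRHS]splitr ltrD.
apply: (@subclosed_compact _ _ [set v : V | forall i, S (v ord0 i)]).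
- rewrite -openC openE => v /= vM; apply/nbhs_nrP.
  exists (nr v - M); first by rewrite subr_gt0 ltNge; exact/negP.
  move=> q qv /= qM; have := nrD (v - q) q; rewrite subrK nrB => h.
  by have := le_lt_trans h (ltr_leD qv qM); rewrite subrK ltxx.
- exact: (@rV_compact (Cplx R) n (fun=> S) (fun=> cS)).
- move=> v /= vM i; have M0 : 0 <= M by rewrite (le_trans (nr_ge0 v)).
  have vi := le_trans (nr_coord v i) vM; rewrite /S /= (ger0_norm M0).
  have E := cmod_sqr (v 0 i).
  have sq : cmod (v 0 i) ^+ 2 <= M ^+ 2 by rewrite lerXn2r // nnegrE cmod_ge0.
  split; rewrite -ler_sqr ?nnegrE // real_normK ?num_real //;
    apply: le_trans sq; rewrite E.
    by rewrite lerDl sqr_ge0.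
  by rewrite lerDr sqr_ge0.
Qed.

(** Since all limits are taken along the same [F], several bounded sequences converge together, with
    no nested subsequences. *)
Lemma ultra_cvg (F : set_system nat) (FU : UltraFilter F) (u : nat -> V) (M : R) :
  (\forall j \near F, nr (u j) <= M) -> exists l : V, u @ F --> l.
Proof.
move=> uM; have := @closed_ball_compact M; rewrite compact_ultra => h.
have UF : UltraFilter (u @ F).
  split; first exact: fmap_proper_filter.
  move=> G GP FG; rewrite eqEsubset; split => // A GA.
  have [//|nA] := in_ultra_setVsetC (u @^-1` A) FU.
  have : G (A `&` ~` A) by apply: filterI => //; exact: FG.
  by rewrite setICr => /filter_not_empty.
by have [l [_ ul]] := h _ UF uM; exists l.
Qed.

Lemma bounded_nrP (A : set V) :
  bounded_set A <-> exists M : R, forall v, A v -> nr v <= M.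
Proof.
split=> [[M [Mr h]]|[M h]].
  have [m ME] : exists m, M = ofR m.
    have /orP[/ofR_Re M0|M0] := Mr; first by exists (complex.Re M).
    have /ofR_Re M1 : 0 <= - M by rewrite oppr_ge0.
    exists (- complex.Re (- M)); rewrite -[LHS]opprK M1.
    by apply/eqP; rewrite eq_complex /= oppr0 !eqxx.
  exists (m + 1) => v Av; rewrite -ler_ofR -nrE; apply: h => //.
  by rewrite ME ltr_ofR ltrDl.
exists (ofR M); split; first by rewrite realE (@ler_ofR 0) (@ler_ofR _ 0) -realE num_real.
move=> x Mx v Av; rewrite /= nrE; apply/ltW; apply: le_lt_trans Mx.
by rewrite ler_ofR; exact: h.
Qed.

End Vectors.

End RealNorm.

Lemma free_ultrafilter : exists F : set_system nat,
  UltraFilter F /\ (forall P : set nat, (exists m, forall j, (m <= j)%N -> P j) -> F P).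
Proof.
have [F [FU FF]] := @ultraFilterLemma nat \oo _.
exists F; split => // P [m mP]; apply: FF; exists m => //.
Qed.

(** * Cauchy and Parseval estimates on circles *)

Section OneVariable.
Variable R : realType.
Local Notation C := (Cplx R).

Lemma horner_even_odd (q : {poly C}) (t : C) :
  q.[t] = (even_poly q).[t ^+ 2] + t * (odd_poly q).[t ^+ 2].
Proof.
by rewrite -{1}(poly_even_odd q) hornerD hornerM hornerX !horner_comp hornerXn mulrC.
Qed.

Lemma horner_even_oddN (q : {poly C}) (t : C) :
  q.[- t] = (even_poly q).[t ^+ 2] - t * (odd_poly q).[t ^+ 2].
Proof. by rewrite horner_even_odd sqrrN mulNr. Qed.

Lemma circle_root (s : C) (r : R) : 0 <= r -> cmod s = r ^+ 2 ->
  exists2 t : C, t ^+ 2 = s & cmod t = r.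
Proof.
move=> r0 sr; exists (sqrtC s); first exact: sqrtCK.
apply/eqP; rewrite -(@eqrXn2 _ 2) ?cmod_ge0 // -cmodX.
by rewrite sqrtCK sr.
Qed.

(** At the square roots t and -t of s, the polynomial takes the values E + tO and E - tO, with E and
    O its even and odd parts at s. The parallelogram law averages their squares. *)
Lemma circle_even_odd (I : finType) (q : I -> {poly C}) (r M : R) : 0 <= r ->
  (forall t, cmod t = r -> \sum_i cmod (q i).[t] ^+ 2 <= M) ->
  forall s, cmod s = r ^+ 2 ->
    \sum_i (cmod (even_poly (q i)).[s] ^+ 2 +
            r ^+ 2 * cmod (odd_poly (q i)).[s] ^+ 2) <= M.
Proof.
move=> r0 qM s /circle_root[] // t <- tr.
rewrite -(@ler_pM2l _ 2) // mulr_sumr.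
rewrite (eq_bigr (fun i => cmod (q i).[t] ^+ 2 + cmod (q i).[- t] ^+ 2)); last first.
  move=> i _; rewrite horner_even_oddN (horner_even_odd (q i)) parallelogram.
  by rewrite cmodM exprMn tr.
by rewrite big_split /= mulr_natl mulr2n lerD // qM // cmodN.
Qed.

(** Passing to the even part keeps the constant coefficient, squares the radius and about halves the
    size, so the induction ends at constants. *)
Lemma circle_center (I : finType) (q : I -> {poly C}) (r M : R) : 0 <= r ->
  (forall t, cmod t = r -> \sum_i cmod (q i).[t] ^+ 2 <= M) ->
  \sum_i cmod (q i)`_0 ^+ 2 <= M.
Proof.
have [N] : exists N, forall i, (size (q i) <= N)%N.
  by exists (\max_i size (q i)) => i; exact: leq_bigmax.
elim/ltn_ind: N q r => -[|[|N]] IH q r qN r0 qM.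
1,2: apply: le_trans (qM (ofR r) _); last by rewrite cmod_ofR ger0_norm.
1,2: rewrite le_eqVlt; apply/orP; left; apply/eqP/eq_bigr => i _;
       rewrite [in RHS](@size1_polyC _ (q i)) ?hornerC //;
       exact: leq_trans (qN i) _.
have Me := circle_even_odd r0 qM.
have -> : \sum_i cmod (q i)`_0 ^+ 2 = \sum_i cmod (even_poly (q i))`_0 ^+ 2.
  by apply: eq_bigr => i _; rewrite coef_even_poly double0.
apply: (IH (uphalf N.+2) _ _ (r ^+ 2)) => [|i||s sr].
- by rewrite /= ltnS uphalfE; lia.
- apply: leq_trans (size_even_poly _) _.
  by have := qN i; rewrite !uphalfE; lia.
- exact: sqr_ge0.
- apply: le_trans (Me s sr); apply: ler_sum => i _.
  by rewrite lerDl mulr_ge0 ?sqr_ge0.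
Qed.

(** Doubling the family into even parts and r times odd parts turns q_0 and r q_1 into constant
    coefficients, so that [circle_center] applies on the circle of radius r^2. *)
Lemma circle_center1 (I : finType) (q : I -> {poly C}) (r M : R) : 0 <= r ->
  (forall t, cmod t = r -> \sum_i cmod (q i).[t] ^+ 2 <= M) ->
  \sum_i (cmod (q i)`_0 ^+ 2 + r ^+ 2 * cmod (q i)`_1 ^+ 2) <= M.
Proof.
move=> r0 qM.
pose e (x : I * bool) : {poly C} :=
  if x.2 then even_poly (q x.1) else (ofR r) *: odd_poly (q x.1).
have split_bool (G : I * bool -> R) :
    \sum_x G x = \sum_i (G (i, true) + G (i, false)).
  rewrite (eq_bigr (fun x => G (x.1, x.2))); last by case.
  rewrite -(pair_bigA _ (fun i b => G (i, b))) /=.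
  by apply: eq_bigr => i _; rewrite big_bool.
have := @circle_center _ e (r ^+ 2) M (sqr_ge0 _) _.
rewrite split_bool /e /= => h.
rewrite (eq_bigr (fun i => cmod (even_poly (q i))`_0 ^+ 2
                  + cmod (ofR r *: odd_poly (q i))`_0 ^+ 2)).
  apply: h => s sr; rewrite split_bool; apply: le_trans (circle_even_odd r0 qM sr).
  apply: ler_sum => i _ /=; rewrite hornerZ cmodM exprMn cmod_ofR real_normK //.
  exact: num_real.
move=> i _; rewrite coefZ coef_even_poly coef_odd_poly double0 cmodM exprMn cmod_ofR.
by rewrite real_normK // num_real.
Qed.

(** The induction follows the binary digits of [m]: to the even part with bound M, or to the odd
    part with bound M / r, on the circle of radius r^2. *)
Lemma cauchy_coef (q : {poly C}) (r M : R) m : 0 < r ->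
  (forall t, cmod t = r -> cmod q.[t] <= M) -> cmod q`_m * r ^+ m <= M.
Proof.
have [k] := ubnP m; elim: k m q r M => // k IH m q r M mk r0 qM.
have M0 : 0 <= M by apply: le_trans (qM (ofR r) _); rewrite ?cmod_ge0 ?cmod_ofR ?gtr0_norm.
have qM2 t : cmod t = r -> \sum_(i : 'I_1) cmod q.[t] ^+ 2 <= M ^+ 2.
  by move=> tr; rewrite big_ord1 lerXn2r ?nnegrE ?cmod_ge0 // qM.
have [->|m0] := posnP m.
  have := @circle_center 'I_1 (fun=> q) r _ (ltW r0) qM2.
  by rewrite big_ord1 expr0 mulr1 ler_sqr // nnegrE cmod_ge0.
have eoM s (sr : cmod s = r ^+ 2) := @circle_even_odd 'I_1 (fun=> q) r _ (ltW r0) qM2 s sr.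
have r20 : 0 < r ^+ 2 by rewrite exprn_gt0.
have Ehalf := odd_double_half m.
case: (odd m) Ehalf => /= Ehalf.
  have : cmod (odd_poly q)`_m./2 * (r ^+ 2) ^+ m./2 <= M / r.
    apply: IH => // [|s sr]; first lia.
    rewrite ler_pdivlMr // -ler_sqr ?nnegrE ?mulr_ge0 ?cmod_ge0 ?(ltW r0) //.
    have := eoM s sr; rewrite big_ord1 exprMn mulrC; apply: le_trans.
    by rewrite lerDr sqr_ge0.
  rewrite coef_odd_poly ler_pdivlMr // -exprM -mulrA -exprSr mul2n.
  by rewrite (_ : (m./2).*2.+1 = m) //; lia.
have : cmod (even_poly q)`_m./2 * (r ^+ 2) ^+ m./2 <= M.
  apply: IH => // [|s sr]; first lia.
  rewrite -ler_sqr ?nnegrE ?cmod_ge0 //.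
  have := eoM s sr; rewrite big_ord1; apply: le_trans.
  by rewrite lerDl mulr_ge0 ?sqr_ge0.
by rewrite coef_even_poly -exprM mul2n (_ : (m./2).*2 = m) //; lia.
Qed.

Lemma geom_tail (x : R) k N : 0 <= x <= 1 / 2 ->
  \sum_(k <= m < N) x ^+ m <= 2 * x ^+ k.
Proof.
move=> /andP[x0 x1]; have [Nk|kN] := leqP N k.
  by rewrite big_geq // mulr_ge0 // exprn_ge0.
suff : \sum_(k <= m < N) x ^+ m <= 2 * x ^+ k - 2 * x ^+ N.
  by move=> h; apply: le_trans h _; rewrite gerBl mulr_ge0 // exprn_ge0.
elim: N kN => // N IH; rewrite ltnS leq_eqVlt => /orP[/eqP <-|kN].
  rewrite big_nat1 exprS; have := exprn_ge0 k x0; move: (x ^+ k) => y y0.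
  have : x * y <= 1 / 2 * y by rewrite ler_wpM2r.
  lra.
rewrite big_nat_recr ?(ltnW kN) //= exprS; have := IH kN; have := exprn_ge0 N x0.
move: (x ^+ N) => y y0 h; have : x * y <= 1 / 2 * y by rewrite ler_wpM2r.
lra.
Qed.

Lemma cauchy_tail (q : {poly C}) (r M : R) k (t : C) : 0 < r ->
  (forall t, cmod t = r -> cmod q.[t] <= M) -> cmod t <= r / 2 ->
  cmod (q.[t] - \sum_(m < k) q`_m * t ^+ m) <= 2 * M * (cmod t / r) ^+ k.
Proof.
move=> r0 qM tr; set N := maxn k (size q).
have M0 : 0 <= M by apply: le_trans (qM (ofR r) _); rewrite ?cmod_ge0 ?cmod_ofR ?gtr0_norm.
have -> : q.[t] = \sum_(0 <= m < N) q`_m * t ^+ m.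
  rewrite (@big_cat_nat _ _ _ (size q)) ?leq_maxr //= [X in _ + X]big1_seq ?addr0.
    by rewrite horner_coef big_mkord.
  move=> m /andP[_]; rewrite mem_index_iota => /andP[sm _].
  by rewrite nth_default ?mul0r.
rewrite (@big_cat_nat _ _ _ k) ?leq_maxl //= big_mkord addrAC subrr add0r.
apply: le_trans (cmod_sum _ _ _) _.
have x0 : 0 <= cmod t / r <= 1 / 2.
  rewrite divr_ge0 ?cmod_ge0 ?(ltW r0) //= ler_pdivrMr //; move: tr; lra.
apply: (@le_trans _ _ (\sum_(k <= m < N) M * (cmod t / r) ^+ m)).
  apply: ler_sum => m _; rewrite cmodM cmodX expr_div_n mulrA -[leRHS]mulrAC.
  apply: ler_wpM2r; first by rewrite exprn_ge0 ?cmod_ge0.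
  by rewrite ler_pdivlMr ?exprn_gt0 //; exact: cauchy_coef.
rewrite -mulr_sumr -mulrA mulrCA ler_wpM2l //.
exact: geom_tail.
Qed.

End OneVariable.

(** * Polynomial maps along complex lines *)

Section CurvePoly.
Variable R : realType.
Local Notation C := (Cplx R).

(** A substitute for holomorphy that passes to compositions and iterates at once, without formulas
    for the composed multivariate polynomials. *)
Definition curve_poly n m (h : 'rV[C]_n -> 'rV[C]_m) : Prop :=
  forall c : 'I_n -> {poly C}, exists q : 'I_m -> {poly C},
    forall t, h (\row_i (c i).[t]) = \row_i (q i).[t].

Lemma curve_poly_comp n m k (h : 'rV[C]_m -> 'rV[C]_k) (g : 'rV[C]_n -> 'rV[C]_m) :
  curve_poly h -> curve_poly g -> curve_poly (h \o g).
Proof.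
move=> hp gp c; have [q qE] := gp c; have [r rE] := hp q.
by exists r => t /=; rewrite qE rE.
Qed.

Lemma curve_poly_iter n (h : 'rV[C]_n -> 'rV[C]_n) k :
  curve_poly h -> curve_poly (iter k h).
Proof.
move=> hp; elim: k => [|k IH]; first by move=> c; exists c.
exact: curve_poly_comp.
Qed.

Lemma horner_mmap n (c : 'I_n -> {poly C}) (p : mpoly n C) t :
  (mmap polyC c p).[t] = meval (fun i => (c i).[t]) p.
Proof.
rewrite mevalE /mmap horner_sum; apply: eq_bigr => m _.
rewrite hornerM hornerC /mmap1 horner_prod; congr (_ * _).
by apply: eq_bigr => i _; rewrite horner_exp.
Qed.

Lemma curve_poly_polymap n m (p : 'I_m -> mpoly n C) : curve_poly (polymap p).
Proof.
move=> c; exists (fun i => mmap polyC c (p i)) => t.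
apply/rowP => i; rewrite !mxE horner_mmap; apply: meval_eq => j.
by rewrite mxE.
Qed.

Lemma curve_poly_line n m (h : 'rV[C]_n -> 'rV[C]_m) z v : curve_poly h ->
  exists q : 'I_m -> {poly C}, forall t, h (z + t *: v) = \row_i (q i).[t].
Proof.
move=> /(_ (fun i => (z 0 i)%:P + (v 0 i) *: 'X))[q qE]; exists q => t.
rewrite -qE; congr h; apply/rowP => i; rewrite !mxE.
by rewrite hornerD hornerC hornerZ hornerX mulrC.
Qed.

Lemma differentiable_bigprod n (I : Type) (s : seq I) (h : I -> 'rV[C]_n -> C) z :
  (forall i, differentiable (h i) z) ->
  differentiable (fun x => \prod_(i <- s) h i x) z.
Proof.
move=> hd; elim: s => [|i s IH].
  by under eq_fun do rewrite big_nil; exact: differentiable_cst.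
under eq_fun do rewrite big_cons.
exact: (differentiableM (hd i) IH).
Qed.

Lemma differentiable_bigsum n (I : Type) (s : seq I) (h : I -> 'rV[C]_n -> C) z :
  (forall i, differentiable (h i) z) ->
  differentiable (fun x => \sum_(i <- s) h i x) z.
Proof.
move=> hd; elim: s => [|i s IH].
  by under eq_fun do rewrite big_nil; exact: differentiable_cst.
under eq_fun do rewrite big_cons.
exact: (differentiableD (hd i) IH).
Qed.

Lemma differentiable_meval n N (s : 'I_n -> 'I_N) (p : mpoly n C) (z : 'rV[C]_N) :
  differentiable (fun x : 'rV[C]_N => meval (fun j => x 0 (s j)) p) z.
Proof.
under eq_fun do rewrite mevalE.
apply: differentiable_bigsum => m.
apply: differentiableM; first exact: differentiable_cst.
apply: differentiable_bigprod => i.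
case: (m i) => [|k]; first exact: differentiable_cst.
have := @differentiableX C _ (fun x : 'rV[C]_N => x 0 (s i)) k z.
by rewrite exprfctE; apply; exact: differentiable_coord.
Qed.

Lemma differentiable_rV n m (h : 'rV[C]_n -> 'rV[C]_m) z :
  (forall i, differentiable (fun x => h x 0 i) z) -> differentiable h z.
Proof.
move=> hd; have -> : h = \sum_(i < m) (fun x => h x 0 i *: delta_mx 0 i).
  apply/funext => x; rewrite fct_sumE [LHS]row_sum_delta.
  by [].
by apply: differentiable_sum => i; exact: differentiableZl.
Qed.

Lemma differentiable_polymap n m (p : 'I_m -> mpoly n C) z :
  differentiable (polymap p) z.
Proof.
apply: differentiable_rV => i; under eq_fun do rewrite mxE.
exact: (differentiable_meval id).
Qed.

Lemma continuous_polymap n m (p : 'I_m -> mpoly n C) : continuous (polymap p).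
Proof. by move=> z; exact/differentiable_continuous/differentiable_polymap. Qed.

Lemma poly_remainder1 (q : {poly C}) : exists2 B : R, 0 <= B &
  forall t, cmod t <= 1 -> cmod (q.[t] - q`_0 - q`_1 * t) <= B * cmod t ^+ 2.
Proof.
exists (\sum_(i < (size q).+2) cmod q`_i); first exact: sumr_ge0 (fun i _ => cmod_ge0 _).
move=> t t1; rewrite (@horner_coef_wide _ (size q).+2) ?leqW // !big_ord_recl /=.
rewrite expr0 mulr1 expr1 -addrA [_ + (_ + _)]addrA.
rewrite (_ : _ + _ = \sum_(i < size q) q`_i.+2 * t ^+ i.+2); last first.
  by rewrite /bump /= !add1n; ring.
apply: le_trans (cmod_sum _ _ _) _.
rewrite !mulrDl mulr_suml.
apply: ler_wpDl; first by rewrite mulr_ge0 ?cmod_ge0 ?exprn_ge0 ?cmod_ge0.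
apply: ler_wpDl; first by rewrite mulr_ge0 ?cmod_ge0 ?exprn_ge0 ?cmod_ge0.
apply: ler_sum => i _; rewrite cmodM cmodX ler_wpM2l ?cmod_ge0 //.
by rewrite ler_wiXn2l ?cmod_ge0.
Qed.

(** Links the differential to the one-variable estimates: along a line the difference quotient is
    the linear coefficient up to O(t). *)
Lemma diff_coef n m (h : 'rV[C]_n -> 'rV[C]_m) z v (q : 'I_m -> {poly C}) :
  differentiable h z -> (forall t, h (z + t *: v) = \row_i (q i).[t]) ->
  'd h z v = \row_i (q i)`_1.
Proof.
move=> hd qE; rewrite -deriveE //.
have [B B0 BP] : exists2 B : R, 0 <= B & forall t i, cmod t <= 1 ->
    cmod ((q i).[t] - (q i)`_0 - (q i)`_1 * t) <= B * cmod t ^+ 2.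
  have /choice[B BP] : forall i, exists B : R, 0 <= B /\ forall t, cmod t <= 1 ->
      cmod ((q i).[t] - (q i)`_0 - (q i)`_1 * t) <= B * cmod t ^+ 2.
    by move=> i; have [B] := poly_remainder1 (q i); exists B.
  exists (\sum_i B i); first by apply: sumr_ge0 => i _; case: (BP i).
  move=> t i t1; apply: le_trans ((BP i).2 t t1) _.
  rewrite ler_wpM2r ?exprn_ge0 ?cmod_ge0 // (bigD1 i) //= lerDl.
  by apply: sumr_ge0 => j _; case: (BP j).
apply: cvg_lim => //.
apply/cvg_nrP => e e0; near=> t.
have t0 : t != 0 by near: t; exact: nbhs_dnbhs_neq.
have tpos : 0 < cmod t.
  by rewrite lt_neqAle cmod_ge0 andbT eq_sym; apply: contra_neq t0; exact: cmod_eq0.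
have tsmall : cmod t < Num.min 1 (e / (B + 1)).
  near: t; apply: nbhs_dnbhs; apply/nbhs_normP.
  exists (ofR (Num.min 1 (e / (B + 1)))) => /=.
    by rewrite (@ltr_ofR _ 0) lt_min ltr01 divr_gt0 // ltr_wpDl.
  by move=> y /=; rewrite sub0r normrN cmodE ltr_ofR.
move: tsmall; rewrite lt_min => /andP[t1 te].
apply: (@le_lt_trans _ _ (B * cmod t)).
  apply/nr_le; first by rewrite mulr_ge0 // cmod_ge0.
  move=> i; rewrite /= [t *: v + z]addrC qE !mxE.
  have := qE 0; rewrite scale0r addr0 => ->; rewrite mxE horner_coef0.
  rewrite (_ : _ - _ = t^-1 * ((q i).[t] - (q i)`_0 - (q i)`_1 * t)); last by field.
  rewrite cmodM cmodV ler_pdivrMl // mulrCA -expr2.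
  by apply: BP; exact: ltW.
apply: (@le_lt_trans _ _ ((B + 1) * cmod t)).
  by rewrite ler_wpM2r ?cmod_ge0 // lerDl.
by rewrite mulrC -ltr_pdivlMr // ltr_wpDl.
Unshelve. all: by end_near. Qed.

End CurvePoly.

(** * Jacobian matrices and multivariate polynomial identities *)

Section Jacobian.
Variable R : realType.
Local Notation C := (Cplx R).

Definition line_curve n (z v : 'rV[C]_n) (i : 'I_n) : {poly C} :=
  (z 0 i)%:P + v 0 i *: 'X.

Lemma horner_line_curve n (z v : 'rV[C]_n) (p : mpoly n C) t :
  (mmap polyC (line_curve z v) p).[t] = meval (fun i => (z + t *: v) 0 i) p.
Proof.
rewrite horner_mmap; apply: meval_eq => i.
by rewrite !mxE hornerD hornerC hornerZ hornerX mulrC.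
Qed.

Lemma line_curve_coef0 n (z v : 'rV[C]_n) (p : mpoly n C) :
  (mmap polyC (line_curve z v) p)`_0 = meval (fun i => z 0 i) p.
Proof. by rewrite -horner_coef0 horner_line_curve scale0r addr0. Qed.

(** Both sides are additive in [p] and obey the product rule at z, so constants and variables
    suffice. *)
Lemma line_curve_coef1 n (z v : 'rV[C]_n) (p : mpoly n C) :
  (mmap polyC (line_curve z v) p)`_1 =
  \sum_j v 0 j * meval (fun i => z 0 i) (mderiv j p).
Proof.
pose P (u : mpoly n C) := (mmap polyC (line_curve z v) u)`_1 =
  \sum_j v 0 j * meval (fun i => z 0 i) (mderiv j u).
have PD a b : P a -> P b -> P (a + b).
  rewrite /P => Pa Pb; rewrite rmorphD coefD Pa Pb -big_split /=.
  by apply: eq_bigr => j _; rewrite raddfD rmorphD mulrDr.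
have PM a b : P a -> P b -> P (a * b).
  rewrite /P => Pa Pb; rewrite rmorphM /= coefM big_ord_recl big_ord1 /=.
  rewrite Pa Pb !line_curve_coef0 mulr_sumr mulr_suml -big_split /=.
  apply: eq_bigr => j _; rewrite mderivM rmorphD !rmorphM /= mulrDr addrC -mulrA.
  by congr (_ + _); rewrite mulrCA.
have PC c : P (mpolyC n c).
  rewrite /P mmapC coefC /= big1 // => j _.
  by rewrite mderivC rmorph0 mulr0.
have P1 : P 1 by rewrite -mpolyC1; exact: PC.
have PX i : P (mpolyX C (mnm1 i)).
  rewrite /P mmapX mmap1U /line_curve coefD coefC coefZ coefX /= add0r mulr1.
  rewrite (bigD1 i) //= big1 => [|j ji]; rewrite mderivX mnm1E.
    have -> : mnm_sub (mnm1 i) (mnm1 i) = mnm0.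
      by apply/mnmP => k; rewrite mnmBE subnn mnm0E.
    by rewrite eqxx scale1r mpolyX0 meval1 mulr1 addr0.
  by rewrite eq_sym (negbTE ji) scale0r rmorph0 mulr0.
have PXm m : P (mpolyX C m).
  rewrite mpolyXE_id; elim/big_ind: _ => [||i _]; first exact: P1.
    exact: PM.
  elim: (m i) => [|k IH]; first by rewrite expr0.
  by rewrite exprS; exact: (PM _ _ (PX i) IH).
elim/mpolyind: p => [|c m p _ _ IH]; first by have := PC 0; rewrite mpolyC0.
by rewrite -mul_mpolyC; exact: (PD _ _ (PM _ _ (PC c) (PXm m)) IH).
Qed.

Definition jac n m (p : 'I_m -> mpoly n C) (z : 'rV[C]_n) : 'M[C]_(n, m) :=
  \matrix_(j, i) meval (fun k => z 0 k) (mderiv j (p i)).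

Lemma diff_polymap n m (p : 'I_m -> mpoly n C) (z v : 'rV[C]_n) :
  'd (polymap p) z v = v *m jac p z.
Proof.
rewrite (diff_coef (q := fun i => mmap polyC (line_curve z v) (p i))).
- apply/rowP => i; rewrite !mxE line_curve_coef1; apply: eq_bigr => j _.
  by rewrite mxE.
- exact: differentiable_polymap.
- by move=> t; apply/rowP => i; rewrite !mxE horner_line_curve.
Qed.

Lemma cvg_row_mx (T : Type) (F : set_system T) {FF : Filter F} n m
    (u : T -> 'rV[C]_n) (v : T -> 'rV[C]_m)
    (a : 'rV[C]_n) (b : 'rV[C]_m) :
  u @ F --> a -> v @ F --> b ->
  (fun k => row_mx (u k) (v k)) @ F --> row_mx a b.
Proof.
move=> /cvg_nrP ua /cvg_nrP vb; apply/cvg_nrP => e e0.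
have e2 : 0 < e / 2 by rewrite divr_gt0.
apply: filterS2 (ua _ e2) (vb _ e2) => k uk vk.
apply: (@le_lt_trans _ _ (e / 2)); last lra.
rewrite opp_row_mx add_row_mx; apply/nr_le => [|i]; first exact: ltW.
case: (split_ordP i) => j ->; rewrite ?row_mxEl ?row_mxEr.
  exact: le_trans (nr_coord _ _) (ltW uk).
exact: le_trans (nr_coord _ _) (ltW vk).
Qed.

(** Base point and vector form one point of C^(n+n), on which the differential is a polynomial map,
    hence continuous. *)
Lemma cvg_diff_polymap (T : Type) (F : set_system T) {FF : Filter F} n m
    (p : 'I_m -> mpoly n C) (u v : T -> 'rV[C]_n) (a b : 'rV[C]_n) :
  u @ F --> a -> v @ F --> b ->
  (fun k => 'd (polymap p) (u k) (v k)) @ F --> 'd (polymap p) a b.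
Proof.
move=> ua vb.
pose D (x : 'rV[C]_(n + n)) := rsubmx x *m jac p (lsubmx x).
have DE z w : 'd (polymap p) z w = D (row_mx z w).
  by rewrite diff_polymap /D row_mxKl row_mxKr.
under eq_fun do rewrite DE.
rewrite DE; apply: (@continuous_cvg _ _ _ _ _ _ D); last exact: cvg_row_mx.
apply: differentiable_continuous; apply: differentiable_rV => i.
under eq_fun do rewrite mxE.
apply: differentiable_bigsum => j.
under eq_fun do rewrite !mxE.
apply: differentiableM; first exact: differentiable_coord.
rewrite (_ : (fun x => _) = (fun x : 'rV[C]_(n + n) =>
    meval (fun k => x 0 (lshift n k)) (mderiv j (p i)))); last first.
  by apply/funext => x; apply: meval_eq => k; rewrite mxE.
exact: differentiable_meval.
Qed.

Lemma horner0_eq0 (q : {poly C}) : (forall t, q.[t] = 0) -> q = 0.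
Proof.
move=> q0; apply/polyP => i; rewrite coef0; apply/cmod_eq0/eqP.
rewrite eq_le cmod_ge0 andbT.
have := @cauchy_coef _ q 1 0 i ltr01; rewrite expr1n mulr1; apply => t _.
by rewrite q0 cmod0.
Qed.

Lemma mderiv_vanish n (p : mpoly n C) j :
  (forall v, meval v p = 0) -> forall v, meval v (mderiv j p) = 0.
Proof.
move=> p0 v; pose z := \row_i v i : 'rV[C]_n.
have := line_curve_coef1 z (delta_mx 0 j) p.
rewrite (@horner0_eq0 (mmap _ _ _)) => [|t]; last by rewrite horner_line_curve.
rewrite coef0 (bigD1 j) //= big1 => [|i ij].
  rewrite mxE !eqxx mul1r addr0 => ->; apply: meval_eq => i.
  by rewrite mxE.
by rewrite mxE (negbTE ij) andbF mul0r.
Qed.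

Lemma meval_at0 n (p : mpoly n C) : meval (fun=> 0) p = mcoeff mnm0 p.
Proof.
rewrite mevalE.
have E m : m != mnm0 -> \prod_(i < n) (0 : C) ^+ m i = 0.
  move=> m0; have [i mi] : exists i, m i != 0.
    apply/existsP; apply: contraR m0; rewrite negb_exists => /forallP h.
    by apply/eqP/mnmP => i; rewrite mnm0E; apply/eqP; have := h i; rewrite negbK.
  by rewrite (bigD1 i) //= expr0n (negbTE mi) mul0r.
have [m0|m0] := boolP (mnm0 \in msupp p).
  rewrite (bigD1_seq mnm0) ?msupp_uniq //= big1_seq => [|m /andP[mn _]].
    rewrite [X in _ + X]big1_seq => [|k /andP[kn _]]; last by rewrite E ?mulr0.
    by rewrite addr0 mulr1.
  by rewrite mnm0E expr0.
rewrite big1_seq => [|m /andP[_ mp]]; first by rewrite memN_msupp_eq0.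
by rewrite E ?mulr0 //; apply: contraNneq m0 => <-.
Qed.

(** All derivatives vanish identically as well, and the value at 0 of the m-th one is the m-th
    coefficient times a nonzero product of factorials. *)
Lemma meval_eq0 n (p : mpoly n C) : (forall v, meval v p = 0) -> p = 0.
Proof.
move=> p0; apply/mpolyP => m; rewrite mcoeff0.
have : mcoeff mnm0 (mderivm m p) = 0.
  rewrite -meval_at0 mderivm_foldr /=.
  have : forall v, meval v p = 0 by [].
  move: (flatten _) => s {p0}; elim: s p => [|i s IH] p p0 /=; first exact: p0.
  have vs : forall v, meval v (foldr (mderiv (n:=n) (R:=C)) p s) = 0.
    by elim: s {IH} => //= j s IH; exact: mderiv_vanish.
  exact: mderiv_vanish.
rewrite mcoeff_mderivm addm0 => /eqP.
rewrite mulrn_eq0 => /orP[|/eqP //]; rewrite eqn0Ngt prodn_gt0 // => i.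
by rewrite ffactnn fact_gt0.
Qed.

(** On each line through 0 the polynomial has no root, so it is constant there by algebraic
    closedness. *)
Lemma nonvanishing_meval_const n (p : mpoly n C) :
  (forall v, meval v p != 0) -> forall v, meval v p = meval (fun=> 0) p.
Proof.
move=> p0 v; pose z := \row_i v i : 'rV[C]_n.
set q := mmap polyC (line_curve 0 z) p.
have qE t : q.[t] = meval (fun i => t * v i) p.
  by rewrite horner_line_curve; apply: meval_eq => i; rewrite !mxE add0r.
have s1 : size q == 1%N.
  apply/negPn/negP => /closed_rootP[t]; rewrite rootE qE.
  by rewrite (negbTE (p0 _)).
have qc := size1_polyC (eq_leq (eqP s1)).
have := qE 0; have := qE 1; rewrite qc !hornerC => -> h.
have -> : meval v p = meval (fun i => 1 * v i) p.
  by apply: meval_eq => i; rewrite mul1r.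
by rewrite h; apply: meval_eq => i; rewrite mul0r.
Qed.

End Jacobian.

(** * Cauchy estimates in several variables *)

Section CauchyEstimates.
Variables (R : realType) (n m : nat).
Local Notation C := (Cplx R).
Variable h : 'rV[C]_n -> 'rV[C]_m.
Hypotheses (hp : curve_poly h) (hd : forall z, differentiable h z).

Lemma line_bound x v (r M rho : R) (q : 'I_m -> {poly C}) :
  (forall z, nr (z - x) <= r -> nr (h z) <= M) ->
  (forall t, h (x + t *: v) = \row_i (q i).[t]) -> rho * nr v <= r ->
  forall i t, cmod t = rho -> cmod (q i).[t] <= M.
Proof.
move=> hM qE rv i t tr; have := qE t => /rowP/(_ i); rewrite mxE => <-.
apply: le_trans (nr_coord _ _) _; apply: hM.
by rewrite addrC addKr nrZ tr.
Qed.

Lemma bound_ge0 x (r M : R) : 0 <= r ->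
  (forall z, nr (z - x) <= r -> nr (h z) <= M) -> 0 <= M.
Proof.
by move=> r0 /(_ x); rewrite subrr nr0 => /(_ r0); apply: le_trans; exact: nr_ge0.
Qed.

Lemma diff_bound x v (r M : R) : 0 < r ->
  (forall z, nr (z - x) <= r -> nr (h z) <= M) ->
  nr ('d h x v) <= M / r * nr v.
Proof.
move=> r0 hM; have M0 := bound_ge0 (ltW r0) hM.
have [->|v0] := pselect (v = 0); first by rewrite linear0 !nr0 mulr0.
have vp := nr_gt0 v0.
have [q qE] := curve_poly_line x v hp; rewrite (diff_coef (hd x) qE).
apply/nr_le => [|i]; first by rewrite mulr_ge0 ?divr_ge0 ?nr_ge0 ?(ltW r0).
rewrite mxE; set rho := r / nr v.
have rho0 : 0 < rho by rewrite divr_gt0.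
have rv : rho * nr v <= r by rewrite divfK // gt_eqF.
have := cauchy_coef 1 rho0 (line_bound hM qE rv i); rewrite expr1 -ler_pdivlMr //.
by rewrite invf_div mulrA -[leRHS]mulrAC.
Qed.

Lemma diff_remainder x v (r M : R) : 0 < r ->
  (forall z, nr (z - x) <= r -> nr (h z) <= M) -> nr v <= r / 2 ->
  nr (h (x + v) - h x - 'd h x v) <= 2 * M * (nr v / r) ^+ 2.
Proof.
move=> r0 hM vr; have M0 := bound_ge0 (ltW r0) hM.
have [->|v0] := pselect (v = 0).
  by rewrite linear0 addr0 subrr subr0 !nr0 mul0r expr0n /= mulr0.
have vp := nr_gt0 v0.
have [q qE] := curve_poly_line x v hp; rewrite (diff_coef (hd x) qE).
apply/nr_le => [|i].
  by rewrite !mulr_ge0 // ?invr_ge0 ?nr_ge0 ?(ltW r0).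
set rho := r / nr v.
have rho0 : 0 < rho by rewrite divr_gt0.
have rv : rho * nr v <= r by rewrite divfK // gt_eqF.
have t1 : cmod (1 : C) <= rho / 2.
  by rewrite cmod1 mulrAC ler_pdivlMr // mul1r.
have := cauchy_tail 2 rho0 (line_bound hM qE rv i) t1.
rewrite !big_ord_recl big_ord0 /= expr0 expr1 !mulr1 addr0 cmod1 div1r invf_div.
have := qE 1; rewrite scale1r => ->; have := qE 0; rewrite scale0r addr0 => ->.
by rewrite !mxE horner_coef0 opprD addrA.
Qed.

(** Within r / 8 of x one has |w - z| <= r / 4, while the ball of radius r / 2 about z stays in the
    given one; [cauchy_tail] with k = 1 on that radius yields the constant 4M / r. *)
Lemma lipschitz_bound x (r M : R) : 0 < r ->
  (forall z, nr (z - x) <= r -> nr (h z) <= M) ->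
  forall z w, nr (z - x) <= r / 8 -> nr (w - x) <= r / 8 ->
  nr (h w - h z) <= 4 * M / r * nr (w - z).
Proof.
move=> r0 hM z w zx wx; have M0 := bound_ge0 (ltW r0) hM.
have zM y : nr (y - z) <= r / 2 -> nr (h y) <= M.
  by move=> yz; apply: hM; apply: le_trans (nr_dist _ _ z) _; lra.
have [->|v0] := pselect (w = z); first by rewrite !subrr !nr0 mulr0.
have vp : 0 < nr (w - z) by apply: nr_gt0 => /subr0_eq.
have vr : nr (w - z) <= r / 4.
  by apply: le_trans (nr_dist _ _ x) _; rewrite (nrB x); lra.
have [q qE] := curve_poly_line z (w - z) hp.
apply/nr_le => [|i]; first by rewrite !mulr_ge0 ?invr_ge0 ?nr_ge0 ?(ltW r0).
set rho := r / 2 / nr (w - z).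
have rho0 : 0 < rho by rewrite !divr_gt0.
have rv : rho * nr (w - z) <= r / 2 by rewrite divfK // gt_eqF.
have t1 : cmod (1 : C) <= rho / 2.
  rewrite cmod1 mulrAC ler_pdivlMr // mul1r; move: vr; lra.
have := cauchy_tail 1 rho0 (line_bound zM qE rv i) t1.
rewrite big_ord1 expr0 expr1 mulr1 cmod1 div1r invf_div.
have := qE 1; rewrite scale1r addrC subrK => ->; have := qE 0.
rewrite scale0r addr0 => ->.
rewrite !mxE horner_coef0; move/le_trans; apply.
by rewrite le_eqVlt; apply/orP; left; apply/eqP; field; rewrite gt_eqF.
Qed.

(** The squared Euclidean norm. A coordinate may vary without affecting the maximum norm [nr],
    whereas a bound on [e2] controls, through Parseval, every coordinate of the differential. *)
Definition e2 k (v : 'rV[C]_k) : R := \sum_i cmod (v 0 i) ^+ 2.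

Lemma parseval_diff x v (r M : R) : 0 <= r -> nr v <= 1 ->
  (forall z, nr (z - x) <= r -> e2 (h z) <= M) ->
  e2 (h x) + r ^+ 2 * e2 ('d h x v) <= M.
Proof.
move=> r0 v1 hM; have [q qE] := curve_poly_line x v hp.
have := @circle_center1 R 'I_m q r M r0 _.
rewrite (diff_coef (hd x) qE) big_split /= -mulr_sumr.
have := qE 0; rewrite scale0r addr0 => ->.
rewrite /e2; under eq_bigr do rewrite -horner_coef0.
under [in X in _ -> X]eq_bigr do rewrite mxE.
under [in X in _ -> _ + _ * X <= _]eq_bigr do rewrite mxE.
apply => t tr; have /hM : nr (x + t *: v - x) <= r.
  by rewrite addrC addKr nrZ tr ler_piMr.
rewrite qE; apply: le_trans; rewrite le_eqVlt; apply/orP; left; apply/eqP.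
by apply: eq_bigr => i _; rewrite mxE.
Qed.

End CauchyEstimates.

Lemma nr_le_e2 (R : realType) k (v : 'rV[Cplx R]_k) (r : R) :
  0 <= r -> e2 v <= r ^+ 2 -> nr v <= r.
Proof.
move=> r0 vr; apply/nr_le => // i; rewrite -ler_sqr ?nnegrE ?cmod_ge0 //.
apply: le_trans vr; rewrite /e2 (bigD1 i) //= lerDl.
by apply: sumr_ge0 => j _; rewrite sqr_ge0.
Qed.

Lemma cmod_dist (R : realType) (a b : Cplx R) : `|cmod a - cmod b| <= cmod (a - b).
Proof.
rewrite ler_norml; apply/andP; split.
  by rewrite lerNl opprB lerBlDr -(cmodN (a - b)) opprB (le_trans _ (cmodD _ _)) // subrK.
by rewrite lerBlDr (le_trans _ (cmodD _ _)) // subrK.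
Qed.

Lemma cvg_e2 (R : realType) k (T : Type) (F : set_system T) {FF : Filter F}
    (u : T -> 'rV[Cplx R]_k) (l : 'rV[Cplx R]_k) :
  u @ F --> l -> (fun j => e2 (u j)) @ F --> e2 l.
Proof.
move=> ul; rewrite /e2.
rewrite [X in X @ F](_ : _ = \sum_i (fun j => cmod (u j 0 i) ^+ 2)); last first.
  by apply/funext => j; rewrite fct_sumE.
elim/big_ind2: _ => [|x1 x2 y1 y2 h1 h2|i _]; first exact: cvg_cst.
  exact: cvgD.
have h : (fun j => cmod (u j 0 i)) @ F --> cmod (l 0 i).
  apply/cvgrPdist_lt => e e0; have /cvg_nrP/(_ e e0) := ul; apply: filterS => j.
  apply: le_lt_trans; apply: le_trans (cmod_dist _ _) _.
  rewrite nrB; apply: le_trans (nr_coord _ i).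
  by rewrite !mxE.
exact: (cvgM h h).
Qed.

(** * Escape to infinity and nonwandering points *)

Section Escape.
Variables (R : realType) (n : nat).
Local Notation C := (Cplx R).
Local Notation V := 'rV[C]_n.

(** The properties of regular automorphisms used by the dynamics, symmetric in the two maps so that
    [escape_sym] transfers statements on K+ to K-. *)
Record escape (f g : V -> V) (M : R) : Prop := Escape {
  es_fK : cancel f g;
  es_gK : cancel g f;
  es_fc : continuous f;
  es_gc : continuous g;
  es_fp : curve_poly f;
  es_gp : curve_poly g;
  es_fd : forall z, differentiable f z;
  es_gd : forall z, differentiable g z;
  es_fD : forall (F : set_system nat) {FF : Filter F} (u v : nat -> V) (a b : V),
    u @ F --> a -> v @ F --> b -> (fun k => 'd f (u k) (v k)) @ F --> 'd f a b;
  es_gD : forall (F : set_system nat) {FF : Filter F} (u v : nat -> V) (a b : V),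
    u @ F --> a -> v @ F --> b -> (fun k => 'd g (u k) (v k)) @ F --> 'd g a b;
  es_M : 1 <= M;
  es_dich : forall z, M < nr z -> 2 * nr z <= nr (f z) \/ 2 * nr z <= nr (g z) }.

Lemma escape_sym f g M : escape f g M -> escape g f M.
Proof. by case=> *; split => // z /[dup] ? ?; rewrite orC; auto. Qed.

Definition Kp (f : V -> V) : set V := [set z | exists B, forall k, nr (iter k f z) <= B].

Lemma KplusE (f : polyaut R n) : Kplus f = Kp (pa_fun f).
Proof.
apply/seteqP; split => z /=.
  by move=> /bounded_nrP[B hB]; exists B => k; apply: hB; exists k.
by move=> [B hB]; apply/bounded_nrP; exists B => _ [k _ <-].
Qed.

Lemma continuous_iter (f : V -> V) k : continuous f -> continuous (iter k f).
Proof.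
move=> fc; elim: k => [|k IH] z; first exact: cvg_id.
by apply: (@continuous_comp _ _ _ (iter k f) f); [exact: IH|exact: fc].
Qed.

Lemma cvg_cont (T : Type) (F : set_system T) {FF : Filter F} (h : V -> V)
    (u : T -> V) (a : V) :
  continuous h -> u @ F --> a -> (fun j => h (u j)) @ F --> h a.
Proof. by move=> hc ua; exact: (@continuous_cvg _ _ _ F FF u h a (hc a) ua). Qed.

Lemma cvg_iter (f : V -> V) k (F : set_system nat) {FF : Filter F} (u : nat -> V) a :
  continuous f -> u @ F --> a -> (fun j => iter k f (u j)) @ F --> iter k f a.
Proof. by move=> fc ua; exact: (cvg_cont (@continuous_iter f k fc) ua). Qed.

Lemma iter_cancel (f g : V -> V) k : cancel f g -> cancel (iter k f) (iter k g).
Proof.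
by move=> fK; elim: k => // k IH z; rewrite iterSr [iter k.+1 f z]iterS fK IH.
Qed.

Lemma iter_sub_cancel (f g : V -> V) k l z : cancel f g -> (l <= k)%N ->
  iter l g (iter k f z) = iter (k - l) f z.
Proof.
by move=> fK lk; rewrite -{1}(subnKC lk) iterD iter_cancel.
Qed.

Variables (f g : V -> V) (M : R).
Hypothesis H : escape f g M.

Let fK := es_fK H.

Lemma escape_iter z : M < nr z -> nr (g z) < 2 * nr z -> forall k,
  [/\ 2 ^+ k * nr z <= nr (iter k f z), nr z <= nr (iter k f z) &
      nr (g (iter k f z)) < 2 * nr (iter k f z)].
Proof.
move=> Mz gz; have M1 := es_M H.
elim=> [|k [IH1 IH2 IH3]] /=; first by rewrite expr0 mul1r.
have [h|] := es_dich H (lt_le_trans Mz IH2); last by rewrite leNgt IH3.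
have fz : nr z <= nr (f (iter k f z)) by apply: le_trans h; lra.
split => //; last by rewrite fK; lra.
by rewrite exprS -mulrA; apply: le_trans h; rewrite ler_pM2l.
Qed.

Lemma pow2_unbounded (a b : R) : 1 <= b -> exists k : nat, a < 2 ^+ k * b.
Proof.
move=> b1; have [k ak] : exists k : nat, a < k%:R.
  exists (Num.bound `|a|); apply: le_lt_trans (ler_norm a) _.
  by rewrite archi_boundP.
exists k; apply: (lt_le_trans ak); apply: (@le_trans _ _ (2 ^+ k)).
  by rewrite -natrX ler_nat ltnW // ltn_expl.
by rewrite ler_peMr // exprn_ge0.
Qed.

Lemma escape_notin z : M < nr z -> nr (g z) < 2 * nr z -> ~ Kp f z.
Proof.
move=> Mz gz [B hB]; have z1 : 1 <= nr z by have := es_M H; lra.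
have [k Bk] := pow2_unbounded B z1; have [h _ _] := escape_iter Mz gz k.
by have := lt_le_trans Bk (le_trans h (hB k)); rewrite ltxx.
Qed.

Lemma Kp_step z : Kp f z -> Kp f (f z).
Proof. by move=> [B hB]; exists B => k; rewrite -iterSr. Qed.

Lemma Kp_iter k z : Kp f z -> Kp f (iter k f z).
Proof. by elim: k => // k IH Kz; exact: Kp_step (IH Kz). Qed.

Lemma Kp_back z : Kp f (f z) -> Kp f z.
Proof.
move=> [B hB]; exists (Num.max B (nr z)) => -[|k] /=; rewrite le_max ?lexx ?orbT //.
by rewrite -iterS iterSr hB.
Qed.

Lemma Kp_iter_back k z : Kp f (iter k f z) -> Kp f z.
Proof. by elim: k z => // k IH z; rewrite iterSr => /IH/Kp_back. Qed.

Lemma Kp_bound z k : Kp f z -> nr (iter k f z) <= Num.max M (nr z).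
Proof.
move=> Kz; elim: k => [|k IH] /=; first by rewrite le_max lexx orbT.
have [|Mf] := leP (nr (f (iter k f z))) M; first by rewrite le_max => ->.
apply: le_trans IH; rewrite leNgt; apply/negP => h.
apply: (@escape_notin (f (iter k f z))) => //; last exact: (@Kp_iter k.+1).
by rewrite fK; have := nr_ge0 (iter k f z); lra.
Qed.

(** Without such a k the orbit would be bounded by max(M, |z|). Both strict inequalities are open
    conditions, whence [Kp_closed]. *)
Lemma notin_escape z : ~ Kp f z -> exists k,
  M < nr (iter k f z) /\ nr (g (iter k f z)) < nr (iter k f z).
Proof.
move=> nK; apply: contrapT => h; apply: nK; exists (Num.max M (nr z)).
elim=> [|k IH] /=; first by rewrite le_max lexx orbT.
have [|Mf] := leP (nr (f (iter k f z))) M; first by rewrite le_max => ->.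
apply: le_trans IH; rewrite leNgt; apply/negP => hlt; apply: h.
by exists k.+1; split => //=; rewrite fK.
Qed.

(** At a point of K+ of norm above M, [g] must double the norm, since otherwise the point would
    escape under [f]; as K+ is invariant, this repeats along the [g]-orbit. *)
Lemma K_bound z : Kp f z -> Kp g z -> nr z <= M.
Proof.
move=> Kf [B hB]; rewrite leNgt; apply/negP => Mz.
have gz : 2 * nr z <= nr (g z).
  by rewrite leNgt; apply/negP => h; exact: escape_notin Mz h Kf.
have S k : M < nr (iter k g z) /\ 2 ^+ k * nr z <= nr (iter k g z).
  elim: k => [|k [IH1 IH2]] /=; first by rewrite expr0 mul1r.
  have Kk : Kp f (iter k g z).
    by apply: (@Kp_iter_back k); rewrite iter_cancel //; exact: es_gK H.
  have h : 2 * nr (iter k g z) <= nr (g (iter k g z)).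
    by rewrite leNgt; apply/negP => h; exact: escape_notin IH1 h Kk.
  split; first by have := es_M H; lra.
  by rewrite exprS -mulrA; lra.
have z1 : 1 <= nr z by have := es_M H; lra.
have [k Bk] := pow2_unbounded B z1.
by have := lt_le_trans Bk (le_trans (S k).2 (hB k)); rewrite ltxx.
Qed.

Lemma near_nr_lt (T : Type) (F : set_system T) {FF : Filter F} (u v : T -> V) (a b : V) :
  u @ F --> a -> v @ F --> b -> nr a < nr b -> \forall j \near F, nr (u j) < nr (v j).
Proof.
move=> /cvg_nr ua /cvg_nr vb ab.
have [e e0 eE] : exists2 e, 0 < e & nr a + e = nr b - e.
  by exists ((nr b - nr a) / 2); [lra|lra].
move/cvgrPdist_lt/(_ e e0): ua => ua; move/cvgrPdist_lt/(_ e e0): vb.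
apply: filterS2 ua => j; rewrite !ltr_norml => /andP[h1 h2] /andP[h3 h4]; lra.
Qed.

Lemma near_nr_gt (T : Type) (F : set_system T) {FF : Filter F} (u : T -> V) (a : V) c :
  u @ F --> a -> c < nr a -> \forall j \near F, c < nr (u j).
Proof.
move=> /cvg_nr ua ca; have e0 : 0 < nr a - c by lra.
move/cvgrPdist_lt/(_ _ e0): ua; apply: filterS => j.
by rewrite ltr_norml => /andP[h1 h2]; lra.
Qed.

Lemma Kp_closed : closed (Kp f).
Proof.
rewrite -openC openE => z nK; have [k [Mk gk]] := notin_escape nK.
have ck : {for z, continuous (iter k f)} by apply: continuous_iter; exact: es_fc H.
have cgk : (g \o iter k f) @ nbhs z --> g (iter k f z).
  exact: (cvg_cont (es_gc H) ck).
have N1 : \forall w \near z, M < nr (iter k f w) by exact: near_nr_gt ck Mk.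
have N2 : \forall w \near z, nr (g (iter k f w)) < nr (iter k f w).
  exact: near_nr_lt cgk ck gk.
suff : \forall w \near z, ~ Kp f w by [].
apply: filterS2 N1 N2 => w Mw gw /(Kp_iter k); apply: escape_notin => //=.
by have := nr_ge0 (iter k f w); move: gw => /=; lra.
Qed.

Lemma recurrent_bounded z B :
  (forall m, exists2 k, (m <= k)%N & nr (iter k f z) <= B) -> Kp f z.
Proof.
move=> rec; apply: contrapT => /notin_escape[k0 [Mk gk]].
have w1 : 1 <= nr (iter k0 f z) by have := es_M H; lra.
have [k1 Bk] := pow2_unbounded B w1.
have [k kk hk] := rec (k0 + k1)%N.
have gk2 : nr (g (iter k0 f z)) < 2 * nr (iter k0 f z) by lra.
have [h _ _] := escape_iter Mk gk2 (k - k0).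
move: h; rewrite -iterD subnK; last by lia.
move=> h; have := le_trans h hk; apply/negP; rewrite -ltNge.
apply: lt_le_trans Bk _; rewrite ler_wpM2r ?nr_ge0 //.
by rewrite -!natrX ler_nat leq_exp2l //; lia.
Qed.

End Escape.

(** * Limits of orbit segments and nonwandering points *)

Section LimitSets.
Variables (R : realType) (n : nat).
Local Notation C := (Cplx R).
Local Notation V := 'rV[C]_n.
Implicit Types (f g : V -> V) (M : R).

(** If y escaped under [g] from step l on, so would nearby points g^l(f^(i_j)(u_j)), with norm above
    some c > M. Applying g^(i_j) to them gives g^l(u_j), still of norm above c, but these converge
    to g^l(x), a point of K. *)
Lemma limit_backward_bounded f g M (H : escape f g M) (F : set_system nat)
    {FF : ProperFilter F} (u : nat -> V) (i : nat -> nat) x y :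
  Kp f x -> Kp g x -> u @ F --> x -> (fun j => iter (i j) f (u j)) @ F --> y ->
  Kp g y.
Proof.
move=> Kf Kg ux uy; have H' := escape_sym H.
apply: contrapT => /(notin_escape H')[l [Ml fl]].
have iterC k z : iter k f (iter l f z) = iter l f (iter k f z) by rewrite -!iterD addnC.
pose w j := iter l g (iter (i j) f (u j)).
have wl : w @ F --> iter l g y by apply: cvg_iter uy; exact: es_gc H.
have fw : (fun j => f (w j)) @ F --> f (iter l g y).
  exact: (cvg_cont (es_fc H) wl).
have xl : (fun j => iter l g (u j)) @ F --> iter l g x.
  by apply: cvg_iter ux; exact: es_gc H.
have XM : nr (iter l g x) <= M.
  apply: (K_bound H); last exact: Kp_iter.
  apply: (@Kp_iter_back _ _ _ l); rewrite iter_cancel //; exact: es_gK H.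
pose c := (M + nr (iter l g y)) / 2.
have cM : M < c by rewrite /c; lra.
have cy : c < nr (iter l g y) by rewrite /c; lra.
have N3 : \forall j \near F, nr (f (w j)) < nr (w j) by exact: near_nr_lt fw wl fl.
have N2 : \forall j \near F, c < nr (w j) by exact: near_nr_gt wl cy.
have /cvg_nr/cvgrPdist_lt/(_ (c - M)) := xl; rewrite subr_gt0 => /(_ cM) N1.
have [j [[h1 h2] h3]] : exists j, (`|nr (iter l g x) - nr (iter l g (u j))| < c - M /\
    c < nr (w j)) /\ nr (f (w j)) < nr (w j).
  by apply: (@filter_ex _ F); apply: (filterI (filterI N1 N2) N3).
have fw2 : nr (f (w j)) < 2 * nr (w j) by have := nr_ge0 (w j); clear -h3; lra.
have [_ h4 _] := escape_iter H' (lt_trans cM h2) fw2 (i j).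
have E : iter (i j) g (w j) = iter l g (u j).
  by rewrite /w -iterD addnC iterD iter_cancel //; exact: es_fK H.
by rewrite E in h4; move: h1; rewrite ltr_norml => /andP[h5 h6]; clear -h2 h4 h5 XM; lra.
Qed.

Definition nw f : set V := [set x | forall e : R, 0 < e ->
  exists2 k, (0 < k)%N & exists z, nr (z - x) < e /\ nr (iter k f z - x) < e].

Lemma nonwanderingE f : nonwandering f = nw f.
Proof.
apply/seteqP; split => x hx.
  move=> e e0; have [|k k0 [q [/= U1 [z U2 E]]]] := hx [set y | nr (y - x) < e].
    by apply/nbhs_nrP; exists e.
  by exists k => //; exists z; split => //; rewrite E.
move=> U /nbhs_nrP[e e0 eU]; have [k k0 [z [z1 z2]]] := hx e e0.
exists k => //; exists (iter k f z); split; first exact: eU.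
by exists z => //; exact: eU.
Qed.

Lemma nw_closed f : closed (nw f).
Proof.
rewrite -openC openE => x /= nx; apply: contrapT => h; apply: nx => e e0.
have e2 : 0 < e / 2 by lra.
have [y xy ny] : exists2 y, nr (y - x) < e / 2 & nw f y.
  apply: contrapT => h2; apply: h; apply/nbhs_nrP; exists (e / 2) => // q qx nq.
  by apply: h2; exists q.
have [k k0 [z [z1 z2]]] := ny _ e2; exists k => //; exists z.
split; apply: le_lt_trans (nr_dist _ _ y) _; lra.
Qed.

Lemma nw_cancel f g : cancel f g -> nw f `<=` nw g.
Proof.
move=> fK x hx e e0; have [k k0 [z [z1 z2]]] := hx e e0.
by exists k => //; exists (iter k f z); rewrite iter_cancel.
Qed.

Lemma near_image (h : V -> V) x e : continuous h -> 0 < e -> exists2 d : R, 0 < d &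
  forall z, nr (z - x) < d -> nr (h z - h x) < e.
Proof.
move=> hc e0; have /cvg_nrP/(_ e e0) := hc x.
by move=> /nbhs_nrP.
Qed.

Lemma nw_step f x : continuous f -> nw f x -> nw f (f x).
Proof.
move=> fc hx e e0; have [d d0 hd] := near_image x fc e0.
have [k k0 [z [z1 z2]]] := hx d d0; exists k => //; exists (f z); split; first exact: hd.
by rewrite -iterSr iterS; exact: hd.
Qed.

Lemma nw_iter f x k : continuous f -> nw f x -> nw f (iter k f x).
Proof. by move=> fc hx; elim: k => //= k IH; exact: nw_step. Qed.

(** A periodic point returns at all multiples of its period. Otherwise the finitely many points
    f^k(x) with 0 < k < m differ from x, and a small ball has no return before time m. *)
Lemma nw_late f x m e : continuous f -> nw f x -> 0 < e ->
  exists2 k, (m <= k)%N & exists z, nr (z - x) < e /\ nr (iter k f z - x) < e.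
Proof.
move=> fc hx e0; have [[p p0 px]|np] := pselect (exists2 p, (0 < p)%N & iter p f x = x).
  exists (m * p)%N; first by rewrite leq_pmulr.
  have E : iter (m * p) f x = x by elim: m => //= m IH; rewrite mulSn iterD IH px.
  by exists x; rewrite E subrr nr0.
have [d d0 hd] : exists2 d : R, 0 < d & forall k, (0 < k < m)%N ->
    forall z, nr (z - x) < d -> d <= nr (iter k f z - x).
  elim: m => [|m [d d0 IH]]; first by exists 1 => // k; rewrite ltn0 andbF.
  have [m0|m0] := posnP m.
    by exists 1 => // k; rewrite m0 => /andP[]; case: k.
  have dp : 0 < nr (iter m f x - x).
    by apply: nr_gt0 => /subr0_eq h; apply: np; exists m.
  have [d' d'0 hd'] := near_image x (@continuous_iter _ _ f m fc) (divr_gt0 dp (ltr0Sn _ 1)).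
  exists (Num.min d (Num.min d' (nr (iter m f x - x) / 2))).
    by rewrite !lt_min d0 d'0 /=; lra.
  move=> k /andP[k0]; rewrite ltnS leq_eqVlt => /orP[/eqP ->|km] z.
    rewrite !lt_min => /and3P[_ zd' _]; have := hd' z zd'.
    have := nr_dist (iter m f x) x (iter m f z); rewrite (nrB _ (iter m f z)).
    by rewrite !ge_min => h1 h2; apply/orP; right; apply/orP; right; lra.
  rewrite lt_min => /andP[zd _]; rewrite ge_min; apply/orP; left.
  by apply: IH; rewrite ?k0.
have ed0 : 0 < Num.min e d by rewrite lt_min e0 d0.
have [k k0 [z []]] := hx _ ed0.
rewrite !lt_min => /andP[z1 z2] /andP[z3 z4].
exists k; last by exists z.
rewrite leqNgt; apply/negP => km; have := hd k _ z z2.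
by rewrite k0 km => /(_ isT); rewrite leNgt z4.
Qed.

Lemma periodic_nw f x : periodic_points f x -> nw f x.
Proof. by move=> [k k0 kx] e e0; exists k => //; exists x; rewrite kx subrr nr0. Qed.

(** Two terms of the sequence with distinct times lie on one orbit and near y. *)
Lemma limit_nw f (F : set_system nat) {FF : ProperFilter F} (k : nat -> nat) z y :
  (forall m, F [set j | (m <= k j)%N]) ->
  (fun j => iter (k j) f z) @ F --> y -> nw f y.
Proof.
move=> kF /cvg_nrP zy e e0; have [j1 h1] := filter_ex (zy e e0).
have : F [set j | nr (iter (k j) f z - y) < e /\ (k j1 < k j)%N].
  by apply: filterI; [exact: zy|exact: kF].
move=> /filter_ex[j2 [h2 k12]]; exists (k j2 - k j1)%N; first by rewrite subn_gt0.
by exists (iter (k j1) f z); rewrite -iterD subnK // ltnW.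
Qed.

(** Near a point where escape has begun, norms double at the first step and never fall back, so
    there is no return. *)
Lemma nw_bounded f g M (H : escape f g M) : nw f `<=` Kp f.
Proof.
move=> x hx; apply: contrapT => /(notin_escape H)[k [Mk gk]].
set w := iter k f x in Mk gk; have w_nw : nw f w := nw_iter k (es_fc H) hx.
have w1 : 1 <= nr w by have := es_M H; lra.
have [d d0 hd] := near_image w (es_gc H) (ltac:(lra) : 0 < (nr w - nr (g w)) / 4).
(* The last term separates twice the norm of z, above 3/2 |w|, from the norm of a return, below 5/4
   |w|; the others keep the escape condition at z. *)
pose e := Num.min d (Num.min ((nr w - nr (g w)) / 4) (Num.min (nr w - M) (nr w / 4))).
have e0 : 0 < e by rewrite !lt_min d0 /=; lra.
have [l l0 [z []]] := w_nw e e0; rewrite !lt_min => /and4P[z1 z2 z3 z4] /and4P[_ _ _ z5].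
have gz := hd z z1.
have nd (a b : V) : nr a <= nr b + nr (a - b) /\ nr b <= nr a + nr (a - b).
  split; first by rewrite -{1}(subrK b a) addrC nrD.
  by rewrite nrB -{1}(subrK a b) addrC nrD.
have [a1 a2] := nd z w; have [a3 a4] := nd (g z) (g w); have [a5 a6] := nd (iter l f z) w.
have Mz : M < nr z by clear -a2 z3; lra.
have gz2 : nr (g z) < 2 * nr z by clear -gz a3 a2 z2 gk w1; lra.
have [h _ _] := escape_iter H Mz gz2 l.
have : 2 * nr z <= 2 ^+ l * nr z.
  by case: l l0 {z5 a5 a6 h} => // l _; rewrite exprS -mulrA ler_pM2l //
    ler_peMl ?nr_ge0 // exprn_ege1 // ler1n.
clear -h a5 z5 a2 z4 w1; lra.
Qed.

End LimitSets.

(** * Regularity forces escape *)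

Section Growth.
Variable R : realType.
Local Notation C := (Cplx R).

Lemma le0_of_inv (a b : R) : 0 <= b -> (forall r, 1 <= r -> a <= b / r) -> a <= 0.
Proof.
move=> b0 h; rewrite leNgt; apply/negP => a0.
pose r := 1 + b / a.
have ba : 0 <= b / a by rewrite divr_ge0 // ltW.
have r1 : 1 <= r by rewrite /r lerDl.
have := h r r1; rewrite ler_pdivlMr; last by apply: lt_le_trans r1.
rewrite /r mulrDr mulr1 mulrCA divff ?gt_eqF // mulr1; lra.
Qed.

(** A form of degree at most 1 that passes to inverses. Regularity asserts d > 1 for [f] alone, and
    the dichotomy uses it for the inverse too. *)
Definition lin_growth n m (h : 'rV[C]_n -> 'rV[C]_m) :=
  exists2 B : R, 0 <= B & forall z, nr (h z) <= B * (1 + nr z).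

Lemma lin_growth_polymap n m (p : 'I_m -> mpoly n C) :
  (forall i u, u \in msupp (p i) -> (mdeg u <= 1)%N) -> lin_growth (polymap p).
Proof.
move=> deg; pose S i := \sum_(u <- msupp (p i)) cmod (mcoeff u (p i)).
have S0 i : 0 <= S i by apply: sumr_ge0 => u _; exact: cmod_ge0.
exists (\sum_i S i); first by apply: sumr_ge0.
move=> z; have z1 : 1 <= 1 + nr z by rewrite lerDl nr_ge0.
have z0 : 0 <= 1 + nr z by apply: le_trans z1.
apply/nr_le => [|i]; first by rewrite mulr_ge0 // sumr_ge0.
rewrite mxE; apply: (@le_trans _ _ (S i * (1 + nr z))); last first.
  by rewrite ler_wpM2r // (bigD1 i) //= lerDl sumr_ge0.
rewrite mevalE; apply: le_trans (cmod_sum _ _ _) _.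
rewrite /S mulr_suml big_seq [leRHS]big_seq; apply: ler_sum => u up.
rewrite cmodM cmod_prod ler_wpM2l ?cmod_ge0 //.
apply: (@le_trans _ _ ((1 + nr z) ^+ mdeg u)).
  rewrite mdegE -prodrXr; apply: ler_prod => j _.
  rewrite cmod_ge0 /= cmodX lerXn2r ?nnegrE ?cmod_ge0 //.
  by apply: le_trans (nr_coord z j) _; rewrite lerDr.
by rewrite -[leRHS]expr1; apply: ler_weXn2l => //; exact: deg up.
Qed.

Lemma lin_growth_affine n m (h : 'rV[C]_n -> 'rV[C]_m) :
  curve_poly h -> (forall z, differentiable h z) -> lin_growth h ->
  forall z, h z = h 0 + 'd h 0 z.
Proof.
move=> hp hd [B B0 hB] z; apply/eqP; rewrite -subr_eq0 opprD addrA; apply/eqP/nr_eq0.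
apply/eqP; rewrite eq_le nr_ge0 andbT.
have a0 := nr_ge0 z.
apply: (@le0_of_inv _ (4 * B * (1 + nr z) ^+ 2)); first by rewrite mulr_ge0 ?sqr_ge0 // mulr_ge0.
move=> s s1.
(* Ensures |z| <= r / 2 and r >= s, so that the quadratic remainder, of order 1 / r, is of order 1 /
   s. *)
pose r := s * (2 * (1 + nr z)).
have r1 : 2 * (1 + nr z) <= r by rewrite /r ler_peMl //; lra.
have r0 : 0 < r by lra.
have hM y : nr (y - 0) <= r -> nr (h y) <= B * (1 + r).
  by rewrite subr0 => yr; apply: le_trans (hB y) _; rewrite ler_wpM2l // lerD2l.
have := @diff_remainder _ _ _ h hp hd 0 z r _ r0 hM.
rewrite add0r => /(_ (ltac:(lra) : nr z <= r / 2)) h1; apply: le_trans h1 _.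
have -> : 2 * (B * (1 + r)) * (nr z / r) ^+ 2 = 2 * B * nr z ^+ 2 * ((1 + r) / r) / r.
  by field; rewrite gt_eqF.
have le2 : (1 + r) / r <= 2 by rewrite ler_pdivrMr //; lra.
apply: (@le_trans _ _ (2 * B * nr z ^+ 2 * 2 / r)).
  rewrite ler_wpM2r ?invr_ge0 ?(ltW r0) // ler_wpM2l // !mulr_ge0 ?sqr_ge0 //.
have zz : nr z ^+ 2 <= (1 + nr z) ^+ 2 by rewrite lerXn2r ?nnegrE //; lra.
have sr : s <= r by rewrite /r ler_peMr //; lra.
have s0 : 0 < s by lra.
apply: ler_pM; rewrite ?invr_ge0 ?(ltW r0) //.
- by rewrite !mulr_ge0 ?sqr_ge0.
- rewrite -!mulrA mulrCA [leRHS]mulrCA ler_wpM2l //; lra.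
- by rewrite lef_pV2.
Qed.

Lemma nr_mulmx n m (A : 'M[C]_(n, m)) : exists2 B : R, 0 <= B &
  forall v : 'rV[C]_n, nr (v *m A) <= B * nr v.
Proof.
exists (\sum_i \sum_j cmod (A i j)).
  by apply: sumr_ge0 => i _; apply: sumr_ge0 => j _; exact: cmod_ge0.
move=> v; apply/nr_le => [|j].
  rewrite mulr_ge0 ?nr_ge0 //.
  by apply: sumr_ge0 => i _; apply: sumr_ge0 => j _; exact: cmod_ge0.
rewrite mxE; apply: le_trans (cmod_sum _ _ _) _; rewrite mulr_suml.
apply: ler_sum => i _; rewrite cmodM mulrC ler_pM ?cmod_ge0 ?nr_coord //.
by rewrite (bigD1 j) //= lerDl; apply: sumr_ge0 => k _; exact: cmod_ge0.
Qed.

Lemma lin_growth_inverse n (p : 'I_n -> mpoly n C) (f : 'rV[C]_n -> 'rV[C]_n) :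
  cancel f (polymap p) -> cancel (polymap p) f ->
  lin_growth (polymap p) -> lin_growth f.
Proof.
move=> fK pK /lin_growth_affine aff.
have {}aff z : polymap p z = polymap p 0 + z *m jac p 0.
  rewrite -diff_polymap; apply: aff => [|x]; first exact: curve_poly_polymap.
  exact: differentiable_polymap.
set A := jac p 0 in aff.
have Aunit : A \in unitmx.
  rewrite -row_free_unit; apply/row_freeP.
  have /row_freeP//: row_free A.
  rewrite -kermx_eq0; apply/eqP/row_matrixP => i; rewrite row0.
  have : row i (kermx A) *m A = 0 by rewrite -row_mul mulmx_ker row0.
  move=> ker; apply: (can_inj pK); rewrite aff ker addr0 //.
have [B B0 hB] := nr_mulmx (invmx A).
exists (B * (1 + nr (polymap p 0))); first by rewrite mulr_ge0 // addr_ge0 ?nr_ge0.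
move=> y; have -> : f y = (y - polymap p 0) *m invmx A.
  have yE : y = polymap p 0 + f y *m A by rewrite -aff fK.
  have -> : y - polymap p 0 = f y *m A by rewrite {1}yE addrAC subrr add0r.
  by rewrite mulmxK.
apply: le_trans (hB _) _; rewrite -mulrA ler_wpM2l //.
apply: le_trans (nrD _ _) _; rewrite nrN.
by have := nr_ge0 y; have := nr_ge0 (polymap p 0); nra.
Qed.

Lemma meval_bounded_mderiv n (p : mpoly n C) j (B : R) :
  (forall z : 'rV[C]_n, cmod (meval (fun i => z 0 i) p) <= B) -> mderiv j p = 0.
Proof.
move=> hB; apply: meval_eq0 => v; pose z := \row_i v i : 'rV[C]_n.
have B0 : 0 <= B by apply: le_trans (hB z); exact: cmod_ge0.
have -> : meval v (mderiv j p) = meval (fun i => z 0 i) (mderiv j p).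
  by apply: meval_eq => i; rewrite mxE.
apply/cmod_eq0/eqP; rewrite eq_le cmod_ge0 andbT.
have := line_curve_coef1 z (delta_mx 0 j) p.
rewrite (bigD1 j) //= big1 => [|i ij]; last by rewrite mxE (negbTE ij) andbF mul0r.
rewrite mxE !eqxx mul1r addr0 => <-.
apply: (@le0_of_inv _ B) => // r r1.
have r0 : 0 < r by lra.
rewrite ler_pdivlMr // -[X in _ * X <= _]expr1; apply: cauchy_coef => // t _.
by rewrite horner_line_curve.
Qed.

(** By Cauchy's estimate the first partial derivatives are bounded, so by Liouville's argument the
    second ones vanish; a monomial of degree at least 2 would survive two derivations. *)
Lemma lin_growth_deg n m (p : 'I_m -> mpoly n C) : lin_growth (polymap p) ->
  forall i u, u \in msupp (p i) -> (mdeg u <= 1)%N.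
Proof.
move=> [B B0 hB] i u up.
have der1 j (z : 'rV[C]_n) : cmod (meval (fun i => z 0 i) (mderiv j (p i))) <= B.
  have := diff_polymap p z (delta_mx 0 j).
  rewrite -rowE => /rowP/(_ i); rewrite !mxE => <-.
  apply: le_trans (nr_coord _ _) _; rewrite -subr_le0.
  have d1 : nr (delta_mx 0 j : 'rV[C]_n) <= 1.
    apply/nr_le => // k; rewrite mxE; case: (_ && _); rewrite ?cmod1 ?cmod0 //.
  apply: (@le0_of_inv _ (B * (1 + nr z))) => [|r r1].
    by rewrite mulr_ge0 // addr_ge0 ?nr_ge0.
  have r0 : 0 < r by lra.
  have hM y : nr (y - z) <= r -> nr (polymap p y) <= B * (1 + nr z + r).
    move=> yz; apply: le_trans (hB y) _; rewrite ler_wpM2l // -addrA lerD2l.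
    by have := nrD (y - z) z; rewrite subrK; lra.
  have := diff_bound (curve_poly_polymap p) (@differentiable_polymap _ _ _ p) (delta_mx 0 j) r0 hM.
  move=> h; rewrite lerBlDr; apply: le_trans h _.
  apply: (@le_trans _ _ (B * (1 + nr z + r) / r)).
    rewrite ler_piMr // mulr_ge0 ?invr_ge0 ?(ltW r0) // mulr_ge0 //.
    by have := nr_ge0 z; lra.
  by rewrite [B * (_ + r)]mulrDr mulrDl mulfK // gt_eqF.
have der2 j k : mderiv k (mderiv j (p i)) = 0 := meval_bounded_mderiv k (der1 j).
rewrite leqNgt; apply/negP => u1.
have [j uj] : exists j, (0 < u j)%N.
  apply/existsP; apply: contraLR u1; rewrite negb_exists => /forallP h.
  rewrite mdegE big1 // => j _; apply/eqP; by rewrite eqn0Ngt.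
pose u' := mnm_sub u (mnm1 j).
have uE : u = mnm_add u' (mnm1 j).
  by rewrite submK //; apply/mnm_lepP => k; rewrite mnm1E; case: eqP => // <-.
have u'1 : (0 < mdeg u')%N by move: u1; rewrite uE mdegD mdeg1; lia.
have [k uk] : exists k, (0 < u' k)%N.
  apply/existsP; apply: contraLR u'1; rewrite negb_exists => /forallP h.
  rewrite mdegE big1 // => l _; apply/eqP; by rewrite eqn0Ngt.
pose u'' := mnm_sub u' (mnm1 k).
have u'E : u' = mnm_add u'' (mnm1 k).
  by rewrite submK //; apply/mnm_lepP => l; rewrite mnm1E; case: eqP => // <-.
have : mcoeff u'' (mderiv k (mderiv j (p i))) = 0 by rewrite der2 mcoeff0.
rewrite !mcoeff_mderiv -u'E -uE => /eqP; rewrite !mulrn_eq0 /=.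
by move: up; rewrite mcoeff_msupp => /negbTE ->.
Qed.

Lemma msupp_deg n m (p : 'I_m -> mpoly n C) i u :
  u \in msupp (p i) -> (mdeg u <= degmap p)%N.
Proof.
move=> up; apply: leq_trans (leq_bigmax i).
by have := msize_mdeg_lt up; case: (msize (p i)).
Qed.

Lemma pa_deg_inv n (f : polyaut R n) : (1 < pa_deg f)%N -> (1 < pa_deg (pa_inv f))%N.
Proof.
rewrite !ltnNge; apply: contra => d1.
have /lin_growth_deg deg : lin_growth (polymap (pa_poly f)).
  apply: (lin_growth_inverse (pa_polyK f) (pa_ipolyK f)).
  by apply: lin_growth_polymap => i u up; apply: leq_trans d1; exact: msupp_deg up.
apply/bigmax_leqP => i _; have [->|p0] := eqVneq (pa_poly f i) 0.
  by rewrite msize0.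
by rewrite -mlead_deg //; apply: (deg i); exact: mlead_supp.
Qed.

End Growth.

(** * Homogeneous lifts near the hyperplane at infinity *)

Section Dichotomy.
Variable R : realType.
Local Notation C := (Cplx R).

Definition homog_pt n (t : C) (w : 'rV[C]_n) : 'rV[C]_n.+1 :=
  \row_j if unlift ord0 j is Some i then w 0 i else t.

Lemma meval_homogenize n d (p : mpoly n C) (t : C) (z : 'rV[C]_n) :
  (forall u, u \in msupp p -> (mdeg u <= d)%N) -> t != 0 ->
  meval (fun j => homog_pt t (t *: z) 0 j) (homogenize d p) =
  t ^+ d * meval (fun i => z 0 i) p.
Proof.
move=> deg t0; rewrite /homogenize raddf_sum /= mevalE mulr_sumr.
rewrite big_seq [RHS]big_seq; apply: eq_bigr => u up.
rewrite mevalZ mevalX mulrCA; congr (_ * _).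
rewrite big_ord_recl !mnmE mxE unlift_none.
rewrite (eq_bigr (fun i => t ^+ u i * z 0 i ^+ u i)); last first.
  by move=> i _; rewrite mnmE !mxE liftK mxE exprMn.
by rewrite big_split /= prodrXr -mdegE mulrA -exprD subnK // deg.
Qed.

(** By homogeneity the lift at (1, z) / |z| equals |z|^(-d) (1, f(z)), and d >= 2. *)
Lemma homog_lift_small n (f : polyaut R n) (z : 'rV[C]_n) :
  (1 < pa_deg f)%N -> 1 <= nr z -> nr (pa_fun f z) <= 2 * nr z ->
  nr (polymap (homog_lift f) (homog_pt (ofR (nr z)^-1) (ofR (nr z)^-1 *: z)))
    <= 2 / nr z.
Proof.
move=> d1 z1 fz; have z0 : 0 < nr z by lra.
have t0 : ofR (nr z)^-1 != 0 :> C.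
  by apply/eqP => /(@ofR_inj _ _ 0)/eqP; rewrite invr_eq0 gt_eqF.
have x0 : 0 < (nr z)^-1 by rewrite invr_gt0.
have x1 : (nr z)^-1 <= 1 by rewrite invf_le1.
apply/nr_le => [|i]; first by rewrite divr_ge0 // ltW.
rewrite mxE /homog_lift; case: (unliftP ord0 i) => [j|] _.
  rewrite meval_homogenize => [|u up|//]; last exact: msupp_deg up.
  rewrite cmodM cmodX cmod_ofR gtr0_norm //.
  have fj : cmod (meval (fun i => z 0 i) (pa_poly f j)) <= 2 * nr z.
    by apply: le_trans fz; have := nr_coord (pa_fun f z) j; rewrite mxE.
  apply: le_trans (ler_wpM2l _ fj) _; first by rewrite exprn_ge0 // ltW.
  have h : (nr z)^-1 ^+ pa_deg f <= (nr z)^-1 ^+ 2 by rewrite ler_wiXn2l // ltW.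
  apply: le_trans (ler_wpM2r _ h) _; first by rewrite mulr_ge0 // ltW.
  by rewrite le_eqVlt; apply/orP; left; apply/eqP; field; rewrite gt_eqF.
rewrite meval_homogenize => [|u|//]; last first.
  by rewrite msupp1 inE => /eqP ->; rewrite mdeg0.
rewrite meval1 mulr1 cmodX cmod_ofR gtr0_norm //.
have h : (nr z)^-1 ^+ pa_deg f <= (nr z)^-1 ^+ 1.
  by rewrite ler_wiXn2l ?(ltW x0) // ltnW.
by apply: le_trans h _; rewrite expr1; lra.
Qed.

Lemma nr_homog_pt n (t : C) (w : 'rV[C]_n) :
  nr w <= nr (homog_pt t w) <= Num.max (cmod t) (nr w).
Proof.
apply/andP; split.
  apply/nr_le => [|i]; first exact: nr_ge0.
  by have := nr_coord (homog_pt t w) (lift ord0 i); rewrite mxE liftK.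
apply/nr_le => [|i]; first by rewrite le_max cmod_ge0.
by rewrite mxE le_max; case: (unlift _ _) => [j|]; rewrite ?nr_coord ?lexx ?orbT.
Qed.

(* At points [z] violating the dichotomy, the rescaled points [[1/|z| : z/|z|]]
   have lifts converging to a common zero of the homogeneous lifts of [f] and [f^-1]. *)
Lemma regular_dichotomy n (f : polyaut R n) : regular f ->
  exists2 M : R, 1 <= M & forall z, M < nr z ->
    2 * nr z <= nr (pa_fun f z) \/ 2 * nr z <= nr (pa_fun (pa_inv f) z).
Proof.
move=> [d1 disj]; have d1' := pa_deg_inv d1.
apply: contrapT => H.
have bad (j : nat) : exists z : 'rV[C]_n, [/\ j.+1%:R < nr z,
    nr (pa_fun f z) <= 2 * nr z & nr (pa_fun (pa_inv f) z) <= 2 * nr z].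
  apply: contrapT => h; apply: H; exists j.+1%:R; first by rewrite ler1n.
  move=> z jz; apply: contrapT => /not_orP[h1 h2]; apply: h; exists z.
  by split; [exact: jz| |]; rewrite leNgt; apply/negP => /ltW; [exact: h1|exact: h2].
have [z zP] := choice bad.
have z1 j : 1 < nr (z j).
  by have [h _ _] := zP j; apply: le_lt_trans h; rewrite ler1n.
have [F [FU FF]] := free_ultrafilter.
pose u j := homog_pt (ofR (nr (z j))^-1) (ofR (nr (z j))^-1 *: z j).
have nw j : nr (ofR (nr (z j))^-1 *: z j) = 1.
  rewrite nrZ cmod_ofR gtr0_norm ?invr_gt0; last by apply: lt_trans (z1 j).
  by rewrite mulVf // gt_eqF //; apply: lt_trans (z1 j).
have u1 j : 1 <= nr (u j) <= 1.
  have /andP[h1 h2] := nr_homog_pt (ofR (nr (z j))^-1) (ofR (nr (z j))^-1 *: z j).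
  rewrite nw in h1 h2; rewrite h1 /=; apply: le_trans h2 _.
  rewrite ge_max lexx andbT cmod_ofR ger0_norm ?invr_ge0 ?nr_ge0 //.
  by rewrite invf_le1 ?(ltW (z1 j)) //; apply: lt_trans (z1 j).
have [x ux] : exists x : 'rV[C]_n.+1, u @ F --> x.
  by apply: (@ultra_cvg _ _ F FU u 1); apply: FF; exists 0%N => j _; case/andP: (u1 j).
have x0 : x != 0.
  apply/eqP => x0; have /cvg_nrP/(_ 1 ltr01)/filter_ex[j] := ux.
  by rewrite x0 subr0; case/andP: (u1 j) => h _; rewrite ltNge h.
have zero (g : polyaut R n) : (1 < pa_deg g)%N ->
    (forall j, nr (pa_fun g (z j)) <= 2 * nr (z j)) -> polymap (homog_lift g) x = 0.
  move=> dg gz; apply: nr_eq0; apply/eqP; rewrite eq_le nr_ge0 andbT leNgt.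
  apply/negP => e0.
  have /cvg_nrP : (fun j => polymap (homog_lift g) (u j)) @ F --> polymap (homog_lift g) x.
    exact: (@continuous_cvg _ _ _ F _ u _ x (@continuous_polymap _ _ _ _ x) ux).
  set e := nr _ in e0 * => /(_ (e / 2) (ltac:(lra))) h1.
  have h2 : F [set j | (Num.bound (4 / e) <= j)%N] by apply: FF; exists (Num.bound (4 / e)).
  have [j [h3 h4]] := filter_ex (filterI h1 h2).
  have h5 := homog_lift_small dg (ltW (z1 j)) (gz j).
  have h6 : 2 / nr (z j) < e / 2.
    have zp : 0 < nr (z j) by apply: lt_trans (z1 j).
    have [zj _ _] := zP j.
    have be : 4 / e < nr (z j).
      apply: lt_trans zj; apply: (@lt_le_trans _ _ (Num.bound (4 / e))%:R).
        by apply: archi_boundP; rewrite divr_ge0 // ltW.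
      by rewrite ler_nat ltnW.
    by move: be; rewrite !ltr_pdivrMr //; move: (nr (z j)) => a; clear -e0; lra.
  have := nrD (polymap (homog_lift g) x - polymap (homog_lift g) (u j))
    (polymap (homog_lift g) (u j)).
  rewrite subrK -/e nrB => h7; have := le_lt_trans h7 (ltrD h3 (le_lt_trans h5 h6)).
  by rewrite -splitr ltxx.
have : (indeterminacy f `&` indeterminacy (pa_inv f)) (projpt x).
  split; exists x => //; split => /=; try exact/eqP.
    by apply: zero => // j; case: (zP j).
  by apply: zero => // j; case: (zP j).
by rewrite disj.
Qed.

Lemma regular_escape n (f : polyaut R n) : regular f ->
  exists M, escape (pa_fun f) (pa_fun (pa_inv f)) M.
Proof.
move=> /regular_dichotomy[M M1 dich]; exists M.
have D (p : 'I_n -> mpoly n C) (F : set_system nat) (FF : Filter F) (u v : nat -> 'rV[C]_n) a b :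
    u @ F --> a -> v @ F --> b -> (fun k => 'd (polymap p) (u k) (v k)) @ F --> 'd (polymap p) a b.
  exact: cvg_diff_polymap.
exact: (Escape (pa_polyK f) (pa_ipolyK f) (@continuous_polymap _ _ _ _)
  (@continuous_polymap _ _ _ _) (curve_poly_polymap _) (curve_poly_polymap _)
  (@differentiable_polymap _ _ _ _) (@differentiable_polymap _ _ _ _)
  (D _) (D _) M1 dich).
Qed.

End Dichotomy.

(** * The Jacobian and the interiors of K+ and K- *)

Section Determinants.
Variable R : realType.
Local Notation C := (Cplx R).

Lemma cmod_det n (A : 'M[C]_n) (B : R) :
  (forall i j, cmod (A i j) <= B) -> cmod (\det A) <= (n`!)%:R * B ^+ n.
Proof.
move=> AB; rewrite /determinant; apply: le_trans (cmod_sum _ _ _) _.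
apply: (@le_trans _ _ (\sum_(s : 'S_n) B ^+ n)).
  apply: ler_sum => s _; rewrite cmodM cmodX cmodN cmod1 expr1n mul1r cmod_prod.
  rewrite -[X in _ <= _ ^+ X](card_ord n) -prodr_const.
  by apply: ler_prod => i _; rewrite cmod_ge0 AB.
by rewrite sumr_const card_Sn mulr_natl.
Qed.

(** The vector det(A) v is v A times the adjugate of A, whose entries are at most (n - 1)! |B|^(n -
    1). *)
Lemma inverse_bound n (B : R) : exists2 D : R, 0 < D & forall A : 'M[C]_n,
  (forall i j, cmod (A i j) <= B) -> 1 <= cmod (\det A) ->
  forall v : 'rV[C]_n, nr v <= D * nr (v *m A).
Proof.
pose E : R := (n.-1`!)%:R * `|B| ^+ n.-1.
have E0 : 0 <= E by rewrite mulr_ge0 // exprn_ge0.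
exists (1 + n%:R * E); first by rewrite ltr_pwDl // mulr_ge0.
move=> A AB dA v; set w := v *m A.
have adjE i j : cmod (\adj A i j) <= E.
  rewrite mxE /cofactor cmodM cmodX cmodN cmod1 expr1n mul1r.
  apply: cmod_det => k l; rewrite !mxE.
  by apply: le_trans (AB _ _) _; exact: ler_norm.
have wE : w *m \adj A = \det A *: v by rewrite -mulmxA mul_mx_adj mul_mx_scalar.
have h : nr (w *m \adj A) <= n%:R * E * nr w.
  apply/nr_le => [|j]; first by rewrite !mulr_ge0 ?nr_ge0.
  rewrite mxE; apply: le_trans (cmod_sum _ _ _) _.
  apply: (@le_trans _ _ (\sum_(i < n) E * nr w)).
    by apply: ler_sum => i _; rewrite cmodM mulrC ler_pM ?cmod_ge0 ?nr_coord.
  by rewrite sumr_const card_ord -[leLHS]mulr_natl mulrA.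
rewrite wE nrZ in h.
apply: (@le_trans _ _ (cmod (\det A) * nr v)); first by rewrite ler_peMl ?nr_ge0.
by apply: le_trans h _; rewrite ler_wpM2r ?nr_ge0 // lerDr.
Qed.

Lemma det_jac n (p : 'I_n -> mpoly n C) (z : 'rV[C]_n) :
  \det (jac p z) = meval (fun k => z 0 k) (\det (\matrix_(j, i) mderiv j (p i))).
Proof.
rewrite -(det_map_mx (meval (fun k => z 0 k))); congr (\det _).
by apply/matrixP => i j; rewrite !mxE.
Qed.

Lemma jac_comp n (p q : 'I_n -> mpoly n C) z : cancel (polymap p) (polymap q) ->
  jac p z *m jac q (polymap p z) = 1%:M.
Proof.
move=> pK; apply/row_matrixP => i; rewrite !rowE mulmxA mulmx1.
rewrite -!diff_polymap.
have := diff_comp (@differentiable_polymap _ _ _ p z) (@differentiable_polymap _ _ _ q _).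
rewrite (_ : polymap q \o polymap p = id); last by apply/funext => x /=; rewrite pK.
by move=> /(congr1 (fun h => h (delta_mx 0 i))) /= <-; rewrite diff_val.
Qed.

Definition jac_det n (f : polyaut R n) : C := \det (jac (pa_poly f) 0).

(** The chain rule makes the Jacobian matrix invertible everywhere, so its determinant is a
    polynomial without zeros. *)
Lemma jac_detE n (f : polyaut R n) z : \det (jac (pa_poly f) z) = jac_det f.
Proof.
have nv x : \det (jac (pa_poly f) x) != 0.
  apply/eqP => d0; have := congr1 determinant (jac_comp x (pa_polyK f)).
  by rewrite det_mulmx d0 mul0r det1 => /esym/eqP; rewrite oner_eq0.
rewrite /jac_det !det_jac (nonvanishing_meval_const _ (fun k => z 0 k)).
  by apply: meval_eq => k; rewrite mxE.
move=> v; have := nv (\row_k v k); rewrite det_jac.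
by rewrite (meval_eq (v2 := v)) // => k; rewrite mxE.
Qed.

Lemma jac_det_inv n (f : polyaut R n) : jac_det f * jac_det (pa_inv f) = 1.
Proof.
have := congr1 determinant (jac_comp 0 (pa_polyK f)).
by rewrite det_mulmx det1 jac_detE (jac_detE (pa_inv f)).
Qed.

Lemma differentiable_iter n (f : 'rV[C]_n -> 'rV[C]_n) k :
  (forall z, differentiable f z) -> forall z, differentiable (iter k f) z.
Proof.
move=> fd; elim: k => [|k IH] z.
  by rewrite (_ : iter 0 f = id) //; exact: differentiable_id.
rewrite (_ : iter k.+1 f = f \o iter k f) //.
by apply: differentiable_comp.
Qed.

Lemma diff_iterS n (f : 'rV[C]_n -> 'rV[C]_n) k z v :
  (forall z, differentiable f z) ->
  'd (iter k.+1 f) z v = 'd f (iter k f z) ('d (iter k f) z v).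
Proof.
move=> fd; have -> : iter k.+1 f = f \o iter k f by [].
exact: (congr1 (fun h => h v) (diff_comp (differentiable_iter k fd z) (fd _))).
Qed.

Lemma diff_iter0 n (f : 'rV[C]_n -> 'rV[C]_n) z v : 'd (iter 0 f) z v = v.
Proof. by have -> : iter 0 f = id by []; rewrite diff_val. Qed.

Lemma diff_iterD n (f : 'rV[C]_n -> 'rV[C]_n) k l z v :
  (forall z, differentiable f z) ->
  'd (iter (k + l) f) z v = 'd (iter k f) (iter l f z) ('d (iter l f) z v).
Proof.
move=> fd; have E : iter (k + l) f = iter k f \o iter l f.
  by apply/funext => x; exact: iterD.
apply: etrans (congr1 (fun h => 'd h z v) E) _.
exact: (congr1 (fun h => h v)
  (diff_comp (differentiable_iter l fd z) (differentiable_iter k fd _))).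
Qed.

(** The real Jacobian of the iterate is |det A|^2, so no iterate contracts volume. *)
Definition expands_volume n (g : 'rV[C]_n -> 'rV[C]_n) := forall k z, exists A : 'M[C]_n,
  (forall v, 'd (iter k g) z v = v *m A) /\ 1 <= cmod (\det A).

Lemma jac_det_expands n (f : polyaut R n) :
  1 <= cmod (jac_det f) -> expands_volume (pa_fun f).
Proof.
move=> d1 k z; elim: k => [|k [A [IH1 IH2]]].
  exists 1%:M; rewrite det1 cmod1; split => // v.
  by rewrite diff_iter0 mulmx1.
exists (A *m jac (pa_poly f) (iter k (pa_fun f) z)); split => [v|].
  rewrite diff_iterS; last exact: differentiable_polymap.
  by rewrite diff_polymap IH1 mulmxA.
by rewrite det_mulmx jac_detE cmodM mulr_ege1.
Qed.

End Determinants.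

(** * Uniform bounds for all iterates on the interior of K+ *)

Section InteriorInclusion.
Variables (R : realType) (n : nat).
Local Notation C := (Cplx R).
Local Notation V := 'rV[C]_n.

Lemma segment_IVT (c : R -> V) y (d : R) :
  {within `[0, 1], continuous (fun s => nr (c s - y))} ->
  nr (c 0 - y) <= d -> d <= nr (c 1 - y) ->
  exists2 s : R, 0 <= s <= 1 & nr (c s - y) = d.
Proof.
move=> cc c0 c1; have [|s] := @IVT R (fun s => nr (c s - y)) 0 1 d ler01 cc.
  by rewrite ge_min c0 /= le_max c1 orbT.
by rewrite in_itv /=; exists s.
Qed.

Lemma interior_nrP (A : set V) x :
  A° x <-> exists2 e : R, 0 < e & forall q, nr (q - x) < e -> A q.
Proof. exact: nbhs_nrP. Qed.

Variables (f g : V -> V) (M : R).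
Hypothesis H : escape f g M.

Lemma interior_Kp_bound y : (Kp f)° y -> exists r B : R,
  [/\ 0 < r, 0 < B & forall k z, nr (z - y) <= r ->
      Kp f z /\ nr (iter k f z) <= B].
Proof.
move=> /interior_nrP[e e0 he].
pose r := Num.min (e / 2) 1.
have r0 : 0 < r by rewrite lt_min ltr01 andbT divr_gt0.
exists r, (M + nr y + 1); split => //.
  by have := es_M H; have := nr_ge0 y; lra.
move=> k z; rewrite le_min => /andP[h1 h2].
have Kz : Kp f z by apply: he; lra.
split => //; apply: le_trans (Kp_bound H k Kz) _.
have := es_M H; have := nr_ge0 y; have := nrD (z - y) y; rewrite subrK ge_max.
by move=> *; apply/andP; split; lra.
Qed.

Lemma iter_curve_poly k : curve_poly (iter k f).
Proof. by apply: curve_poly_iter; exact: es_fp H. Qed.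

Lemma iter_differentiable k z : differentiable (iter k f) z.
Proof. by apply: differentiable_iter; exact: es_fd H. Qed.

Lemma interior_Kp_diff y : (Kp f)° y ->
  exists2 L : R, 0 < L & forall k v, nr ('d (iter k f) y v) <= L * nr v.
Proof.
move=> /interior_Kp_bound[r [B [r0 B0 hB]]]; exists (B / r); first exact: divr_gt0.
move=> k v; apply: diff_bound => // [||z zy].
- exact: iter_curve_poly.
- exact: iter_differentiable.
- by case: (hB k z zy).
Qed.

End InteriorInclusion.

(** * Volume and the inclusion of int K- in int K+ *)

Section VolumeInclusion.
Variables (R : realType) (n : nat).
Local Notation C := (Cplx R).
Local Notation V := 'rV[C]_n.
Variables (f g : V -> V) (M : R).
Hypothesis H : escape f g M.
Let H' := escape_sym H.

(* The images of a small ball around [y] under the iterates of [g] contain balls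
   of a fixed radius; these accumulate somewhere, and points lying in infinitely many
   of them return infinitely often to the ball around [y] under [f]. *)
Lemma interior_Kp_sub : expands_volume g -> (Kp g)° `<=` (Kp f)°.
Proof.
move=> vol y Ky; have [r [B [r0 B0 hB]]] := interior_Kp_bound H' Ky.
have hM k z : nr (z - y) <= r -> nr (iter k g z) <= B by move=> /(hB k z)[].
have gp k := iter_curve_poly H' k.
have gd k := iter_differentiable H' k.
have [D D0 hD] := @inverse_bound R n (B / r).
have low k v : nr v <= D * nr ('d (iter k g) y v).
  have [A [dA detA]] := vol k y; rewrite dA; apply: hD => // i j.
  have := diff_bound (gp k) (gd k) (delta_mx 0 i) r0 (hM k); rewrite dA -rowE.
  have := nr_coord (row i A) j; rewrite mxE => h1 h2; apply: le_trans h1 _.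
  apply: le_trans h2 _; rewrite ler_piMr ?divr_ge0 ?(ltW r0) ?(ltW B0) //.
  by apply/nr_le => // l; rewrite mxE; case: (_ && _); rewrite ?cmod1 ?cmod0.
(* On the sphere of radius d the quadratic remainder 2B (d / r)^2 is at most rho = d / (2D), half of
   the lower bound d / D for the linear part. *)
pose d := Num.min (r / 2) (r ^+ 2 / (4 * B * D)).
have d0 : 0 < d by rewrite lt_min !divr_gt0 ?mulr_gt0 ?exprn_gt0.
have dr : d <= r / 2 by rewrite /d ge_min lexx.
have dBD : 4 * B * D * d <= r ^+ 2.
  by rewrite mulrC -ler_pdivlMr ?mulr_gt0 // /d ge_min lexx orbT.
pose rho := d / (2 * D).
have rho0 : 0 < rho by rewrite divr_gt0 // mulr_gt0.
have sphere k v : nr v = d -> rho <= nr (iter k g (y + v) - iter k g y).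
  move=> vd; have vr : nr v <= r / 2 by rewrite vd.
  have h1 := diff_remainder (gp k) (gd k) r0 (hM k) vr.
  have h2 := low k v; rewrite vd in h1 h2.
  have h3 : 2 * B * (d / r) ^+ 2 <= rho.
    have -> : 2 * B * (d / r) ^+ 2 = (4 * B * D * d) / r ^+ 2 * rho.
      by rewrite /rho; field; rewrite !gt_eqF.
    by rewrite ler_piMl ?(ltW rho0) // ler_pdivrMr ?exprn_gt0 // mul1r.
  have h4 : 2 * rho <= nr ('d (iter k g) y v).
    have -> : 2 * rho = d / D by rewrite /rho; field; rewrite gt_eqF.
    by rewrite ler_pdivrMr // mulrC.
  move: h1 h4; set X := _ - iter k g y; set L := 'd _ y v => h1 h4.
  have := nrD X (L - X); rewrite addrC subrK [nr (L - X)]nrB => h5.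
  by clear -h1 h3 h4 h5; lra.
(* Pull the segment from g^k(y) to p back by f^k. If it ended outside the d-ball around y, it would
   meet the sphere, at a point which g^k sends at least rho away from g^k(y), beyond the segment. *)
have cover k p : nr (p - iter k g y) < rho -> nr (iter k f p - y) < d.
  move=> pr; rewrite ltNge; apply/negP => dp.
  pose c s := iter k f (iter k g y + ofR s *: (p - iter k g y)).
  have cc : {within `[0, 1], continuous (fun s => nr (c s - y))}.
    apply: continuous_subspaceT => s.
    apply: cvg_nr; apply: cvgB; last exact: cvg_cst.
    apply: (@cvg_cont _ _ _ _ _ (iter k f)).
      by apply: continuous_iter; exact: es_fc H.
    apply/cvg_nrP => e e0; apply/nbhs_ballP.
    pose N := 1 + nr (p - iter k g y).
    have N0 : 0 < N by rewrite ltr_pwDl ?nr_ge0.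
    exists (e / N) => [|t]; first by rewrite /= divr_gt0.
    rewrite /ball /= ltr_pdivlMr // => st.
    rewrite opprD addrACA subrr add0r -scalerBl nrZ.
    have -> : ofR t - ofR s = ofR (t - s).
      by rewrite ofRD; congr (_ + _); apply/eqP; rewrite eq_complex /= oppr0 !eqxx.
    rewrite cmod_ofR distrC; apply: le_lt_trans st; rewrite ler_wpM2l //.
    by rewrite /N lerDr.
  have c0 : c 0 = y.
    by rewrite /c (_ : ofR 0 = 0) // scale0r addr0 iter_cancel //; exact: es_gK H.
  have c1 : c 1 = iter k f p.
    by rewrite /c (_ : ofR 1 = 1) // scale1r [_ + (_ - _)]addrC subrK.
  have [||s /andP[s0 s1] sd] := segment_IVT (d := d) cc.
  - by rewrite c0 subrr nr0 ltW.
  - by rewrite c1.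
  have := sphere k _ sd; rewrite [y + _]addrC subrK iter_cancel; last exact: es_fK H.
  rewrite [_ + ofR s *: _]addrC addrK nrZ cmod_ofR ger0_norm //.
  apply/negP; rewrite -ltNge; apply: le_lt_trans pr.
  by rewrite ler_piMl ?nr_ge0.
have [F [FU FF]] := free_ultrafilter.
have [p hp] : exists p : V, (fun k => iter k g y) @ F --> p.
  apply: (@ultra_cvg _ _ F FU _ B); apply: FF; exists 0%N => k _.
  by apply: hM; rewrite subrr nr0 ltW.
have rho2 : 0 < rho / 2 by rewrite divr_gt0.
have near_p : \forall k \near F, nr (iter k g y - p) < rho / 2 by move/cvg_nrP: hp; apply.
have Kball q : nr (q - p) < rho / 2 -> Kp f q.
  move=> qp; apply: (recurrent_bounded H (B := d + nr y)) => m.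
  have Fm : F [set k | (m <= k)%N] by apply: FF; exists m.
  have [k [mk kp]] := filter_ex (filterI Fm near_p).
  exists k => //.
  have qk : nr (q - iter k g y) < rho.
    by have := nr_dist q (iter k g y) p; rewrite [nr (p - _)]nrB; move: kp => /=; lra.
  by have := nrD (iter k f q - y) y; rewrite subrK; have := cover k q qk; lra.
(* Some g^k(y) lies in the ball around p contained in K+; continuity of g^k and invariance of K+
   bring this back to y. *)
have [k kp] := filter_ex near_p; apply/interior_nrP.
have k0 : 0 < rho / 2 - nr (iter k g y - p) by move: kp => /=; lra.
have [e e0 he] := near_image y (@continuous_iter _ _ g k (es_gc H)) k0.
exists e => // q qe; apply: (@Kp_iter_back _ _ f 0) => /=.
rewrite -(iter_cancel k (es_gK H) q); apply: Kp_iter; apply: Kball.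
by have := nr_dist (iter k g q) p (iter k g y); have := he q qe; lra.
Qed.

End VolumeInclusion.

(** * Hyperbolic splittings *)

Section IteratedDifferential.
Variables (R : realType) (n : nat).
Local Notation C := (Cplx R).
Local Notation V := 'rV[C]_n.
Implicit Types (f g : V -> V).

(* Locked: unification attempts to unfold ['d]. *)
Definition dit : (V -> V) -> nat -> V -> V -> V :=
  locked (fun f k z v => 'd (iter k f) z v).

Lemma ditE f k z v : dit f k z v = 'd (iter k f) z v.
Proof. by rewrite /dit -lock. Qed.

Lemma dit0 f z v : dit f 0 z v = v.
Proof. by rewrite ditE; exact: diff_iter0. Qed.

Lemma dit1 f z v : dit f 1 z v = 'd f z v.
Proof. exact: ditE. Qed.

Lemma ditvD f k z v w : dit f k z (v + w) = dit f k z v + dit f k z w.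
Proof. by rewrite !ditE; exact: linearD. Qed.

Lemma ditvZ f k z a v : dit f k z (a *: v) = a *: dit f k z v.
Proof. by rewrite !ditE; exact: linearZ. Qed.

Lemma ditv0 f k z : dit f k z 0 = 0.
Proof. by rewrite ditE; exact: linear0. Qed.

Variables (f g : V -> V) (M : R).
Hypothesis H : escape f g M.

Lemma ditD k l z v : dit f (k + l) z v = dit f k (iter l f z) (dit f l z v).
Proof. by rewrite !ditE; exact: diff_iterD (es_fd H). Qed.

Lemma ditS k z v : dit f k.+1 z v = dit f 1 (iter k f z) (dit f k z v).
Proof. exact: (ditD 1 k z v). Qed.

Lemma dit_cancel k z v : dit f k (iter k g z) (dit g k z v) = v.
Proof.
have E : iter k f \o iter k g = id.
  by apply/funext => x /=; rewrite iter_cancel //; exact: es_gK H.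
have := diff_comp (differentiable_iter k (es_gd H) z)
  (differentiable_iter k (es_fd H) (iter k g z)).
rewrite E => /(congr1 (fun h => h v)) /= h; rewrite !ditE.
by apply: etrans (esym h) _; rewrite diff_val.
Qed.

Lemma cvg_dit k (F : set_system nat) {FF : Filter F} (u v : nat -> V) (a b : V) :
  u @ F --> a -> v @ F --> b -> (fun j => dit f k (u j) (v j)) @ F --> dit f k a b.
Proof.
move=> ua vb; elim: k => [|k IH].
  by under eq_fun do rewrite dit0; rewrite dit0.
under eq_fun do rewrite ditS dit1.
rewrite ditS dit1; apply: (@es_fD _ _ _ _ _ H F FF) IH.
exact: (cvg_iter (es_fc H) ua).
Qed.

End IteratedDifferential.

Section Hyperbolicity.
Variables (R : realType) (n : nat).
Local Notation C := (Cplx R).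
Local Notation V := 'rV[C]_n.

Definition hyperbolic_data (f : V -> V) (L : set V) (Eu Es : V -> set V) : Prop :=
  [/\ subbundle L Eu, subbundle L Es & splitting L Eu Es] /\
  [/\ invariant_bundle f L Eu, invariant_bundle f L Es,
      expanding f L Eu & contracting f L Es].

Lemma small_power (x e : R) : 0 < x < 1 -> 0 < e ->
  exists k0, forall k, (k0 <= k)%N -> x ^+ k < e.
Proof.
move=> /andP[x0 x1] e0; have x1' : `|x| < 1 by rewrite gtr0_norm.
have /cvgrPdist_lt/(_ e e0)[k0 _ hk] := cvg_expr x1'.
exists k0 => k kk; have := hk k kk; rewrite /= sub0r normrN ger0_norm //.
by rewrite exprn_ge0 // ltW.
Qed.

Lemma large_power (c mu a : R) : 0 < c -> 1 < mu ->
  exists k0, forall k, (k0 <= k)%N -> a < c * mu ^+ k.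
Proof.
move=> c0 mu1; have mu0 : 0 < mu by apply: lt_trans mu1.
have e0 : 0 < c / (`|a| + 1) by rewrite divr_gt0 // ltr_wpDl.
have [|k0 hk] := @small_power mu^-1 _ _ e0.
  by rewrite invr_gt0 mu0 invf_lt1.
exists k0 => k /hk; rewrite exprVn ltr_pdivlMr ?ltr_wpDl // mulrC.
rewrite ltr_pdivrMr ?exprn_gt0 //; apply: le_lt_trans.
by apply: le_trans (ler_norm a) _; rewrite lerDl.
Qed.

Lemma subbundle_lin (L : set V) E p (a b : R) v w : subbundle L E -> L p ->
  E p v -> E p w -> E p (ofR a *: v + ofR b *: w).
Proof.
move=> sub Lp; have [U [Up [k [e [_ he]]]]] := sub p Lp.
have [_ ->] := he p (conj Lp (nbhs_singleton Up)).
move=> [x _ <-] [y _ <-]; exists (a *: x + b *: y) => //.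
rewrite !scaler_sumr -big_split /=; apply: eq_bigr => i _.
by rewrite !mxE ofRD !ofRM scalerDl !scalerA.
Qed.

Lemma subbundle_scale (L : set V) E p (a : R) v : subbundle L E -> L p ->
  E p v -> E p (ofR a *: v).
Proof.
move=> sub Lp Ev; have := subbundle_lin a 0 sub Lp Ev Ev.
by rewrite (_ : ofR 0 = 0) // scale0r addr0.
Qed.

Lemma subbundle_sub (L : set V) E p v w : subbundle L E -> L p ->
  E p v -> E p w -> E p (v - w).
Proof.
move=> sub Lp Ev Ew; have := subbundle_lin 1 (-1) sub Lp Ev Ew.
rewrite (_ : ofR 1 = 1) // (_ : ofR (-1) = -1) ?scale1r ?scaleN1r //.
by apply/eqP; rewrite eq_complex /= oppr0 !eqxx.
Qed.

Lemma splitting_uniq (L : set V) Eu Es p u s u' s' :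
  subbundle L Eu -> subbundle L Es -> splitting L Eu Es -> L p ->
  Eu p u -> Es p s -> Eu p u' -> Es p s' -> u + s = u' + s' -> u = u' /\ s = s'.
Proof.
move=> su ss spl Lp hu hs hu' hs' E.
have E2 : u - u' = s' - s.
  by apply/eqP; rewrite subr_eq addrAC -[_ == _]subr_eq opprK E addrC.
have [I _] := spl p Lp.
have : (Eu p `&` Es p) (u - u').
  split; first exact: (subbundle_sub su Lp).
  by rewrite E2; exact: (subbundle_sub ss Lp).
rewrite I /= => uu'; split; first exact: subr0_eq.
by apply/esym/subr0_eq; rewrite -E2.
Qed.

Lemma splitting_dec (L : set V) Eu Es p v : splitting L Eu Es -> L p ->
  exists u s, [/\ Eu p u, Es p s & v = u + s].
Proof.
move=> spl Lp; have [_ T] := spl p Lp; have : [set: V] v by [].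
by rewrite -T => -[u hu [s hs <-]]; exists u, s.
Qed.

Lemma expandingP (f : V -> V) L E : expanding f L E <-> exists c mu : R,
  [/\ 0 < c, 1 < mu & forall k p v, L p -> E p v ->
    c * mu ^+ k * nr v <= nr (dit f k p v)].
Proof.
split=> -[c [mu]]; [case=> c0 [mu1 h]|case=> c0 mu1 h]; exists c, mu.
  by split => // k p v Lp Ev; rewrite ditE -ler_ofR ofRM -!nrE; exact: h.
by split => //; split => // k p v Lp Ev; rewrite !nrE -ofRM ler_ofR -ditE; exact: h.
Qed.

Lemma contractingP (f : V -> V) L E : contracting f L E <-> exists c mu : R,
  [/\ 0 < c, 0 < mu < 1 & forall k p v, L p -> E p v ->
    nr (dit f k p v) <= c * mu ^+ k * nr v].
Proof.
split=> -[c [mu]]; [case=> c0 [mu1 h]|case=> c0 mu1 h]; exists c, mu.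
  by split => // k p v Lp Ev; rewrite ditE -ler_ofR ofRM -!nrE; exact: h.
by split => //; split => // k p v Lp Ev; rewrite !nrE -ofRM ler_ofR -ditE; exact: h.
Qed.

Lemma invariant_iter (f g : V -> V) M (H : escape f g M) (L : set V) E k p v :
  f @` L = L -> invariant_bundle f L E -> L p -> E p v ->
  L (iter k f p) /\ E (iter k f p) (dit f k p v).
Proof.
move=> fL inv Lp Ev; elim: k => [|k [IH1 IH2]]; first by rewrite dit0.
rewrite (ditS H) iterS dit1; split; first by rewrite -fL; exists (iter k f p).
by rewrite -inv //; exists (dit f k p v).
Qed.

Lemma invariant_inv (f g : V -> V) M (H : escape f g M) (L : set V) E :
  f @` L = L -> invariant_bundle f L E -> g @` L = L /\ invariant_bundle g L E.
Proof.
move=> fL inv.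
have Lg p : L p -> L (g p).
  by rewrite -{1}fL => -[q Lq <-]; rewrite (es_fK H).
have Lf p : L p -> L (f p) by move=> Lp; rewrite -fL; exists p.
split.
  apply/seteqP; split => [_ [p Lp <-]|p Lp]; first exact: Lg.
  by exists (f p); [exact: Lf|rewrite (es_fK H)].
move=> p Lp; have := inv (g p) (Lg p Lp); rewrite (es_gK H) => <-.
have K v : dit g 1 p (dit f 1 (g p) v) = v.
  have := dit_cancel (escape_sym H) 1 (g p) v.
  by rewrite (_ : iter 1 f (g p) = p) //; exact: es_gK H _.
apply/seteqP; split => [_ [_ [v Ev <-] <-]|v Ev].
  by rewrite -!dit1 K.
by exists (dit f 1 (g p) v); [exists v => //; rewrite dit1|rewrite -dit1 K].
Qed.

Lemma hyperbolic_data_inv (f g : V -> V) M (H : escape f g M) L Eu Es :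
  f @` L = L -> hyperbolic_data f L Eu Es -> hyperbolic_data g L Es Eu.
Proof.
move=> fL [[su ss spl] [iu is_ /expandingP[c [mu [c0 mu1 hu]]]
  /contractingP[c' [mu' [c'0 /andP[mu'0 mu'1] hs]]]]].
have [gL igu] := invariant_inv H fL iu; have [_ igs] := invariant_inv H fL is_.
split; first split => // p Lp.
  have [I T] := spl p Lp; rewrite setIC; split => //.
  rewrite -T; apply/seteqP; split => _ [a ha [b hb <-]]; exists b => //; exists a => //;
    by rewrite addrC.
split => //.
  apply/expandingP; exists c'^-1, mu'^-1; split; rewrite ?invr_gt0 ?invf_gt1 // => k p v Lp Ev.
  have [Lk Ek] := invariant_iter (escape_sym H) k gL igs Lp Ev.
  have := hs k _ _ Lk Ek; rewrite (dit_cancel H) exprVn -invfM.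
  by rewrite ler_pdivrMl // mulr_gt0 ?exprn_gt0.
apply/contractingP; exists c^-1, mu^-1; split; rewrite ?invr_gt0 //.
  have mu0 : 0 < mu by apply: lt_trans mu1.
  by rewrite mu0 invf_lt1.
move=> k p v Lp Ev.
have [Lk Ek] := invariant_iter (escape_sym H) k gL igu Lp Ev.
have := hu k _ _ Lk Ek; rewrite (dit_cancel H) exprVn -invfM.
have cm : 0 < c * mu ^+ k by rewrite mulr_gt0 // exprn_gt0 // (lt_trans _ mu1).
by rewrite ler_pdivlMl.
Qed.

End Hyperbolicity.

(** * Closedness of the stable bundle under limits *)

Section ConeField.
Variables (R : realType) (n : nat).
Local Notation C := (Cplx R).
Local Notation V := 'rV[C]_n.
Variable F : set_system nat.
Hypotheses (FU : UltraFilter F)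
  (FF : forall P : set nat, (exists m, forall j, (m <= j)%N -> P j) -> F P).

Lemma cvg_nr_leM (u v : nat -> V) (a b : V) (K : R) : u @ F --> a -> v @ F --> b ->
  (\forall j \near F, nr (u j) <= K * nr (v j)) -> nr a <= K * nr b.
Proof.
move=> /cvg_nr ua /cvg_nr vb uv.
exact: (ler_cvg_to ua (cvgM (cvg_cst K) vb) uv).
Qed.

Lemma cvg_nr_leC (u : nat -> V) (a : V) (B : R) : u @ F --> a ->
  (\forall j \near F, nr (u j) <= B) -> nr a <= B.
Proof.
move=> ua uB; rewrite leNgt; apply/negP => Ba.
have N : \forall j \near F, B < nr (u j) by exact: near_nr_gt ua Ba.
by have [j [/= h1 h2]] := filter_ex (filterI uB N); move: h1; rewrite leNgt h2.
Qed.

Lemma cvg_nr_geC (u : nat -> V) (a : V) (B : R) : u @ F --> a ->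
  (\forall j \near F, B <= nr (u j)) -> B <= nr a.
Proof.
move=> ua uB; rewrite leNgt; apply/negP => Ba.
have := ua; move/cvg_nr/cvgrPdist_lt/(_ (B - nr a)); rewrite subr_gt0 => /(_ Ba) N.
have [j [/= h1]] := filter_ex (filterI uB N).
by rewrite ltr_norml => /andP[h2 h3]; lra.
Qed.

Lemma cvg_closed (A : set V) (u : nat -> V) (a : V) : closed A -> u @ F --> a ->
  (\forall j \near F, A (u j)) -> A a.
Proof. by move=> Ac ua uA; apply: (closed_cvg A Ac uA). Qed.

Lemma inv_cvg0 (e : R) : 0 < e -> F [set j : nat | j.+1%:R^-1 < e].
Proof.
move=> e0; apply: FF; exists (Num.bound e^-1) => j bj /=.
rewrite invf_plt ?posrE //; apply: (@lt_le_trans _ _ (Num.bound e^-1)%:R).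
  by apply: archi_boundP; rewrite invr_ge0 ltW.
by rewrite ler_nat leqW.
Qed.

Lemma cvg_near_seq (u v : nat -> V) (a : V) : u @ F --> a ->
  (forall j, nr (v j - u j) <= j.+1%:R^-1) -> v @ F --> a.
Proof.
move=> /cvg_nrP ua vu; apply/cvg_nrP => e e0; have e2 : 0 < e / 2 by lra.
apply: filterS2 (ua _ e2) (inv_cvg0 e2) => j /= h1 h2.
have h3 := le_lt_trans (vu j) h2.
by have h4 := nr_dist (v j) a (u j); clear -h1 h3 h4; lra.
Qed.

Lemma compact_nr_bound (L : set V) : compact L -> exists B, forall p, L p -> nr p <= B.
Proof.
move=> cL; have [[x Lx]|L0] := pselect (L !=set0); last first.
  by exists 0 => p Lp; case: L0; exists p.
have [|y _ hy] := @compact_EVT_max V R (@nr R n) L (ex_intro _ x Lx) cL.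
  apply: continuous_subspaceT => z.
  by apply: (@cvg_nr _ _ _ (nbhs z) _ id z); exact: cvg_id.
by exists (nr y) => p Lp; apply: hy; rewrite inE.
Qed.

Lemma continuous_ball_bound (h : V -> V) (r : R) : continuous h ->
  exists B : R, forall z, nr z <= r -> nr (h z) <= B.
Proof.
move=> hc; have cB := @closed_ball_compact R n r.
have /compact_nr_bound[B hB] : compact (h @` [set v | nr v <= r]).
  by apply: continuous_compact => //; exact: continuous_subspaceT.
by exists B => z zr; apply: hB; exists z.
Qed.

Variables (f g : V -> V) (M : R).
Hypothesis H : escape f g M.
Variables (L : set V) (Eu Es : V -> set V).
Hypotheses (cL : compact L) (fL : f @` L = L) (hyp : hyperbolic_data f L Eu Es).

Let clL : closed L := compact_closed (@norm_hausdorff _ _) cL.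

(** The limit vector inherits bounded forward images from the uniform contraction estimate. Its
    stable component has bounded images too, hence so has its unstable component, which expansion
    then forces to be 0. *)
Lemma stable_closed (p v : nat -> V) (a b : V) : p @ F --> a -> v @ F --> b ->
  (forall j, L (p j)) -> (forall j, Es (p j) (v j)) -> Es a b.
Proof.
move=> pa vb Lp Ev; have La : L a by apply: (cvg_closed clL pa); exact: filterS filterT.
have [[su ss spl] [iu is_ /expandingP[c [mu [c0 mu1 hu]]]
  /contractingP[c' [mu' [c'0 /andP[mu'0 mu'1] hs]]]]] := hyp.
have [u [s [Eu_u Es_s bE]]] := splitting_dec b spl La.
have bk k : nr (dit f k a b) <= c' * nr b.
  have h : nr (dit f k a b) <= c' * mu' ^+ k * nr b.
    have hF : \forall j \near F, nr (dit f k (p j) (v j)) <= c' * mu' ^+ k * nr (v j).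
      by apply: filterS filterT => j _; exact: hs.
    exact: (cvg_nr_leM (cvg_dit H pa vb) vb hF).
  apply: le_trans h _; rewrite ler_wpM2r ?nr_ge0 // ler_piMr ?(ltW c'0) //.
  by rewrite exprn_ile1 ?(ltW mu'0) ?(ltW mu'1).
have uk k : c * mu ^+ k * nr u <= c' * nr b + c' * nr s.
  apply: le_trans (hu k a u La Eu_u) _.
  have -> : dit f k a u = dit f k a b - dit f k a s by rewrite bE ditvD addrK.
  apply: le_trans (nrD _ _) _; rewrite nrN lerD //.
  apply: le_trans (hs k a s La Es_s) _.
  rewrite ler_wpM2r ?nr_ge0 // ler_piMr ?(ltW c'0) //.
  by rewrite exprn_ile1 ?(ltW mu'0) ?(ltW mu'1).
have [u0|u0] := pselect (u = 0); first by rewrite bE u0 add0r.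
have up := nr_gt0 u0.
have [k0 hk] := large_power ((c' * nr b + c' * nr s) / nr u) c0 mu1.
by have := hk k0 (leqnn _); rewrite ltr_pdivrMr // ltNge uk.
Qed.

End ConeField.

(** * Unstable cones near a hyperbolic set *)

Section ConeStep.
Variables (R : realType) (n : nat).
Local Notation C := (Cplx R).
Local Notation V := 'rV[C]_n.
Variable F : set_system nat.
Hypotheses (FU : UltraFilter F)
  (FF : forall P : set nat, (exists m, forall j, (m <= j)%N -> P j) -> F P).
Variables (f g : V -> V) (M : R).
Hypothesis H : escape f g M.
Variables (L : set V) (Eu Es : V -> set V).
Hypotheses (cL : compact L) (fL : f @` L = L) (hyp : hyperbolic_data f L Eu Es).

Let clL : closed L := compact_closed (@norm_hausdorff _ _) cL.
Let su : subbundle L Eu. Proof. by case: hyp => -[]. Qed.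
Let ss : subbundle L Es. Proof. by case: hyp => -[]. Qed.
Let spl : splitting L Eu Es. Proof. by case: hyp => -[]. Qed.

Lemma unstable_closed (p v : nat -> V) (a b : V) : p @ F --> a -> v @ F --> b ->
  (forall j, L (p j)) -> (forall j, Eu (p j) (v j)) -> Eu a b.
Proof.
have [gL _] : g @` L = L /\ invariant_bundle g L Eu.
  by apply: (invariant_inv H fL); case: hyp => _ [].
exact: (stable_closed FU (escape_sym H) cL (hyperbolic_data_inv H fL hyp)).
Qed.

Lemma seq_limit (u : nat -> V) (B : R) : (forall j, nr (u j) <= B) ->
  exists l : V, u @ F --> l.
Proof. by move=> uB; apply: (@ultra_cvg _ _ F FU u B); apply: filterS filterT. Qed.

Lemma seq_limit_in (u : nat -> V) : (forall j, L (u j)) ->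
  exists2 l : V, L l & u @ F --> l.
Proof.
move=> uL; have [B hB] := compact_nr_bound cL.
have [|l ul] := @seq_limit u B; first by move=> j; exact: hB.
by exists l => //; apply: (cvg_closed FU clL ul); exact: filterS filterT.
Qed.

(** Otherwise, after normalization, the vectors u_j and -s_j would have a common limit of norm 1,
    lying in both bundles. *)
Lemma projection_bound : exists2 K : R, 0 < K &
  forall p u s, L p -> Eu p u -> Es p s -> nr u <= K * nr (u + s).
Proof.
apply: contrapT => nK.
have bad (j : nat) : exists t : V * V * V, [/\ L t.1.1, Eu t.1.1 t.1.2, Es t.1.1 t.2 &
    j.+1%:R * nr (t.1.2 + t.2) < nr t.1.2].
  apply: contrapT => h; apply: nK; exists j.+1%:R => // p u s Lp hu hs.
  by rewrite leNgt; apply/negP => lt; apply: h; exists (p, u, s).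
have [t ht] := choice bad.
pose p j := (t j).1.1; pose N j := (nr (t j).1.2)^-1.
have Np j : 0 < nr (t j).1.2.
  by have [_ _ _ h] := ht j; apply: le_lt_trans h; rewrite mulr_ge0 ?nr_ge0.
pose u j := (ofR (N j) : C) *: (t j).1.2; pose s j := (ofR (N j) : C) *: (t j).2.
have u1 j : nr (u j) = 1.
  by rewrite nrZ cmod_ofR gtr0_norm ?invr_gt0 // mulVf // gt_eqF.
have Lp j : L (p j) by case: (ht j).
have [a La pa] := seq_limit_in Lp.
have [|b ub] := @seq_limit u 1; first by move=> j; rewrite u1.
have sb : (fun j => - s j) @ F --> b.
  apply: (cvg_near_seq FU FF ub) => j.
  rewrite -opprD nrN addrC -scalerDr nrZ cmod_ofR gtr0_norm ?invr_gt0 //.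
  have [_ _ _ h] := ht j.
  by rewrite ler_pdivrMl // ler_pdivlMr // mulrC ltW.
have Eub : Eu a b.
  by apply: (unstable_closed pa ub) => // j; apply: subbundle_scale su _ _; case: (ht j).
have Esb : Es a b.
  apply: (stable_closed FU H cL hyp pa sb) => // j.
  have -> : - s j = (ofR (- N j) : C) *: (t j).2.
    rewrite /s -scaleNr; congr (_ *: _); apply/eqP.
    by rewrite eq_complex /= oppr0 !eqxx.
  by apply: subbundle_scale ss _ _; case: (ht j).
have [I _] := spl La; have : (Eu a `&` Es a) b by [].
rewrite I /= => b0.
have : 1 <= nr b by apply: (cvg_nr_geC FU ub); apply: filterS filterT => j _; rewrite u1.
by rewrite b0 nr0 ler10.
Qed.

(** If |u| = 1 and |s| <= 1, the factors 5 and 1/4 give an image of norm at least 19/4, strictly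
    above 2 |u + s| <= 4; the slack absorbs the passage to nearby base points in [cone_step]. *)
Lemma cone_constants : exists k : nat, [/\ (0 < k)%N,
  (forall p v, L p -> Eu p v -> 5 * nr v <= nr (dit f k p v)) &
  (forall p v, L p -> Es p v -> 4 * nr (dit f k p v) <= nr v)].
Proof.
have [_ [_ _ /expandingP[c [mu [c0 mu1 hu]]] /contractingP[c' [mu' [c'0 mu'01 hs]]]]] := hyp.
have [k1 h1] := large_power 5 c0 mu1.
have e0 : 0 < (4 * c')^-1 by rewrite invr_gt0 mulr_gt0.
have [k2 h2] := small_power mu'01 e0.
exists (maxn 1 (maxn k1 k2)); set k := maxn _ _.
have kk1 : (k1 <= k)%N by rewrite /k !leq_max leqnn orbT.
have kk2 : (k2 <= k)%N by rewrite /k !leq_max leqnn !orbT.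
split; first by rewrite /k leq_max.
  move=> p v Lp Ev; apply: le_trans (hu k p v Lp Ev).
  by rewrite ler_wpM2r ?nr_ge0 // ltW // h1.
move=> p v Lp Ev; have h := hs k p v Lp Ev.
have := ltW (h2 k kk2); rewrite -[leRHS]div1r ler_pdivlMr ?mulr_gt0 // => h3.
have : 4 * (c' * mu' ^+ k * nr v) <= nr v.
  by rewrite !mulrA -[leRHS]mul1r ler_wpM2r ?nr_ge0 //; apply: le_trans h3; rewrite mulrC.
apply: le_trans; by rewrite ler_pM2l.
Qed.

Variable k : nat.
Hypotheses (ku : forall p v, L p -> Eu p v -> 5 * nr v <= nr (dit f k p v))
  (ks : forall p v, L p -> Es p v -> 4 * nr (dit f k p v) <= nr v).

(* Invariance and expansion of the cone field persist, by compactness, when base points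
   in [L] are replaced by points close to [L]. *)
Lemma cone_step : exists2 r : R, 0 < r & forall q p p' u s u' s',
  L p -> L p' -> nr (q - p) <= r -> nr (iter k f q - p') <= r ->
  Eu p u -> Es p s -> nr s <= nr u -> Eu p' u' -> Es p' s' ->
  dit f k q (u + s) = u' + s' ->
  nr s' <= nr u' /\ 2 * nr (u + s) <= nr (u' + s').
Proof.
apply: contrapT => nr_.
have bad (j : nat) : exists t : V * (V * V) * (V * V) * (V * V),
  let: (q, (p, p'), (u, s), (u', s')) := t in
  [/\ L p /\ L p', nr (q - p) <= j.+1%:R^-1 /\ nr (iter k f q - p') <= j.+1%:R^-1,
     [/\ Eu p u, Es p s, nr s <= nr u, Eu p' u' & Es p' s'],
     dit f k q (u + s) = u' + s' & ~ (nr s' <= nr u' /\ 2 * nr (u + s) <= nr (u' + s'))].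
  apply: contrapT => h; apply: nr_; exists j.+1%:R^-1; first by rewrite invr_gt0.
  move=> q p p' u s u' s' Lp Lp' qp qp' hu hs su_ hu' hs' E.
  by apply: contrapT => C_; apply: h; exists (q, (p, p'), (u, s), (u', s')).
have {}bad (j : nat) : exists t : V * (V * V) * (V * V) * (V * V),
  let: (q, (p, p'), (u, s), (u', s')) := t in
  [/\ L p /\ L p', nr (q - p) <= j.+1%:R^-1 /\ nr (iter k f q - p') <= j.+1%:R^-1,
     [/\ Eu p u, Es p s, nr s <= 1, Eu p' u' & Es p' s'],
     nr u = 1 /\ dit f k q (u + s) = u' + s' &
     ~ (nr s' <= nr u' /\ 2 * nr (u + s) <= nr (u' + s'))].
  have [[[[q [p p']] [u s]] [u' s']] [[Lp Lp'] [qp qp'] [hu hs su_ hu' hs'] E bd]] := bad j.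
  (* If u = 0, the whole vector and its image vanish and the conclusion holds; so u may be scaled to
     norm 1. *)
  have u0 : u <> 0.
    move=> u0; have s0 : s = 0 by
      apply: nr_eq0; apply/eqP; rewrite eq_le nr_ge0 andbT (le_trans su_) // u0 nr0.
    have [h1 h2] : u' = 0 /\ s' = 0.
      have z1 : Eu p' 0 by have := subbundle_sub su Lp' hu' hu'; rewrite subrr.
      have z2 : Es p' 0 by have := subbundle_sub ss Lp' hs' hs'; rewrite subrr.
      apply: (splitting_uniq su ss spl Lp') => //.
      by rewrite -E u0 s0 !addr0 ditv0.
    by apply: bd; rewrite h1 h2 u0 s0 addr0 nr0 mulr0.
  have up := nr_gt0 u0; pose N : C := ofR (nr u)^-1.
  have Nn (v : V) : nr (N *: v) = (nr u)^-1 * nr v by rewrite nrZ cmod_ofR gtr0_norm // invr_gt0.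
  exists (q, (p, p'), (N *: u, N *: s), (N *: u', N *: s')); split => //.
  - split; try exact: (subbundle_scale _ su); try exact: (subbundle_scale _ ss).
    by rewrite Nn ler_pdivrMl // mulr1.
  - split; first by rewrite Nn mulVf // gt_eqF.
    by rewrite -!scalerDr ditvZ E.
  - by rewrite -!scalerDr !Nn mulrCA !ler_pM2l ?invr_gt0.
have [t ht] := choice bad.
pose q j := (t j).1.1.1; pose p j := (t j).1.1.2.1; pose p' j := (t j).1.1.2.2.
pose u j := (t j).1.2.1; pose s j := (t j).1.2.2.
pose u' j := (t j).2.1; pose s' j := (t j).2.2.
have {}ht j : [/\ L (p j) /\ L (p' j),
     nr (q j - p j) <= j.+1%:R^-1 /\ nr (iter k f (q j) - p' j) <= j.+1%:R^-1,
     [/\ Eu (p j) (u j), Es (p j) (s j), nr (s j) <= 1, Eu (p' j) (u' j) & Es (p' j) (s' j)],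
     nr (u j) = 1 /\ dit f k (q j) (u j + s j) = u' j + s' j &
     ~ (nr (s' j) <= nr (u' j) /\ 2 * nr (u j + s j) <= nr (u' j + s' j))].
  have := ht j; rewrite /q /p /p' /u /s /u' /s'.
  by case: (t j) => -[[q_ [p_ p'_]] [u_ s_]] [u'_ s'_].
have Lp j : L (p j) by case: (ht j) => -[].
have Lp' j : L (p' j) by case: (ht j) => -[].
have [a La pa] := seq_limit_in Lp.
have [|x ux] := @seq_limit u 1; first by move=> j; case: (ht j) => _ _ _ [-> _].
have [|y sy] := @seq_limit s 1; first by move=> j; case: (ht j) => _ _ [].
have qa : q @ F --> a by apply: (cvg_near_seq FU FF pa) => j; case: (ht j) => _ [].
have p'a : p' @ F --> iter k f a.
  apply: (cvg_near_seq FU FF (cvg_iter (es_fc H) qa)) => j.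
  by rewrite nrB; case: (ht j) => _ [].
have vxy : (fun j => u j + s j) @ F --> x + y by exact: (cvgD ux sy).
have dxy : (fun j => dit f k (q j) (u j + s j)) @ F --> dit f k a (x + y).
  exact: (cvg_dit H qa vxy).
have [K K0 hK] := projection_bound.
(* The image vectors converge, and the bounded projection keeps their unstable components bounded,
   so these have a limit too. *)
have wB : \forall j \near F, nr (u' j) <= K * (1 + nr (dit f k a (x + y))).
  move/cvg_nrP: (dxy) => /(_ 1 ltr01).
  apply: filterS => j hj; have [_ _ [_ _ _ hu' hs'] [_ E] _] := ht j.
  apply: le_trans (hK _ _ _ (Lp' j) hu' hs') _; rewrite -E ler_pM2l //.
  have := nrD (dit f k (q j) (u j + s j) - dit f k a (x + y)) (dit f k a (x + y)).
  by rewrite subrK => h; apply: le_trans h _; rewrite lerD2r ltW.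
have [x' u'x] := ultra_cvg FU wB.
have s'y : s' @ F --> dit f k a (x + y) - x'.
  rewrite (_ : s' = (fun j => dit f k (q j) (u j + s j) - u' j)).
    exact: (cvgB dxy u'x).
  by apply/funext => j; have [_ _ _ [_ ->] _] := ht j; rewrite addrC addKr.
set y' := _ - x' in s'y.
have Ex : Eu a x by apply: (unstable_closed pa ux) => // j; case: (ht j) => _ _ [].
have Ey : Es a y by apply: (stable_closed FU H cL hyp pa sy) => // j; case: (ht j) => _ _ [].
have La' : L (iter k f a) by apply: (cvg_closed FU clL p'a); apply: filterS filterT.
have Ex' : Eu (iter k f a) x'.
  by apply: (unstable_closed p'a u'x) => // j; case: (ht j) => _ _ [].
have Ey' : Es (iter k f a) y'.
  by apply: (stable_closed FU H cL hyp p'a s'y) => // j; case: (ht j) => _ _ [].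
have [iu is_] : invariant_bundle f L Eu /\ invariant_bundle f L Es by case: hyp => _ [].
have [_ Edx] := invariant_iter H k fL iu La Ex.
have [_ Edy] := invariant_iter H k fL is_ La Ey.
(* Over the limit point the decomposition is unique, so the limits of the components are the images
   of the limit components. *)
have [xE yE] : x' = dit f k a x /\ y' = dit f k a y.
  apply: (splitting_uniq su ss spl La') => //.
  by rewrite -ditvD /y' addrC subrK.
have x1 : nr x = 1.
  apply/eqP; rewrite eq_le; apply/andP; split.
    by apply: (cvg_nr_leC FU ux); apply: filterS filterT => j _; case: (ht j) => _ _ _ [->].
  by apply: (cvg_nr_geC FU ux); apply: filterS filterT => j _; case: (ht j) => _ _ _ [->].
have y1 : nr y <= 1.
  by apply: (cvg_nr_leC FU sy); apply: filterS filterT => j _; case: (ht j) => _ _ [].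
have x'5 := ku La Ex; have y'4 := ks La Ey; rewrite -xE x1 in x'5; rewrite -yE in y'4.
have N1 : \forall j \near F, nr (s' j) < nr (u' j).
  by apply: (near_nr_lt s'y u'x); lra.
have big : 9 / 2 <= nr (x' + y').
  have := nrD (x' + y') (- y'); rewrite addrK nrN => h.
  by lra.
have N2 : \forall j \near F, 17 / 4 < nr (u' j + s' j).
  have cw : (fun j => u' j + s' j) @ F --> x' + y' by exact: (cvgD u'x s'y).
  by apply: (near_nr_gt cw); lra.
have [j [/= h1 h2]] := filter_ex (filterI N1 N2).
have [_ _ [_ _ s1 _ _] [u1 _]] := ht j; apply; split; first exact: ltW.
by have := nrD (u j) (s j); lra.
Qed.

End ConeStep.

(** * No normality near the Julia set *)

Section NearJulia.
Variables (R : realType) (n : nat).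
Local Notation C := (Cplx R).
Local Notation V := 'rV[C]_n.
Variable F : set_system nat.
Hypotheses (FU : UltraFilter F)
  (FF : forall P : set nat, (exists m, forall j, (m <= j)%N -> P j) -> F P).
Variables (f g : V -> V) (M : R).
Hypothesis H : escape f g M.
Variables (L : set V) (Eu Es : V -> set V).
Hypotheses (cL : compact L) (fL : f @` L = L) (hyp : hyperbolic_data f L Eu Es).

Let clL : closed L := compact_closed (@norm_hausdorff _ _) cL.
Let su : subbundle L Eu. Proof. by case: hyp => -[]. Qed.
Let ss : subbundle L Es. Proof. by case: hyp => -[]. Qed.
Let spl : splitting L Eu Es. Proof. by case: hyp => -[]. Qed.

Let Lf k p : L p -> L (iter k f p).
Proof. by elim: k => //= k IH Lp; rewrite -fL; exists (iter k f p) => //; exact: IH. Qed.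

Lemma subbundle0 E p : subbundle L E -> L p -> (exists v, E p v) -> E p 0.
Proof. by move=> sE Lp [v Ev]; have := subbundle_sub sE Lp Ev Ev; rewrite subrr. Qed.

Let Es0 p : L p -> Es p 0.
Proof.
move=> Lp; apply: subbundle0 => //; have [u [s [_ hs _]]] := splitting_dec 0 spl Lp.
by exists s.
Qed.

(* A point of [L] without unstable directions would attract a neighbourhood. *)
Lemma unstable_nontrivial p : L p -> ~ (Kp f)° p -> exists2 u, Eu p u & u <> 0.
Proof.
move=> Lp np; apply: contrapT => nu; apply: np.
have Eu0 u : Eu p u -> u = 0 by move=> hu; apply: contrapT => u0; apply: nu; exists u.
have [gL igu] : g @` L = L /\ invariant_bundle g L Eu.
  by apply: (invariant_inv H fL); case: hyp => _ [].
have Eui i u : Eu (iter i f p) u -> u = 0.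
  move=> hu; have [_] := invariant_iter (escape_sym H) i gL igu (Lf i Lp) hu.
  rewrite iter_cancel; last exact: es_fK H.
  move/Eu0 => h; have := dit_cancel H i (iter i f p) u.
  by rewrite h ditv0.
have Esi i v : Es (iter i f p) v.
  have [u [s [hu hs ->]]] := splitting_dec v spl (Lf i Lp).
  by rewrite (Eui i u hu) add0r.
have [k [k0 _ ks]] := cone_constants hyp.
have [BL hBL] := compact_nr_bound cL.
have [B hB] := continuous_ball_bound (BL + 1) (@continuous_iter _ _ f k (es_fc H)).
have B0 : 0 <= B.
  apply: le_trans (nr_ge0 _) (hB p _); apply: le_trans (hBL _ Lp) _; lra.
(* For |v| <= rho the quadratic remainder 2B |v|^2 is at most |v| / 4, as is the image under the
   differential of f^k; together they shrink the distance to the orbit of p. *)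
pose rho := Num.min (1 / 2) (1 / (8 * (B + 1))).
have rho0 : 0 < rho by rewrite lt_min !divr_gt0 // mulr_gt0 // ltr_wpDl.
have rho2 : rho <= 1 / 2 by rewrite /rho ge_min lexx.
have rhoB : 8 * (B + 1) * rho <= 1.
  by rewrite mulrC -ler_pdivlMr ?mulr_gt0 ?ltr_wpDl // /rho ge_min lexx orbT.
have step i z : nr (z - iter i f p) <= rho ->
    nr (iter k f z - iter k f (iter i f p)) <= rho.
  move=> zr; set x := iter i f p in zr *; pose v := z - x.
  have hM w : nr (w - x) <= 1 -> nr (iter k f w) <= B.
    move=> wx; apply: hB; have := nrD (w - x) x; rewrite subrK.
    by have := hBL x (Lf i Lp); lra.
  have h1 := @diff_remainder _ _ _ (iter k f) (iter_curve_poly H k)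
    (iter_differentiable H k) x v 1 B ltr01 hM.
  have h2 := ks _ v (Lf i Lp) (Esi i v).
  have {}h1 := h1 (le_trans zr rho2).
  rewrite -ditE divr1 [x + v]addrC subrK in h1.
  have h3 : nr v ^+ 2 <= rho * nr v by rewrite expr2 ler_wpM2r ?nr_ge0.
  have h4 : 2 * B * nr v ^+ 2 <= nr v / 4.
    apply: le_trans (ler_wpM2l _ h3) _; first by rewrite mulr_ge0.
    rewrite mulrA [leRHS]mulrC ler_wpM2r ?nr_ge0 //; move: rhoB; nra.
  have := nrD (iter k f z - iter k f x - dit f k x v) (dit f k x v).
  rewrite subrK; rewrite -/v in zr; have := nr_ge0 v.
  by rewrite -/x in h2; lra.
apply/interior_nrP; exists rho => // z /ltW zp.
have orbit m : nr (iter (m * k) f z - iter (m * k) f p) <= rho.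
  by elim: m => // m IH; rewrite mulSn !iterD; exact: step.
apply: (recurrent_bounded H (B := BL + 1)) => m.
exists (m * k)%N; first by rewrite leq_pmulr.
have := nrD (iter (m * k) f z - iter (m * k) f p) (iter (m * k) f p).
by rewrite subrK; have := orbit m; have := hBL _ (Lf (m * k) Lp); lra.
Qed.

(** The non-strict inequality and the compactness of [L] let this pass to limits; openness costs a
    larger c. *)
Definition near_set (c : R) (z : V) := exists2 p, L p & nr (z - p) <= c.

Lemma near_set_mono c d z : c <= d -> near_set c z -> near_set d z.
Proof. by move=> cd [p Lp h]; exists p => //; exact: le_trans cd. Qed.

Lemma near_set_lim c (u : nat -> V) x : u @ F --> x ->
  (\forall j \near F, near_set c (u j)) -> near_set c x.
Proof.
move=> ux hu; have : forall j, exists p, near_set c (u j) -> L p /\ nr (u j - p) <= c.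
  move=> j; have [[p Lp h]|h] := pselect (near_set c (u j)); first by exists p.
  by exists 0.
move=> /choice[p hp]; have [BL hBL] := compact_nr_bound cL.
have pB : \forall j \near F, nr (p j) <= BL.
  by apply: filterS hu => j /hp[Lp _]; exact: hBL.
have [q pq] := ultra_cvg FU pB.
exists q; first by apply: (cvg_closed FU clL pq); apply: filterS hu => j /hp[].
have cB : (fun j => u j - p j) @ F --> x - q by exact: (cvgB ux pq).
by apply: (cvg_nr_leC FU cB); apply: filterS hu => j /hp[].
Qed.

Lemma near_set_near c d (u : nat -> V) x : u @ F --> x -> near_set c x -> c < d ->
  \forall j \near F, near_set d (u j).
Proof.
move=> /cvg_nrP ux [p Lp h] cd; have e0 : 0 < d - c by rewrite subr_gt0.
apply: filterS (ux _ e0) => j uj; exists p => //.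
by have := nr_dist (u j) p x; lra.
Qed.

Lemma not_near_open c k x : ~ near_set c (iter k f x) ->
  exists2 d : R, 0 < d & forall z, nr (z - x) < d -> ~ near_set c (iter k f z).
Proof.
move=> nx; apply: contrapT => h.
have bad (j : nat) : exists z, nr (z - x) < j.+1%:R^-1 /\ near_set c (iter k f z).
  apply: contrapT => h2; apply: h; exists j.+1%:R^-1; first by rewrite invr_gt0.
  by move=> z zx zc; apply: h2; exists z.
have [z hz] := choice bad; apply: nx.
have zx : z @ F --> x.
  apply: (cvg_near_seq FU FF (u := fun=> x)); first exact: cvg_cst.
  by move=> j; case: (hz j) => /ltW.
apply: (near_set_lim (cvg_iter (es_fc H) zx)).
by apply: filterS filterT => j _; case: (hz j).
Qed.

Hypothesis LJ : forall p, L p -> ~ (Kp f)° p.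

(** An unstable vector taken at a point of [L] close to y stays in the cones along the orbit of y
    and doubles every k steps, while at an interior point of K+ the differentials of all iterates
    are bounded. *)
Lemma near_orbit_not_interior : exists2 r : R, 0 < r & forall y,
  (forall i, near_set r (iter i f y)) -> ~ (Kp f)° y.
Proof.
have [k [_ ku ks]] := cone_constants hyp.
have [r r0 step] := cone_step FU FF H cL fL hyp ku ks.
exists r => // y hy /(interior_Kp_diff H)[B B0 hB].
have [p0 Lp0 yp0] := hy 0%N.
have [u0 hu0 u00] := unstable_nontrivial Lp0 (LJ Lp0).
have up := nr_gt0 u00.
have cone m : exists p u s, [/\ L p, nr (iter (m * k) f y - p) <= r,
    [/\ Eu p u, Es p s & nr s <= nr u], dit f (m * k) y u0 = u + s &
    2 ^+ m * nr u0 <= nr (u + s)].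
  elim: m => [|m [p [u [s [Lp yp [hu hs su_] E hm]]]]].
    exists p0, u0, 0; split => //; last by rewrite addr0 expr0 mul1r.
      by split => //; [exact: Es0|rewrite nr0 nr_ge0].
    by rewrite mul0n dit0 addr0.
  have [p' Lp' yp'] := hy (m.+1 * k)%N.
  have [u' [s' [hu' hs' E']]] := splitting_dec (dit f k (iter (m * k) f y) (u + s)) spl Lp'.
  have yk : iter (m.+1 * k) f y = iter k f (iter (m * k) f y) by rewrite mulSn iterD.
  have [h1 h2] : nr s' <= nr u' /\ 2 * nr (u + s) <= nr (u' + s').
    by apply: (step (iter (m * k) f y) p p') => //; rewrite -yk.
  exists p', u', s'; split => //; first by rewrite mulSn (ditD H) E E'.
  by apply: le_trans h2; rewrite exprS -mulrA ler_pM2l.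
have [m hm] := @pow2_unbounded R B 1 (lexx _).
have [p [u [s [_ _ _ E hm']]]] := cone m.
have := hB (m * k)%N u0; rewrite -ditE E => h.
have := le_trans hm' h; rewrite ler_pM2r // => h'.
by move: hm; rewrite mulr1 ltNge h'.
Qed.

Lemma first_exit c z : (exists l, ~ near_set c (iter l g z)) ->
  exists l, ~ near_set c (iter l g z) /\ forall i, (i < l)%N -> near_set c (iter i g z).
Proof.
move=> [l0 hl0]; have ex : exists l, `[< ~ near_set c (iter l g z) >].
  by exists l0; exact/asboolP.
case: (ex_minnP ex) => l /asboolP hl lmin; exists l; split => // i il.
apply: contrapT => /asboolP/lmin; by rewrite leqNgt il.
Qed.

Hypothesis Lmax : forall p, Kp f p -> Kp g p -> ~ (Kp f)° p -> L p.

Variable r : R.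
Hypothesis r_exp : forall y, (forall i, near_set r (iter i f y)) -> ~ (Kp f)° y.

(** Exit times tend to infinity because the backward orbit of x stays well inside. Hence a limit y
    of exit points has an image f(y) whose forward orbit stays near [L], so f(y) is not interior to
    K+ and belongs to [L], and so does y; but exit points are away from [L]. *)
Lemma exit_absurd c (z : nat -> V) x : 0 < c <= r -> z @ F --> x ->
  (forall l, near_set (c / 2) (iter l g x)) ->
  (forall j, exists l, ~ near_set c (iter l g (z j))) ->
  (forall l : nat -> nat, (forall j, forall i, (i < l j)%N -> near_set c (iter i g (z j))) ->
    exists y, [/\ (fun j => iter (l j) g (z j)) @ F --> y, Kp f y & Kp g y]) ->
  False.
Proof.
move=> /andP[c0 cr] zx xg ex lim.
have /choice[l hl] : forall j, exists l, ~ near_set c (iter l g (z j)) /\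
    forall i, (i < l)%N -> near_set c (iter i g (z j)).
  by move=> j; exact: first_exit.
have [|y [wy Kfy Kgy]] := lim l; first by move=> j; case: (hl j).
have late m : \forall j \near F, (m < l j)%N.
  have nearm i : \forall j \near F, near_set c (iter i g (z j)).
    by apply: (near_set_near (cvg_iter (es_gc H) zx) (xg i)); lra.
  have : \forall j \near F, forall i, (i <= m)%N -> near_set c (iter i g (z j)).
    elim: m => [|m IH].
      by apply: filterS (nearm 0%N) => j hj i; rewrite leqn0 => /eqP ->.
    apply: filterS2 IH (nearm m.+1) => j h1 h2 i.
    by rewrite leq_eqVlt => /orP[/eqP -> //|]; exact: h1.
  apply: filterS => j hj; rewrite ltnNge; apply/negP => lm.
  by case: (hl j) => + _; apply; exact: hj.
(* Exit points themselves are not near [L], whence the start at f(y), one step before the exit. *)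
have nfy : ~ (Kp f)° (f y).
  apply: r_exp => i; apply: (near_set_mono cr); rewrite -iterSr.
  apply: (near_set_lim (cvg_iter (es_fc H) wy)).
  apply: filterS (late i.+1) => j ij.
  have -> : iter i.+1 f (iter (l j) g (z j)) = iter (l j - i.+1) g (z j).
    by rewrite iter_sub_cancel //; [exact: es_gK H|exact: ltnW].
  by case: (hl j) => _; apply; lia.
have Lfy : L (f y).
  apply: Lmax => //; first exact: Kp_step.
  by apply: Kp_back; rewrite (es_fK H).
have Ly : L y.
  have : (f @` L) (f y) by rewrite fL.
  by move=> [q Lq /(can_inj (es_fK H)) <-].
have : \forall j \near F, near_set c (iter (l j) g (z j)).
  apply: (near_set_near wy _ c0); exists y => //.
  by rewrite subrr nr0.
by move=> /filter_ex[j]; case: (hl j).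
Qed.

Hypothesis r0 : 0 < r.

(** Otherwise [exit_absurd] applies to late returns f^k(u) of points u near x: their backward orbits
    retrace the orbit of u, which leaves the neighbourhood at the time i when that of x does. Limits
    of exit points lie in K by [limit_backward_bounded]. *)
Lemma interior_nw_exit x : nw f x -> (Kp f)° x ->
  exists l, ~ near_set (r / 2) (iter l g x).
Proof.
move=> hx Kx; apply: contrapT => nx.
have xg l : near_set (r / 2) (iter l g x).
  by apply: contrapT => h; apply: nx; exists l.
have [i hi] : exists i, ~ near_set r (iter i f x).
  apply: contrapT => h; apply: (r_exp _ Kx) => i.
  by apply: contrapT => h2; apply: h; exists i.
have [d d0 hd] := not_near_open hi.
have [rb [B [rb0 B0 hB]]] := interior_Kp_bound H Kx.
have ret (j : nat) : exists t : nat * V, [/\ (i <= t.1)%N, nr (t.2 - x) <= j.+1%:R^-1,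
    nr (iter t.1 f t.2 - x) <= j.+1%:R^-1, nr (t.2 - x) < d & nr (t.2 - x) <= rb].
  pose e := Num.min j.+1%:R^-1 (Num.min d rb).
  have e0 : 0 < e by rewrite !lt_min d0 rb0 invr_gt0 ltr0Sn.
  have [k ik [z [z1 z2]]] := nw_late i (es_fc H) hx e0.
  move: z1 z2; rewrite !lt_min => /and3P[z1 z3 z4] /and3P[z2 _ _].
  by exists (k, z); split => //=; exact: ltW.
have [t ht] := choice ret; pose k j := (t j).1; pose u j := (t j).2.
have cst : (fun=> x : V) @ F --> x by exact: cvg_cst.
have ux : u @ F --> x by apply: (cvg_near_seq FU FF cst) => j; case: (ht j).
have zx : (fun j => iter (k j) f (u j)) @ F --> x.
  by apply: (cvg_near_seq FU FF cst) => j; case: (ht j).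
have ki j : (i <= k j)%N by case: (ht j).
have gf j l : (l <= k j)%N -> iter l g (iter (k j) f (u j)) = iter (k j - l) f (u j).
  by move=> lk; rewrite iter_sub_cancel //; exact: es_fK H.
have uB j m : Kp f (u j) /\ nr (iter m f (u j)) <= B by apply: hB; case: (ht j).
have Kfx : Kp f x := interior_subset Kx.
have Kgx : Kp g x := nw_bounded (escape_sym H) (nw_cancel (es_fK H) hx).
have exi j : ~ near_set r (iter (k j - i) g (iter (k j) f (u j))).
  by rewrite gf ?leq_subr // subKn //; apply: hd; case: (ht j).
have cr : 0 < r <= r by rewrite r0 lexx.
apply: (exit_absurd cr zx xg) => [j|l hl]; first by exists (k j - i)%N.
have lk j : (l j <= k j)%N.
  by rewrite leqNgt; apply/negP => kl; apply: (exi j); apply: hl; lia.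
have E : (fun j => iter (l j) g (iter (k j) f (u j))) = (fun j => iter (k j - l j) f (u j)).
  by apply/funext => j; exact: gf.
have [y wy] : exists y : V, (fun j => iter (k j - l j) f (u j)) @ F --> y.
  by apply: (@ultra_cvg _ _ F FU _ B); apply: filterS filterT => j _; case: (uB j (k j - l j)%N).
exists y; rewrite E; split => //; last exact: (limit_backward_bounded H Kfx Kgx ux wy).
apply: (cvg_closed FU (Kp_closed H) wy); apply: filterS filterT => j _.
by apply: Kp_iter; case: (uB j 0%N).
Qed.

(** Points accumulating at q in [L] would all have backward exits by [interior_nw_exit], whereas the
    backward orbit of q stays in [L]. Exit points are nonwandering, so their limits lie in K. *)
Lemma interior_nw_far : exists2 c : R, 0 < c &
  forall x, nw f x -> (Kp f)° x -> ~ near_set c x.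
Proof.
apply: contrapT => h.
have bad (j : nat) : exists t : V * V, [/\ nw f t.1, (Kp f)° t.1, L t.2 &
    nr (t.1 - t.2) <= j.+1%:R^-1].
  apply: contrapT => h2; apply: h; exists j.+1%:R^-1; first by rewrite invr_gt0.
  by move=> x hx Kx [p Lp xp]; apply: h2; exists (x, p).
have [t ht] := choice bad; pose x j := (t j).1; pose p j := (t j).2.
have Lp j : L (p j) by case: (ht j).
have [q Lq pq] := seq_limit_in FU cL Lp.
have xq : x @ F --> q by apply: (cvg_near_seq FU FF pq) => j; case: (ht j).
have Lg l : L (iter l g q).
  elim: l => //= l IH; move: IH; rewrite -{1}fL => -[w Lw <-].
  by rewrite (es_fK H).
have cr : 0 < r / 2 <= r by apply/andP; split; move: r0; lra.
apply: (exit_absurd cr xq) => [l|j|l hl].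
- by exists (iter l g q) => //; rewrite subrr nr0; lra.
- by case: (ht j) => *; exact: interior_nw_exit.
have wn j : nw f (iter (l j) g (x j)).
  apply: (nw_cancel (es_gK H)); apply: nw_iter; first exact: es_gc H.
  by apply: (nw_cancel (es_fK H)); case: (ht j).
have wf j : Kp f (iter (l j) g (x j)) := nw_bounded H (wn j).
have wg j : Kp g (iter (l j) g (x j)).
  exact: (nw_bounded (escape_sym H) (nw_cancel (es_fK H) (wn j))).
have [y wy] : exists y : V, (fun j => iter (l j) g (x j)) @ F --> y.
  apply: (@ultra_cvg _ _ F FU _ M); apply: filterS filterT => j _.
  exact: (K_bound H (wf j) (wg j)).
exists y; split => //.
  by apply: (cvg_closed FU (Kp_closed H) wy); exact: filterS filterT.
by apply: (cvg_closed FU (Kp_closed (escape_sym H)) wy); exact: filterS filterT.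
Qed.

End NearJulia.

(** * Nonwandering points in the interior of K+ are sinks *)

Section Sinks.
Variables (R : realType) (n : nat).
Local Notation C := (Cplx R).
Local Notation V := 'rV[C]_n.
Variable F : set_system nat.
Hypotheses (FU : UltraFilter F)
  (FF : forall P : set nat, (exists m, forall j, (m <= j)%N -> P j) -> F P).
Variables (f g : V -> V) (M : R).
Hypothesis H : escape f g M.

Let A : set V := [set x | nw f x /\ (Kp f)° x].

(** To be supplied by the positive distance between A and J, which keeps limits off the boundary of
    K+. *)
Hypothesis A_lim : forall (u : nat -> V) x, u @ F --> x -> (forall j, A (u j)) -> A x.

Lemma interior_lipschitz x : (Kp f)° x -> exists r B K : R,
  [/\ 0 < r /\ 0 < B, 0 < K, (forall z, nr (z - x) <= r -> (Kp f)° z),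
    (forall k z, nr (z - x) <= r -> nr (iter k f z) <= B) &
    (forall k z w, nr (z - x) <= r -> nr (w - x) <= r ->
      nr (iter k f w - iter k f z) <= K * nr (w - z))].
Proof.
move=> /(interior_Kp_bound H)[r [B [r0 B0 hB]]].
have hM k z : nr (z - x) <= r -> nr (iter k f z) <= B by move=> /(hB k z)[].
exists (r / 8), B, (4 * B / r); split.
- by rewrite B0 divr_gt0.
- by rewrite divr_gt0 // mulr_gt0.
- move=> z zx; apply/interior_nrP; exists (r / 2) => [|q qz]; first by lra.
  have [//|//] := hB 0%N q; have := nr_dist q x z; lra.
- by move=> k z zx; apply: hM; lra.
- move=> k z w zx wx.
  exact: (lipschitz_bound (iter_curve_poly H k) r0 (hM k) zx wx).
Qed.

(** The Lipschitz bound common to all iterates transfers the return of a nearby point to x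
    itself. *)
Lemma recurrent_sequence x : A x -> exists k : nat -> nat,
  (forall j, (j < k j)%N) /\ (fun j => iter (k j) f x) @ F --> x.
Proof.
move=> [hx Kx]; have [r [B [K [[r0 B0] K0 _ _ hK]]]] := interior_lipschitz Kx.
have ret (j : nat) : exists k, (j < k)%N /\ nr (iter k f x - x) <= (K + 1) * j.+1%:R^-1.
  pose e := Num.min j.+1%:R^-1 r.
  have e0 : 0 < e by rewrite !lt_min r0 invr_gt0 ltr0Sn.
  have [k jk [z []]] := nw_late j.+1 (es_fc H) hx e0.
  rewrite !lt_min => /andP[z1 z2] /andP[z3 _]; exists k; split => //.
  have h := hK k z x (ltW z2) _; rewrite subrr nr0 in h.
  have {}h := h (ltW r0); rewrite (nrB x z) in h.
  apply: le_trans (nr_dist _ _ (iter k f z)) _; rewrite mulrDl mul1r lerD ?(ltW z3) //.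
  by apply: le_trans h _; rewrite ler_pM2l // ltW.
have [k hk] := choice ret; exists k; split; first by move=> j; case: (hk j).
apply/cvg_nrP => e e0.
have e1 : 0 < e / (K + 1) by rewrite divr_gt0 // addr_gt0.
apply: filterS (inv_cvg0 FF e1) => j /=; rewrite ltr_pdivlMr ?addr_gt0 // mulrC.
by apply: le_lt_trans; case: (hk j).
Qed.

Lemma late_index (k : nat -> nat) : (forall j, (j < k j)%N) ->
  forall m, F [set j | (m <= k j)%N].
Proof. by move=> hk m; apply: FF; exists m => j mj /=; have := hk j; lia. Qed.

(* Parseval on a disc through [x] bounds the derivative of [iter (k j) f] at [x] by the
   gap between the supremum of [e2] and its value at the centre. *)
Lemma small_diff x (k : nat -> nat) (d : R) : (Kp f)° x ->
  (fun j => iter (k j) f x) @ F --> x -> 0 < d ->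
  (forall z l, nr (z - x) <= d -> (fun j => iter (k j) f z) @ F --> l -> e2 l <= e2 x) ->
  forall e, 0 < e -> \forall j \near F, forall v, nr (dit f (k j) x v) <= e * nr v.
Proof.
move=> Kx kx d0 hmax e e0; have [r [B [K [[r0 B0] K0 _ hB hK]]]] := interior_lipschitz Kx.
pose s := Num.min d r; have s0 : 0 < s by rewrite lt_min d0.
have sd : s <= d by rewrite /s ge_min lexx.
have sr : s <= r by rewrite /s ge_min lexx orbT.
(* Parseval on radius s bounds s^2 times [e2] of the differential by the gap 2 eta = e^2 s^2. *)
pose eta := e ^+ 2 * s ^+ 2 / 2.
have eta0 : 0 < eta by rewrite divr_gt0 // mulr_gt0 // exprn_gt0.
have up : \forall j \near F, forall z, nr (z - x) <= s -> e2 (iter (k j) f z) <= e2 x + eta.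
  have [//|nF] := in_ultra_setVsetC
    [set j | forall z, nr (z - x) <= s -> e2 (iter (k j) f z) <= e2 x + eta] FU.
  (* A point violating the bound if there is one, and x otherwise; for [F]-almost all j there is
     one. *)
  have bad j : exists z, nr (z - x) <= s /\
      ((exists y, nr (y - x) <= s /\ e2 x + eta < e2 (iter (k j) f y)) ->
       e2 x + eta < e2 (iter (k j) f z)).
    have [[y [yx h]]|h] := pselect (exists y, nr (y - x) <= s /\ e2 x + eta < e2 (iter (k j) f y)).
      by exists y.
    by exists x; rewrite subrr nr0 ltW.
  have [z hz] := choice bad.
  have [y zy] : exists y : V, z @ F --> y.
    apply: (@ultra_cvg _ _ F FU _ (s + nr x)); apply: filterS filterT => j _.
    by have := nrD (z j - x) x; rewrite subrK; case: (hz j) => zx _; lra.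
  have yx : nr (y - x) <= s.
    have cst : (fun j => z j - x) @ F --> y - x by exact: (cvgB zy (cvg_cst _)).
    by apply: (cvg_nr_leC FU cst); apply: filterS filterT => j _; case: (hz j).
  have [l kl] : exists l : V, (fun j => iter (k j) f y) @ F --> l.
    apply: (@ultra_cvg _ _ F FU _ B); apply: filterS filterT => j _.
    by apply: hB; exact: le_trans sr.
  have kz : (fun j => iter (k j) f (z j)) @ F --> l.
    apply/cvg_nrP => t t0; have t2 : 0 < t / 2 by lra.
    have t3 : 0 < t / 2 / K by rewrite divr_gt0.
    move/cvg_nrP: kl => /(_ _ t2) N1; move/cvg_nrP: zy => /(_ _ t3).
    apply: filterS2 N1 => j h1; rewrite ltr_pdivlMr // mulrC => h2.
    have h3 := hK (k j) y (z j) (le_trans yx sr) (le_trans (proj1 (hz j)) sr).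
    have := nr_dist (iter (k j) f (z j)) l (iter (k j) f y).
    by have := le_lt_trans h3 h2; lra.
  have hl := hmax y l (le_trans yx sd) kl.
  have : \forall j \near F, e2 x + eta < e2 (iter (k j) f (z j)).
    apply: filterS nF => j /= nj; case: (hz j) => _; apply.
    apply: contrapT => h; apply: nj => w wx; rewrite leNgt; apply/negP => h2.
    by apply: h; exists w.
  have : (fun j => e2 (iter (k j) f (z j))) @ F --> e2 l by exact: (cvg_e2 kz).
  move/cvgrPdist_lt/(_ eta eta0) => N1 N2.
  have [j [/= h1 h2]] := filter_ex (filterI N1 N2).
  by move: h1; rewrite ltr_norml => /andP[h3 _]; lra.
have low : \forall j \near F, e2 x - eta < e2 (iter (k j) f x).
  have : (fun j => e2 (iter (k j) f x)) @ F --> e2 x by exact: (cvg_e2 kx).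
  move/cvgrPdist_lt/(_ eta eta0); apply: filterS => j.
  by rewrite ltr_norml => /andP[_ h]; lra.
apply: filterS2 up low => j hup hlow v.
have unit w : nr w <= 1 -> nr (dit f (k j) x w) <= e.
  move=> w1; apply: nr_le_e2; first exact: ltW.
  have := parseval_diff (iter_curve_poly H (k j)) (iter_differentiable H (k j)) (ltW s0) w1 hup.
  rewrite -ditE => h; have h2 : s ^+ 2 * e2 (dit f (k j) x w) <= 2 * eta by lra.
  have s20 : 0 < s ^+ 2 by rewrite exprn_gt0.
  rewrite -(ler_pM2l s20); apply: le_trans h2 _.
  by rewrite /eta le_eqVlt; apply/orP; left; apply/eqP; field.
have [->|v0] := pselect (v = 0); first by rewrite ditv0 nr0 mulr0.
have vp := nr_gt0 v0.
have := unit ((ofR (nr v)^-1 : C) *: v); rewrite ditvZ !nrZ cmod_ofR gtr0_norm ?invr_gt0 //.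
by rewrite mulVf ?gt_eqF // ler_pdivrMl // mulrC; apply.
Qed.

Lemma curve_poly_shift (h : V -> V) c : curve_poly h -> curve_poly (fun z => h z - c).
Proof.
move=> hp u; have [q qE] := hp u; exists (fun i => q i - (c 0 i)%:P) => t.
by rewrite qE; apply/rowP => i; rewrite !mxE hornerD hornerN hornerC.
Qed.

(** For a suitable return time K, f^K contracts a small ball into itself. A recurrent point a of
    that ball is fixed by f^K, since the distance from a to f^K(a) shrinks along the orbit yet has
    to recur; and a contraction has at most one fixed point. *)
Lemma sink x (k : nat -> nat) : A x -> (forall j, (j < k j)%N) ->
  (fun j => iter (k j) f x) @ F --> x ->
  (forall e, 0 < e -> \forall j \near F, forall v, nr (dit f (k j) x v) <= e * nr v) ->
  exists K : nat, [/\ (0 < K)%N, iter K f x = x,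
    forall v, nr (dit f K x v) <= 1 / 64 * nr v &
    exists2 d : R, 0 < d & forall a, A a -> nr (a - x) < d -> a = x].
Proof.
move=> Ax hk kx hsmall; have [hx Kx] := Ax.
have [rb [B' [rb0 B'0 hB']]] := interior_Kp_bound H Kx.
have [r [B [L [[r0 B0] L0 _ hB hL]]]] := interior_lipschitz Kx.
pose s := Num.min r (Num.min (rb / 2) (rb ^+ 2 / (128 * B'))).
have s0 : 0 < s by rewrite !lt_min r0 !divr_gt0 ?exprn_gt0 ?mulr_gt0.
have sr : s <= r by rewrite /s ge_min lexx.
have srb : s <= rb / 2 by rewrite /s !ge_min lexx !orbT.
have sB : 2 * B' * s / rb ^+ 2 <= 1 / 64.
  rewrite ler_pdivrMr ?exprn_gt0 //.
  have : s <= rb ^+ 2 / (128 * B') by rewrite /s !ge_min lexx !orbT.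
  by rewrite ler_pdivlMr ?mulr_gt0 //; lra.
have e64 : 0 < 1 / 64 :> R by rewrite divr_gt0.
have s64 : 0 < s / 64 by rewrite divr_gt0.
have [j [/= dj kj]] : exists j, (forall v, nr (dit f (k j) x v) <= 1 / 64 * nr v) /\
    nr (iter (k j) f x - x) < s / 64.
  move/cvg_nrP: kx => /(_ _ s64) N.
  by have [j hj] := filter_ex (filterI (hsmall _ e64) N); exists j.
pose K := k j; pose h := iter K f.
have K0 : (0 < K)%N by apply: leq_ltn_trans (hk j).
have sup z : nr (z - x) <= s -> nr (h z - h x) <= s / 32.
  move=> zs; set v := z - x in zs.
  have zE : x + v = z by rewrite /v addrC subrK.
  have hM w : nr (w - x) <= rb -> nr (iter K f w) <= B' by move=> /(hB' K w)[].
  have := @diff_remainder _ _ _ (iter K f) (iter_curve_poly H K)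
    (iter_differentiable H K) x v rb B' rb0 hM (le_trans zs srb).
  rewrite -ditE zE => h1.
  have h2 := dj v; rewrite -/K in h2.
  have h3 : 2 * B' * (nr v / rb) ^+ 2 <= s / 64.
    have : 2 * B' * (nr v / rb) ^+ 2 <= 2 * B' * (s / rb) ^+ 2.
      rewrite ler_wpM2l ?mulr_ge0 ?(ltW B'0) // lerXn2r ?nnegrE ?divr_ge0 ?nr_ge0 ?(ltW rb0)
        ?(ltW s0) //.
      by rewrite ler_wpM2r // invr_ge0 ltW.
    move/le_trans; apply.
    have -> : 2 * B' * (s / rb) ^+ 2 = (2 * B' * s / rb ^+ 2) * s.
      by field; rewrite gt_eqF.
    by have := ler_wpM2r (ltW s0) sB; lra.
  have := nrD (iter K f z - iter K f x - dit f K x v) (dit f K x v); rewrite subrK.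
  by rewrite /h; lra.
(* On this radius [lipschitz_bound], with the bound s / 32 on radius s, gives the constant 4 (s /
   32) / s = 1/8. *)
pose d := s / 8; have d0 : 0 < d by rewrite divr_gt0.
have contr z w : nr (z - x) <= d -> nr (w - x) <= d -> nr (h w - h z) <= 1 / 8 * nr (w - z).
  move=> zd wd.
  have := lipschitz_bound (curve_poly_shift (h x) (iter_curve_poly H K)) s0 sup zd wd.
  rewrite /= opprB addrA subrK -/h; move/le_trans; apply.
  rewrite ler_wpM2r ?nr_ge0 // ler_pdivrMr //; lra.
have stay z : nr (z - x) <= d -> nr (h z - x) <= d.
  move=> zd; have := contr x z; rewrite subrr nr0 => /(_ (ltW d0) zd) h1.
  by have := nr_dist (h z) x (h x); rewrite /h /K in h1 *; move: zd kj h1; rewrite /d; lra.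
have iter_stay m z : nr (z - x) <= d -> nr (iter m h z - x) <= d.
  by move=> zd; elim: m => //= m IH; exact: stay.
have iter_contr m z w : nr (z - x) <= d -> nr (w - x) <= d ->
    nr (iter m h w - iter m h z) <= (1 / 8) ^+ m * nr (w - z).
  move=> zd wd; elim: m => [|m IH]; first by rewrite expr0 mul1r.
  rewrite !iterS; apply: le_trans (contr _ _ (iter_stay m z zd) (iter_stay m w wd)) _.
  by rewrite exprS -[X in _ <= X]mulrA ler_wpM2l // divr_ge0.
have dr : d <= r by rewrite /d; lra.
have fixed a : A a -> nr (a - x) <= d -> h a = a.
  move=> Aa ad; have [k' [hk' ka]] := recurrent_sequence Aa.
  have cl : (fun i => iter (k' i) f (h a) - iter (k' i) f a) @ F --> h a - a.
    have c1 : (fun i => iter (k' i) f (h a)) @ F --> h a.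
      rewrite (_ : (fun i => _) = (fun i => h (iter (k' i) f a))); last first.
        by apply/funext => i; rewrite /h -!iterD addnC.
      exact: (cvg_iter (es_fc H) ka).
    exact: (cvgB c1 ka).
  apply/subr0_eq/nr_eq0/eqP; rewrite eq_le nr_ge0 andbT leNgt; apply/negP => D0.
  set D := nr (h a - a) in D0.
  have small : exists m0, forall m, (m0 <= m)%N -> (1 / 8 : R) ^+ m < (2 * L)^-1.
    by apply: small_power; rewrite ?invr_gt0 ?mulr_gt0 //; apply/andP; split; lra.
  have [m0 hm0] := small.
  have far : \forall i \near F, nr (iter (k' i) f (h a) - iter (k' i) f a) <= D / 2.
    apply: filterS (late_index hk' (K * m0)) => i /= im.
    have mi : (m0 <= k' i %/ K)%N by rewrite leq_divRL // mulnC.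
    (* The quotient of the return time by K contracts, and the remainder costs at most the factor
       L. *)
    have E z : iter (k' i) f z = iter (k' i %% K) f (iter (k' i %/ K) h z).
      by rewrite {1}(divn_eq (k' i) K) addnC iterD iterM.
    rewrite !E; apply: le_trans (hL _ _ _ _ _) _.
    - by apply: le_trans dr; exact: iter_stay.
    - by apply: le_trans dr; apply: iter_stay; exact: stay.
    apply: le_trans (ler_wpM2l (ltW L0) (iter_contr _ _ _ ad (stay _ ad))) _.
    have h1 := ltW (hm0 _ mi); rewrite -/D.
    have -> : D / 2 = L * ((2 * L)^-1 * D) by field; rewrite gt_eqF.
    by apply: ler_wpM2l (ltW L0) _ _ _; apply: ler_wpM2r h1; exact: ltW.
  by have := cvg_nr_leC FU cl far; rewrite -/D; lra.
exists K; split => //; first by apply: (fixed x Ax); rewrite subrr nr0 ltW.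
exists d => // a Aa ad; have fa := fixed a Aa (ltW ad).
have fx : h x = x by apply: (fixed x Ax); rewrite subrr nr0 ltW.
have := contr x a; rewrite subrr nr0 => /(_ (ltW d0) (ltW ad)); rewrite fa fx => h1.
apply/subr0_eq/nr_eq0/eqP; rewrite eq_le nr_ge0 andbT; lra.
Qed.

Lemma limit_in_A x : A x -> exists2 d : R, 0 < d & forall (k : nat -> nat) z l,
  (forall j, (j < k j)%N) -> (fun j => iter (k j) f x) @ F --> x ->
  nr (z - x) <= d -> (fun j => iter (k j) f z) @ F --> l -> A l.
Proof.
move=> [hx Kx]; have [r [B [K [[r0 B0] K0 hI _ hK]]]] := interior_lipschitz Kx.
pose d := Num.min r (r / K); have d0 : 0 < d by rewrite lt_min r0 divr_gt0.
exists d; first exact: d0.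
move=> k z l hk kx zd kz.
have zr : nr (z - x) <= r by apply: le_trans zd _; rewrite ge_min lexx.
have zK : K * nr (z - x) <= r.
  by rewrite mulrC -ler_pdivlMr //; apply: le_trans zd _; rewrite ge_min lexx orbT.
split; first exact: (limit_nw (late_index hk) kz).
apply: hI.
have c : (fun j => iter (k j) f z - iter (k j) f x) @ F --> l - x by exact: (cvgB kz kx).
apply: (cvg_nr_leC FU c); apply: filterS filterT => j _; apply: le_trans zK.
by apply: hK => //; rewrite subrr nr0 ltW.
Qed.

Definition isolated (B : set V) x :=
  exists2 d : R, 0 < d & forall a, B a -> nr (a - x) < d -> a = x.

Lemma nr_dist_abs (a b c : V) : `|nr (a - c) - nr (b - c)| <= nr (a - b).
Proof.
rewrite ler_norml; apply/andP; split.
  by have := nr_dist b c a; rewrite (nrB b a); lra.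
by have := nr_dist a c b; lra.
Qed.

(* The limit map of the iterates along [k] sends the segment from [x] to [z] into [A]. *)
Lemma limit_path x : A x -> exists2 d : R, 0 < d & forall (k : nat -> nat) z l,
  (forall j, (j < k j)%N) -> (fun j => iter (k j) f x) @ F --> x ->
  nr (z - x) <= d -> (fun j => iter (k j) f z) @ F --> l ->
  A l /\ (isolated A l -> l = x).
Proof.
move=> Ax; have [d1 d10 hd1] := limit_in_A Ax.
have [r [B [K [[r0 B0] K0 hI hB hK]]]] := interior_lipschitz (proj2 Ax).
pose d := Num.min d1 r; have d0 : 0 < d by rewrite lt_min d10.
have dd1 : d <= d1 by rewrite /d ge_min lexx.
have dr : d <= r by rewrite /d ge_min lexx orbT.
exists d; first exact: d0.
move=> k z l hk kx zd kz; split; first exact: (hd1 k z l hk kx (le_trans zd dd1) kz).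
move=> [e e0 he].
have lim w : exists l : V, nr (w - x) <= d -> (fun j => iter (k j) f w) @ F --> l.
  have [wd|nwd] := pselect (nr (w - x) <= d); last first.
    exists 0; move=> wd; exfalso; exact: nwd.
  have [|y wy] := @ultra_cvg _ _ F FU (fun j => iter (k j) f w) B.
    by apply: filterS filterT => j _; apply: hB; exact: le_trans dr.
  exists y; move=> _; exact: wy.
have [G hG] := choice lim.
have Gu w y : nr (w - x) <= d -> (fun j => iter (k j) f w) @ F --> y -> G w = y.
  by move=> wd wy; apply: (cvg_unique _ (hG w wd) wy); exact: norm_hausdorff.
have GL w w' : nr (w - x) <= d -> nr (w' - x) <= d -> nr (G w' - G w) <= K * nr (w' - w).
  move=> wd wd'.
  have c : (fun j => iter (k j) f w' - iter (k j) f w) @ F --> G w' - G w.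
    exact: (cvgB (hG w' wd') (hG w wd)).
  apply: (cvg_nr_leC FU c); apply: filterS filterT => j _.
  by apply: hK; exact: le_trans dr.
have GA w : nr (w - x) <= d -> A (G w).
  by move=> wd; apply: (hd1 k w _ hk kx (le_trans wd dd1)); exact: hG.
have xd : nr (x - x) <= d by rewrite subrr nr0 ltW.
have Gx : G x = x by exact: Gu.
have Gz : G z = l by exact: Gu.
pose p (s : R) := z + (ofR s : C) *: (x - z).
have pd s : 0 <= s <= 1 -> nr (p s - x) <= d.
  move=> /andP[s0 s1]; have -> : p s - x = (ofR (1 - s) : C) *: (z - x).
    have -> : ofR (1 - s) = 1 - ofR s :> C.
      by apply/eqP; rewrite eq_complex /= oppr0 addr0 !eqxx.
    by rewrite /p scalerBl scale1r -[x - z]opprB scalerN addrAC.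
  rewrite nrZ cmod_ofR ger0_norm ?subr_ge0 //; apply: le_trans zd.
  by rewrite ler_piMl ?nr_ge0 //; lra.
have pp s t : p s - p t = (ofR (s - t) : C) *: (x - z).
  have -> : ofR (s - t) = ofR s - ofR t :> C.
    by apply/eqP; rewrite eq_complex /= oppr0 addr0 !eqxx.
  by rewrite /p scalerBl opprD addrACA subrr add0r.
have cc : {within `[0, 1], continuous (fun s => nr (G (p s) - l))}.
  apply/subspace_continuousP => s s01; apply/cvgrPdist_lt => t t0.
  have Kz0 : 0 < K * nr (x - z) + 1 by rewrite ltr_wpDl // mulr_ge0 ?nr_ge0 // ltW.
  have q0 : 0 < t / (K * nr (x - z) + 1) by rewrite divr_gt0.
  rewrite near_withinE; near=> y => y01.
  have sy : `|s - y| < t / (K * nr (x - z) + 1) by near: y; exact: nbhsx_ballx.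
  have i01 (w : R) : `[0, 1]%classic w -> 0 <= w <= 1 by rewrite /= in_itv.
  have yd : nr (p y - x) <= d by apply: pd; exact: i01.
  have sd : nr (p s - x) <= d by apply: pd; exact: i01.
  have h1 := GL _ _ yd sd.
  rewrite pp nrZ cmod_ofR in h1.
  have h2 := nr_dist_abs (G (p s)) (G (p y)) l.
  apply: le_lt_trans h2 (le_lt_trans h1 _).
  move: sy; rewrite ltr_pdivlMr // => sy.
  apply: le_lt_trans sy; rewrite mulrCA ler_wpM2l // lerDl.
  by [].
(* The image of the segment joins l to x, at distance at least e from l; a point of it at distance e
   / 2 would lie in A, against the isolation of l. *)
apply: contrapT => lx.
have far : e <= nr (x - l).
  by rewrite leNgt; apply/negP => h; apply: lx; apply/esym; exact: he.
have [||s s01 hs] := segment_IVT (c := fun s => G (p s)) (d := e / 2) cc.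
- by rewrite /p (_ : ofR 0 = 0) // scale0r addr0 Gz subrr nr0; lra.
- by rewrite /p (_ : ofR 1 = 1) // scale1r [z + _]addrC subrK Gx; lra.
have : G (p s) = l by apply: he; [exact: GA (pd s s01)|rewrite hs; lra].
by move=> E; move: hs; rewrite E subrr nr0; lra.
Unshelve. all: by end_near.
Qed.

Lemma A_bounded x : A x -> nr x <= M.
Proof.
move=> [hx _]; apply: (K_bound H (nw_bounded H hx)).
exact: nw_bounded (escape_sym H) _ (nw_cancel (es_fK H) hx).
Qed.

Lemma A_seq (u : nat -> V) : (forall j, A (u j)) -> exists2 l : V, A l & u @ F --> l.
Proof.
move=> Au; have [|l ul] := seq_limit FU (u := u) (B := M).
  by move=> j; exact: A_bounded.
exists l; [exact: A_lim ul Au|exact: ul].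
Qed.

Lemma e2_max (B : set V) : B !=set0 -> B `<=` A ->
  (forall (u : nat -> V) x, u @ F --> x -> (forall j, B (u j)) -> B x) ->
  exists2 w, B w & forall x, B x -> e2 x <= e2 w.
Proof.
move=> B0 BA Blim; have cB : closed B.
  move=> x Bx; have near (j : nat) : exists y, B y /\ nr (y - x) <= j.+1%:R^-1.
    have [|y [By /= yx]] := Bx [set y | nr (y - x) < j.+1%:R^-1].
      by apply/nbhs_nrP; exists j.+1%:R^-1.
    by exists y; split => //; exact: ltW.
  have [u hu] := choice near; apply: (Blim u) => [|j]; last by case: (hu j).
  by apply: (cvg_near_seq FU FF (cvg_cst x)) => j; case: (hu j).
have cptB : compact B.
  apply: (subclosed_compact cB (@closed_ball_compact R n M)) => x /BA.
  exact: A_bounded.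
have [|w Bw hw] := @compact_EVT_max V R (@e2 R n) B B0 cptB; last first.
  by exists w => [|x Bx]; [move: Bw; rewrite inE|apply: hw; rewrite inE].
apply: continuous_subspaceT => z.
by apply: (@cvg_e2 _ _ _ (nbhs z) _ id z); exact: cvg_id.
Qed.

(** Near a maximum x of [e2] over the non-isolated points, limits of iterates are again
    non-isolated: by [limit_path] an isolated limit would be x. So [small_diff] applies, and [sink]
    isolates x. *)
Lemma isolated_A w : A w -> isolated A w.
Proof.
move=> Aw; apply: contrapT => niw.
pose B := [set x | A x /\ ~ isolated A x].
have [|||x [Ax nix] xmax] := @e2_max B.
- by exists w.
- by move=> x [].
- move=> u x ux Bu; split; first by apply: (A_lim ux) => j; case: (Bu j).
  move=> [d d0 hd]; move/cvg_nrP: (ux) => /(_ d d0) N.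
  have [j /= hj] := filter_ex N; have [Aj nj] := Bu j.
  by apply: nj; rewrite (hd _ Aj hj); exists d.
have [k [hk kx]] := recurrent_sequence Ax; have [d d0 hd] := limit_path Ax.
have small := small_diff (proj2 Ax) kx d0.
have [|K [_ _ _ //]] := sink Ax hk kx _; apply: small => z l zd zl.
have [Al il] := hd k z l hk kx zd zl; apply: xmax; split => // isol.
by apply: nix; rewrite -(il isol).
Qed.

(** As all points of A are isolated, the limits in [limit_path] equal w, so [small_diff] applies at
    w itself. *)
Lemma sink_A w : A w -> exists K : nat, [/\ (0 < K)%N, iter K f w = w &
  forall v, nr (dit f K w v) <= 1 / 64 * nr v].
Proof.
move=> Aw; have [k [hk kw]] := recurrent_sequence Aw; have [d d0 hd] := limit_path Aw.
have small := small_diff (proj2 Aw) kw d0.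
have [|K [K1 K2 K3 _]] := sink Aw hk kw _; last by exists K.
apply: small => z l zd zl.
have [Al il] := hd k z l hk kw zd zl; by rewrite (il (isolated_A Al)).
Qed.

(** Finiteness of A in usable form: counterexamples for each index would converge to a point of A,
    hence eventually equal it. *)
Lemma uniform_A (P : nat -> V -> Prop) :
  (forall w, A w -> exists m, forall j, (m <= j)%N -> P j w) ->
  exists j, forall w, A w -> P j w.
Proof.
move=> hP; apply: contrapT => h.
have bad (j : nat) : exists w, A w /\ ~ P j w.
  apply: contrapT => h2; apply: h; exists j => w Aw.
  by apply: contrapT => nP; apply: h2; exists w.
have [u hu] := choice bad; have Au j : A (u j) by case: (hu j).
have [w Aw uw] := A_seq Au; have [d d0 hd] := isolated_A Aw.
have [m hm] := hP w Aw; move/cvg_nrP: uw => /(_ d d0) N.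
have Fm : F [set j | (m <= j)%N] by apply: FF; exists m.
have [j [/= h1 h2]] := filter_ex (filterI N Fm).
by case: (hu j) => _; apply; rewrite (hd _ (Au j) h1); exact: hm.
Qed.

Lemma sink_mul w K q : iter K f w = w -> (forall v, nr (dit f K w v) <= 1 / 64 * nr v) ->
  iter (q * K) f w = w /\ forall v, nr (dit f (q * K) w v) <= (1 / 64) ^+ q * nr v.
Proof.
move=> fw hd; elim: q => [|q [IH1 IH2]].
  by split => // v; rewrite mul0n dit0 expr0 mul1r.
rewrite mulSn iterD IH1; split => // v; rewrite (ditD H) IH1.
apply: le_trans (hd _) _; rewrite exprS -[X in _ <= X]mulrA.
by apply: ler_wpM2l (IH2 v); rewrite divr_ge0.
Qed.

Lemma common_period : exists m : nat, [/\ (0 < m)%N,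
  forall w, A w -> iter m f w = w &
  forall w, A w -> forall v, nr (dit f m w v) <= 1 / 64 * nr v].
Proof.
(* A factorial (j + 1)! is a multiple of any period K <= j, so the property holds from the index K
   on. *)
have [|j hj] := uniform_A (P := fun j w => iter j.+1`! f w = w /\
    forall v, nr (dit f j.+1`! w v) <= 1 / 64 * nr v).
  move=> w /sink_A[K [K0 fw hd]]; exists K => j Kj.
  have /dvdnP[q E] : (K %| j.+1`!)%N by rewrite dvdn_fact // K0 leqW.
  have q0 : (0 < q)%N by case: q E => //; rewrite mul0n => E; have := fact_gt0 j.+1; rewrite E.
  have [h1 h2] := sink_mul q fw hd; rewrite E; split => // v.
  apply: le_trans (h2 v) _; apply: ler_wpM2r; first exact: nr_ge0.
  by case: q q0 {E h1 h2} => // q _; rewrite exprS ler_piMr ?divr_ge0 // exprn_ile1 //; lra.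
by exists j.+1`!; rewrite fact_gt0; split => // w /hj[].
Qed.

Lemma common_diff_bound : exists2 L : R, 0 < L &
  forall w, A w -> forall k v, nr (dit f k w v) <= L * nr v.
Proof.
have [|j hj] := uniform_A (P := fun j w => forall k v, nr (dit f k w v) <= j.+1%:R * nr v).
  move=> w [_ /(interior_Kp_diff H)[L L0 hL]]; exists (Num.bound L) => j Lj k v.
  rewrite ditE; apply: le_trans (hL k v) _; apply: ler_wpM2r; first exact: nr_ge0.
  apply: le_trans (ltW (archi_boundP (ltW L0))) _.
  by rewrite ler_nat leqW.
by exists j.+1%:R.
Qed.

Lemma bernoulli (x : R) m : 0 <= x <= 1 -> 1 - m%:R * x <= (1 - x) ^+ m.
Proof.
move=> /andP[x0 x1]; elim: m => [|m IH]; first by rewrite expr0 mul0r subr0.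
have x1' : 0 <= 1 - x by lra.
have h := ler_wpM2l x1' IH; rewrite exprS; apply: le_trans h.
have hm : 0 <= m%:R * (x * x) by rewrite !mulr_ge0.
by rewrite -natr1; lra.
Qed.

Lemma contracting_A : exists c mu : R, [/\ 0 < c, 0 < mu < 1 &
  forall k p v, A p -> nr (dit f k p v) <= c * mu ^+ k * nr v].
Proof.
have [m [m0 fm dm]] := common_period; have [L L0 hL] := common_diff_bound.
have m1 : 1 <= m%:R :> R by rewrite ler1n.
have m2 : 0 < (2 * m%:R)^-1 :> R by rewrite invr_gt0; lra.
have m3 : (2 * m%:R)^-1 <= 2^-1 :> R by rewrite lef_pV2 ?posrE //; lra.
(* By Bernoulli mu^m >= 1/2, which makes mu a rate for single iterates; rounding k up to a multiple
   of m costs the factor 2 in the constant. *)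
pose mu : R := 1 - (2 * m%:R)^-1.
have mu0 : 0 < mu by rewrite /mu; lra.
have mu1 : mu < 1 by rewrite /mu; lra.
have mum : 1 / 2 <= mu ^+ m.
  apply: le_trans (bernoulli m _); last by lra.
  have -> : m%:R * (2 * m%:R)^-1 = 2^-1 :> R by field; lra.
  lra.
exists (2 * L), mu; split; [by rewrite mulr_gt0|by rewrite mu0|move=> k p v Ap].
rewrite {1}(divn_eq k m) addnC (ditD H).
apply: le_trans (hL _ _ _ _) _.
  by have [-> _] := sink_mul (k %/ m) (fm p Ap) (dm p Ap).
have [_ h] := sink_mul (k %/ m) (fm p Ap) (dm p Ap).
apply: le_trans (ler_wpM2l (ltW L0) (h v)) _.
have -> : 2 * L * mu ^+ k * nr v = L * (2 * mu ^+ k * nr v) by ring.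
apply: ler_wpM2l (ltW L0) _ _ _; apply: ler_wpM2r; first exact: nr_ge0.
have h1 : mu ^+ ((k %/ m).+1 * m) <= mu ^+ k.
  by apply: ler_wiXn2l; [exact: ltW|exact: ltW|rewrite ltnW // ltn_ceil].
have h2 : (1 / 2) ^+ (k %/ m).+1 <= mu ^+ ((k %/ m).+1 * m).
  rewrite mulnC exprM; apply: lerXn2r mum; rewrite nnegrE; first by lra.
  exact: exprn_ge0 (ltW mu0).
have h3 : (1 / 64) ^+ (k %/ m) <= (1 / 2) ^+ (k %/ m) :> R.
  by rewrite lerXn2r ?nnegrE //; lra.
by move: h2; rewrite exprS; lra.
Qed.

End Sinks.

(** * Gluing the splittings *)

Section Gluing.
Variables (R : realType) (n : nat).
Local Notation C := (Cplx R).
Local Notation V := 'rV[C]_n.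

Lemma subbundle_zero (A : set V) : subbundle A (fun=> [set 0]).
Proof.
move=> p Ap; exists setT; split; first exact: filterT.
exists 0%N, (fun _ _ => 0); split => [[]//|q _ comb].
have comb0 a : comb a = 0 by rewrite /comb big_ord0.
split; first by move=> a b _; rewrite !thinmx0.
by apply/seteqP; split => [_ ->|_ [a _ <-]]; [exists 0|rewrite comb0].
Qed.

Lemma sum_delta (x : 'I_n -> C) m : \sum_k x k * (m == k)%:R = x m.
Proof.
rewrite (bigD1 m) // eqxx mulr1 big1 => [|j jm]; first exact: addr0.
by rewrite eq_sym (negbTE jm) mulr0.
Qed.

(** Fibres are real, so the frame has 2n vectors: the unit vectors and their multiples by i. *)
Lemma subbundle_full (A : set V) : subbundle A (fun=> setT).
Proof.
move=> p Ap; exists setT; split; first exact: filterT.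
pose e (i : 'I_(n + n)) : V :=
  match fintype.split i with inl j => delta_mx 0 j | inr j => (Complex 0 1 : C) *: delta_mx 0 j end.
exists (n + n)%N, (fun i _ => e i); split => [i|q _ comb].
  by move=> z; exact: cvg_cst.
have combE a : comb a = \row_m (Complex (a 0 (lshift n m)) (a 0 (rshift n m)) : C).
  rewrite /comb big_split_ord /=; apply/rowP => m; rewrite mxE [LHS]mxE !summxE.
  transitivity (ofR (a 0 (lshift n m)) + ofR (a 0 (rshift n m)) * (Complex 0 1 : C)).
    congr (_ + _).
      rewrite -(sum_delta (fun k => ofR (a 0 (lshift n k))) m); apply: eq_bigr => j _.
      by rewrite /e (fintype.unsplitK (inl j)) !mxE eqxx.
    rewrite -(sum_delta (fun k => ofR (a 0 (rshift n k)) * (Complex 0 1 : C)) m).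
    apply: eq_bigr => j _.
    by rewrite /e (fintype.unsplitK (inr j)) !mxE eqxx mulrA.
  by apply/eqP; rewrite eq_complex /= !(mulr0, mul0r, mulr1, addr0, add0r, subr0) !eqxx.
split.
  move=> a b; rewrite !combE => /rowP E; apply/rowP => i; rewrite -(fintype.splitK i).
  by case: (fintype.split i) => j; have := E j; rewrite !mxE => -[].
apply/seteqP; split => // v _.
exists (row_mx (\row_j complex.Re (v 0 j)) (\row_j complex.Im (v 0 j))); first by [].
rewrite combE; apply/rowP => j; rewrite mxE row_mxEl row_mxEr !mxE.
by case: (v 0 j).
Qed.

Definition glue (J : set V) (E E' : V -> set V) p := if p \in J then E p else E' p.

Lemma glue_in J E E' p : J p -> glue J E E' p = E p.
Proof. by move=> Jp; rewrite /glue mem_set. Qed.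

Lemma glue_out J E E' p : ~ J p -> glue J E E' p = E' p.
Proof. by move=> Jp; rewrite /glue memNset. Qed.

Variables (J A : set V) (c : R).
Hypotheses (c0 : 0 < c) (far : forall x, A x -> ~ near_set J c x).

Lemma far_notin x : A x -> ~ J x.
Proof. by move=> Ax Jx; apply: (far Ax); exists x => //; rewrite subrr nr0 ltW. Qed.

(** A ball of radius c around a point of one set misses the other, so local frames carry over. *)
Lemma subbundle_glue E E' : subbundle J E -> subbundle A E' ->
  subbundle (J `|` A) (glue J E E').
Proof.
have ball (p : V) : nbhs p [set q : V | nr (q - p) < c] by apply/nbhs_nrP; exists c.
move=> sE sE' p [Jp|Ap].
  have [U [Up [k [e [ec he]]]]] := sE p Jp.
  exists (U `&` [set q | nr (q - p) < c]); split; first exact: filterI Up (ball p).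
  have sub : (J `|` A) `&` (U `&` [set q | nr (q - p) < c]) `<=` J `&` U.
    by move=> q [[Jq|Aq] [Uq qp]] //; case: (far Aq); exists p => //; exact: ltW.
  exists k, e; split=> [i|q /sub[Jq Uq]]; first exact: continuous_subspaceW sub (ec i).
  by rewrite (glue_in _ _ Jq); apply: he.
have [U [Up [k [e [ec he]]]]] := sE' p Ap.
exists (U `&` [set q | nr (q - p) < c]); split; first exact: filterI Up (ball p).
have sub : (J `|` A) `&` (U `&` [set q | nr (q - p) < c]) `<=` A `&` U.
  move=> q [[Jq|Aq] [Uq qp]] //; case: (far Ap); exists q => //.
  by rewrite nrB; exact: ltW.
exists k, e; split=> [i|q /sub[Aq Uq]]; first exact: continuous_subspaceW sub (ec i).
by rewrite (glue_out _ _ (far_notin Aq)); apply: he.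
Qed.

Variables (f g : V -> V) (M : R).
Hypothesis H : escape f g M.
Hypotheses (fJ : f @` J = J) (fA : f @` A = A).

Lemma invariant_glue E E' : invariant_bundle f J E -> invariant_bundle f A E' ->
  invariant_bundle f (J `|` A) (glue J E E').
Proof.
move=> iE iE' p [Jp|Ap].
  have Jf : J (f p) by rewrite -fJ; exists p.
  by rewrite !glue_in //; exact: iE.
have Af : A (f p) by rewrite -fA; exists p.
by rewrite !(glue_out _ _ (far_notin _)) //; exact: iE'.
Qed.

Lemma hyperbolic_glue Eu Es : hyperbolic_data f J Eu Es ->
  contracting f A (fun=> setT) ->
  hyperbolic_data f (J `|` A) (glue J Eu (fun=> [set 0])) (glue J Es (fun=> setT)).
Proof.
move=> [[su ss spl] [iu is_ /expandingP[a [mu [a0 mu1 hu]]]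
  /contractingP[c1 [mu' [c10 /andP[mu'0 mu'1] hs]]]]].
move=> /contractingP[c2 [nu [c20 /andP[nu0 nu1] hA]]].
split; split.
- exact: subbundle_glue su (@subbundle_zero A).
- exact: subbundle_glue ss (@subbundle_full A).
- move=> p [Jp|Ap]; first by rewrite !glue_in //; exact: spl.
  rewrite !(glue_out _ _ (far_notin Ap)) setIT; split => //.
  apply/seteqP; split => // v _; exists 0; first by [].
  by exists v => //; rewrite add0r.
- apply: invariant_glue iu _ => p _; apply/seteqP; split => [_ [_ -> <-]|_ ->].
    exact: linear0.
  by exists 0 => //; exact: linear0.
- apply: invariant_glue is_ _ => p _; apply/seteqP; split => // v _.
  exists (dit g 1 (f p) v); first by [].
  have := dit_cancel H 1 (f p) v.
  by rewrite (_ : iter 1 g (f p) = p) ?dit1 //; exact: es_fK H _.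
- apply/expandingP; exists a, mu; split => // k p v [Jp|Ap].
    by rewrite glue_in //; exact: hu.
  by rewrite (glue_out _ _ (far_notin Ap)) => ->; rewrite ditv0 nr0 mulr0.
- apply/contractingP; exists (c1 + c2), (Num.max mu' nu); split.
  + by rewrite addr_gt0.
  + by rewrite lt_max mu'0 gt_max mu'1.
  have bound b x k (v : V) : 0 < b -> b <= c1 + c2 -> 0 < x -> x <= Num.max mu' nu ->
      b * x ^+ k * nr v <= (c1 + c2) * Num.max mu' nu ^+ k * nr v.
    move=> b0 bc x0 xm; apply: ler_wpM2r; first exact: nr_ge0.
    apply: ler_pM => //; [exact: ltW|exact: exprn_ge0 (ltW x0)|].
    by rewrite lerXn2r ?nnegrE ?(ltW x0) // (le_trans (ltW x0)).
  move=> k p v [Jp|Ap].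
    rewrite glue_in // => Ev; apply: le_trans (hs k p v Jp Ev) _.
    by apply: bound => //; [lra|rewrite le_max lexx].
  rewrite (glue_out _ _ (far_notin Ap)) => Ev; apply: le_trans (hA k p v Ap Ev) _.
  by apply: bound => //; [lra|rewrite le_max lexx orbT].
Qed.

End Gluing.

(** * The nonwandering set as the union of J and the sinks *)

Section Core.
Variables (R : realType) (n : nat).
Local Notation C := (Cplx R).
Local Notation V := 'rV[C]_n.

Lemma hyperbolic_axiomA (f g : V -> V) M (J : set V) : escape f g M ->
  (forall p, J p -> ~ (Kp f)° p) ->
  (forall p, Kp f p -> Kp g p -> ~ (Kp f)° p -> J p) ->
  hyperbolic_set f J -> J `<=` closure (J `&` periodic_points f) -> axiomA f.
Proof.
move=> H LJ Jmax [cJ [fJ [Eu [Es hyp]]]] dense.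
have [F [FU FF]] := free_ultrafilter.
have [r r0 hr] := near_orbit_not_interior FU FF H cJ fJ hyp LJ.
have [c c0 hc] := interior_nw_far FU FF H cJ fJ Jmax hr r0.
pose A : set V := [set x | nw f x /\ (Kp f)° x].
have far x : A x -> ~ near_set J c x by move=> [hx Kx]; exact: hc.
have nwK x : nw f x -> Kp f x /\ Kp g x.
  move=> hx; split; first exact: (nw_bounded H hx).
  exact: (nw_bounded (escape_sym H) (nw_cancel (es_fK H) hx)).
have Jnw : J `<=` nw f.
  apply: subset_trans dense _; rewrite (closure_id (nw f)).1; last exact: nw_closed.
  by apply: closure_subset => p [_ /periodic_nw].
have nwE : nw f = J `|` A.
  apply/seteqP; split => [x hx|x [/Jnw//|[]//]].
  have [Kf Kg] := nwK x hx; have [Kx|nK] := pselect ((Kp f)° x).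
    by right.
  by left; exact: Jmax.
have A_lim (u : nat -> V) x : u @ F --> x -> (forall j, A (u j)) -> A x.
  move=> ux Au; have hx : nw f x.
    apply: (cvg_closed FU (@nw_closed _ _ f) ux).
    by apply: filterS filterT => j _; case: (Au j).
  move: (hx); rewrite {1}nwE => -[Jx|//].
  move/cvg_nrP: ux => /(_ c c0) N; have [j /= hj] := filter_ex N.
  by case: (far _ (Au j)); exists x => //; exact: ltW.
have fnw : f @` nw f = nw f.
  apply/seteqP; split => [_ [x hx <-]|x hx]; first exact: nw_step (es_fc H) hx.
  exists (g x); last exact: es_gK H _.
  apply: (nw_cancel (es_gK H)); apply: nw_step (es_gc H) _.
  exact: nw_cancel (es_fK H) _ hx.
(* A is the complement of J in the nonwandering set, and both are invariant under the injective map
   [f]. *)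
have fA : f @` A = A.
  have inj : injective f := can_inj (es_fK H).
  have nJ x : nw f x -> ~ J x -> A x by rewrite {1}nwE => -[].
  have AnJ x : A x -> ~ J x by move=> [_ Kx] /LJ.
  apply/seteqP; split => [_ [x Ax <-]|x Ax].
    apply: nJ; first by apply: nw_step (es_fc H) _; case: Ax.
    by rewrite -fJ => -[y Jy /inj E]; apply: (AnJ x Ax); rewrite -E.
  have : nw f x by case: Ax.
  rewrite -{1}fnw => -[y hy E]; exists y; last exact: E.
  apply: (nJ y hy) => Jy; apply: (AnJ x Ax); rewrite -fJ; exists y; [exact: Jy|exact: E].
have cA : contracting f A (fun=> setT).
  apply/contractingP; have [c' [mu [c'0 mu01 h]]] := contracting_A FU FF H A_lim.
  exists c', mu; split; [exact: c'0|exact: mu01|].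
  move=> k p v Ap _; exact: (h k p v Ap).
rewrite /axiomA nonwanderingE; split.
  split.
    apply: (subclosed_compact (@nw_closed _ _ f) (@closed_ball_compact R n M)) => x hx.
    by have [Kf Kg] := nwK x hx; exact: (K_bound H Kf Kg).
  split => //; rewrite nwE.
  eexists; eexists; exact: (hyperbolic_glue c0 far H fJ fA hyp cA).
move=> x; rewrite {1}nwE => -[Jx|Ax].
  apply: (closure_subset _ (dense x Jx)) => p [/Jnw hp pp]; by split.
apply: subset_closure; split; first by case: Ax.
by have [K [K0 fK _]] := sink_A FU FF H A_lim Ax; exists K.
Qed.

End Core.

(** * Exchange of the automorphism and its inverse *)

Section AxiomA.
Variables (R : realType) (n : nat).
Local Notation C := (Cplx R).
Local Notation V := 'rV[C]_n.
Implicit Types f : polyaut R n.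

Lemma pa_inv_inv f : pa_inv (pa_inv f) = f.
Proof. by case: f. Qed.

Lemma regular_inv f : regular f -> regular (pa_inv f).
Proof. by move=> [d I]; split; [exact: pa_deg_inv|rewrite pa_inv_inv setIC]. Qed.

Lemma Julia_inv f : Julia (pa_inv f) = Julia f.
Proof. by rewrite /Julia pa_inv_inv; exact: setIC. Qed.

Lemma JuliaE f M : escape (pa_fun f) (pa_fun (pa_inv f)) M ->
  Julia f = (Kp (pa_fun f) `\` (Kp (pa_fun f))°) `&`
    (Kp (pa_fun (pa_inv f)) `\` (Kp (pa_fun (pa_inv f)))°).
Proof.
move=> H; rewrite /Julia /Jplus !KplusE.
by rewrite -!(closure_id _).1; [|exact: Kp_closed (escape_sym H)|exact: Kp_closed H].
Qed.

Lemma periodic_inv f g : cancel (pa_fun f) (pa_fun g) ->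
  periodic_points (pa_fun f) `<=` periodic_points (pa_fun g).
Proof.
move=> fK p [k k0 kp]; exists k => //.
by rewrite -{1}kp iter_cancel.
Qed.

Lemma hyperbolic_set_inv (f g : V -> V) M L : escape f g M ->
  hyperbolic_set f L -> hyperbolic_set g L.
Proof.
move=> H [cL [fL [Eu [Es hyp]]]].
have [gL _] : g @` L = L /\ invariant_bundle g L Eu.
  by apply: (invariant_inv H fL); case: hyp => _ [].
split => //; split => //; exists Es, Eu.
exact: (hyperbolic_data_inv H fL hyp).
Qed.

Lemma hyperbolic_inv f : regular f -> hyperbolic f -> hyperbolic (pa_inv f).
Proof.
move=> /regular_escape[M H] [hs dense]; rewrite /hyperbolic Julia_inv; split.
  exact: (hyperbolic_set_inv H hs).
apply: subset_trans dense _; apply: closure_subset => p [Jp pp]; split => //.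
by apply: periodic_inv pp; exact: es_fK H.
Qed.

Lemma axiomA_inv f : regular f -> axiomA (pa_fun (pa_inv f)) -> axiomA (pa_fun f).
Proof.
move=> /regular_escape[M H].
have nwE : nonwandering (pa_fun f) = nonwandering (pa_fun (pa_inv f)).
  rewrite !nonwanderingE; apply/seteqP.
  by split; apply: nw_cancel; [exact: es_fK H|exact: es_gK H].
rewrite /axiomA nwE => -[hs dense]; split.
  exact: (hyperbolic_set_inv (escape_sym H) hs).
apply: subset_trans dense _; apply: closure_subset => p [Jp pp]; split => //.
by apply: periodic_inv pp; exact: es_gK H.
Qed.

(** With int K- inside int K+, a point of K outside int K+ is outside int K- too; so J is K minus
    int K+, as [hyperbolic_axiomA] asks. *)
Lemma volume_axiomA f : regular f -> hyperbolic f ->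
  1 <= cmod (jac_det (pa_inv f)) -> axiomA (pa_fun f).
Proof.
move=> freg [hs dense] det1; have [M H] := regular_escape freg.
have int := interior_Kp_sub H (jac_det_expands det1).
have JE := JuliaE H.
apply: (hyperbolic_axiomA H _ _ hs dense) => p; rewrite JE; first by move=> [[_ nf] _].
move=> Kf Kg nf; exact: (conj (conj Kf nf) (conj Kg (fun h => nf (int p h)))).
Qed.

End AxiomA.

Theorem corollary4p5 (R : realType) (n : nat) (hn : (2 <= n)%N)
    (f : polyaut R n) (freg : regular f) (fhyp : hyperbolic f) :
  axiomA (pa_fun f).
Proof.
have [det1|det1] := leP 1 (cmod (jac_det (pa_inv f))).
  exact: volume_axiomA.
apply: (axiomA_inv freg); apply: volume_axiomA.
- exact: regular_inv.
- exact: hyperbolic_inv.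
rewrite pa_inv_inv leNgt; apply/negP => det2.
have := congr1 (@cmod R) (jac_det_inv f); rewrite cmodM cmod1 => E.
have := mulr_ilt1 (cmod_ge0 _) (cmod_ge0 _) det2 det1.
by rewrite E ltxx.
Qed.
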